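(* Let $S_M=(\mathbb C\times\mathbb H)/\Gamma$ be an Inoue–Bombieri surface endowed with the Tricerri lcK metric $\omega_T$, and let $(\tilde S_M,\tilde\omega_T)$ be its Kähler covering. Then $(\tilde S_M,\tilde\omega_T)$ admits a local full Kähler immersion into $\ell^2(\mathbb C)\setminus\{0\}$ with the flat metric, but $(S_M,\omega_T)$ is not Hopf-induced, i.e. it does not admit an lcK immersion into a classical Hopf manifold $H^N_\lambda$, $N\le+\infty$.
   Context: **Inoue–Bombieri surface.** Let $(z,w)$ be coordinates on $\mathbb C\times\mathbb H$, $w=x_2+\sqrt{-1}y_2$, $y_2>0$. Let $A\in\mathrm{SL}(3;\mathbb Z)$ have a real eigenvalue $\lambda_A>1$ and non-real eigenvalues $\mu,\bar\mu$; let $(\ell_1,\ell_2,\ell_3)$ be a real eigenvector for $\lambda_A$ and $(m_1,m_2,m_3)$ an eigenvector for $\mu$. $\Gamma$ is generated by $f_0(z,w)=(\mu z,\lambda_A w)$ and $f_j(z,w)=(z+m_j,w+\ell_j)$, $j=1,2,3$. It acts freely and properly discontinuously with compact quotient $S_M$. **Metrics.** $\omega_T=\sqrt{-1}\,y_2\,dz\wedge d\bar z+\frac{\sqrt{-1}}{4y_2^2}dw\wedge d\bar w$ is lcK on $S_M$ with Lee form $\theta=\frac{dy_2}{y_2}$ ($d\omega_T=\theta\wedge\omega_T$). The covering is $\tilde S_M=(\mathbb C\times\mathbb H)/\langle f_1,f_2,f_3\rangle$ with Kähler form $\tilde\omega_T=y_2^{-1}\omega_T=\sqrt{-1}\,dz\wedge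 d\bar z+\frac{\sqrt{-1}}{4y_2^3}dw\wedge d\bar w$. **Immersions.** A local Kähler immersion is a holomorphic map $F$ from a neighbourhood of each point with $F^*\omega_0=\tilde\omega_T$, where $\omega_0$ is the Kähler form of the flat metric on $\ell^2(\mathbb C)$ (flat forms differing by a positive constant factor are equivalent for this purpose); it is full if its image is not contained in any proper totally geodesic complex submanifold. The classical Hopf manifold is $H^N_\lambda=(\mathbb C^N\setminus\{0\})/\langle\lambda\cdot\mathrm{id}\rangle$, $\lambda\in\mathbb C\setminus\{0\}$, $|\lambda|\ne1$ ($\mathbb C^\infty:=\ell^2(\mathbb C)$), with $\omega_H=\|z\|^{-2}\omega_0$. An lcK immersion is a holomorphic map $f\colon S_M\to H^N_\lambda$ with $f^*\omega_H=\omega_T$. *)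

(* Defs.v *)
From HB Require Import structures.
From mathcomp Require Import all_boot all_order all_algebra.
From mathcomp Require Import complex ring lra.
From mathcomp Require Import all_classical all_reals all_analysis.

Set Implicit Arguments.
Unset Strict Implicit.
Unset Printing Implicit Defensive.

Import Order.TTheory GRing.Theory Num.Theory numFieldNormedType.Exports.

Local Open Scope classical_set_scope.
Local Open Scope ring_scope.

(* R[i] packed as a numClosedFieldType: it then carries the topology and the
   normed C-module structure that the library gives to such fields.  Norms,
   also those of normed spaces over it, take values in it; 'Re' and 'Im' of
   the complex module are R-valued. *)
Definition Cplx (R : realType) : numClosedFieldType := R[i].

Definition abs2 (R : realType) (z : Cplx R) : R :=
  complex.Re z ^+ 2 + complex.Im z ^+ 2.

Definition coord_in (N : option nat) (k : nat) : bool :=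
  if N is Some n then (k < n)%N else true.

Definition l2_pred (R : realType) (N : option nat) : {pred nat -> Cplx R} :=
  fun x => `[< (forall k, ~~ coord_in N k -> x k = 0) /\
               cvgn (series (fun k => abs2 (x k)) : nat -> R) >].

Section Minkowski.
Variable R : realType.
Local Notation C := (Cplx R).
Implicit Types (x y : nat -> C) (z w : C).

Definition sum2 x : nat -> R := series (fun k => abs2 (x k)).

Lemma abs2_ge0 z : 0 <= abs2 z.
Proof. by rewrite addr_ge0 ?sqr_ge0. Qed.

Lemma abs2M z w : abs2 (z * w) = abs2 z * abs2 w.
Proof.
by case: z => a b; case: w => c d; rewrite /abs2 /=; ring.
Qed.

Lemma abs2_eq0 z : abs2 z = 0 -> z = 0.
Proof.
case: z => a b /eqP; rewrite /abs2 /= paddr_eq0 ?sqr_ge0 // !sqrf_eq0.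
by move=> /andP[/eqP -> /eqP ->].
Qed.

Lemma norm_abs2 z : `|z| = (Num.sqrt (abs2 z))%:C%C.
Proof. by case: z => a b. Qed.

Lemma sum2_ge0 x n : 0 <= sum2 x n.
Proof. by rewrite sumr_ge0 // => k _; exact: abs2_ge0. Qed.

Lemma sum2_nd x : {homo sum2 x : n p / (n <= p)%N >-> n <= p}.
Proof.
by apply/nondecreasing_seqP => n; rewrite /sum2 /series /= big_nat_recr //=
  lerDl abs2_ge0.
Qed.

Lemma sum2_le_lim x n : cvgn (sum2 x) -> sum2 x n <= limn (sum2 x).
Proof. by move=> cx; apply: nondecreasing_cvgn_le => //; exact: sum2_nd. Qed.

Lemma abs2D z w :
  abs2 (z + w) <= (Num.sqrt (abs2 z) + Num.sqrt (abs2 w)) ^+ 2.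
Proof.
have := ler_normD z w; rewrite !norm_abs2 -rmorphD /= lecR => h.
by rewrite -[leLHS]sqr_sqrtr ?abs2_ge0 // lerXn2r // nnegrE ?addr_ge0 ?sqrtr_ge0.
Qed.

Lemma minkowski_step (a b s t : R) : 0 <= a -> 0 <= b -> 0 <= s -> 0 <= t ->
  (a + b) ^+ 2 + (s + t) ^+ 2 <=
  (Num.sqrt (a ^+ 2 + s ^+ 2) + Num.sqrt (b ^+ 2 + t ^+ 2)) ^+ 2.
Proof.
move=> a0 b0 s0 t0.
have A0 : 0 <= a ^+ 2 + s ^+ 2 by rewrite addr_ge0 ?sqr_ge0.
have B0 : 0 <= b ^+ 2 + t ^+ 2 by rewrite addr_ge0 ?sqr_ge0.
rewrite [leRHS]sqrrD !sqr_sqrtr //.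
suff : a * b + s * t <= Num.sqrt (a ^+ 2 + s ^+ 2) * Num.sqrt (b ^+ 2 + t ^+ 2).
  move: (Num.sqrt _ * _) => q h.
  rewrite -subr_ge0 (_ : _ - _ = (q - (a * b + s * t)) *+ 2); last by ring.
  by rewrite mulrn_wge0 // subr_ge0.
have h0 : 0 <= a * b + s * t by rewrite addr_ge0 ?mulr_ge0.
rewrite -sqrtrM // -[leLHS]ger0_norm // -sqrtr_sqr ler_wsqrtr //.
rewrite -subr_ge0 (_ : _ - _ = (a * t - b * s) ^+ 2) ?sqr_ge0 //; ring.
Qed.

Lemma sum2D x y n : sum2 (fun k => x k + y k) n <=
  (Num.sqrt (sum2 x n) + Num.sqrt (sum2 y n)) ^+ 2.
Proof.
elim: n => [|n IHn]; first by rewrite {1}/sum2 /series /= big_geq // sqr_ge0.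
have E u : sum2 u n.+1 =
    Num.sqrt (sum2 u n) ^+ 2 + Num.sqrt (abs2 (u n)) ^+ 2.
  rewrite !sqr_sqrtr ?sum2_ge0 ?abs2_ge0 //.
  by rewrite /sum2 /series /= big_nat_recr.
rewrite (E x) (E y) (le_trans _ (minkowski_step _ _ _ _)) ?sqrtr_ge0 //.
by rewrite E !sqr_sqrtr ?sum2_ge0 ?abs2_ge0 // lerD ?abs2D.
Qed.

Lemma sum2D_bound x y n : cvgn (sum2 x) -> cvgn (sum2 y) ->
  sum2 (fun k => x k + y k) n <=
  (Num.sqrt (limn (sum2 x)) + Num.sqrt (limn (sum2 y))) ^+ 2.
Proof.
move=> cx cy; apply: (le_trans (sum2D x y n)).
rewrite lerXn2r // ?nnegrE ?addr_ge0 ?sqrtr_ge0 //.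
by rewrite lerD // ler_wsqrtr // sum2_le_lim.
Qed.

Lemma is_cvg_sum2D x y : cvgn (sum2 x) -> cvgn (sum2 y) ->
  cvgn (sum2 (fun k => x k + y k)).
Proof.
move=> cx cy; apply: nondecreasing_is_cvgn; first exact: sum2_nd.
exists ((Num.sqrt (limn (sum2 x)) + Num.sqrt (limn (sum2 y))) ^+ 2).
by move=> _ [n _ <-]; exact: sum2D_bound.
Qed.

Lemma sum2Z z x : sum2 (fun k => z * x k) = abs2 z *: (sum2 x : nat -> R).
Proof.
apply/funext => n; rewrite /sum2 /series /= fctE /= scaler_sumr.
by apply: eq_bigr => k _; rewrite abs2M.
Qed.

Lemma lim_sum2Z z x : cvgn (sum2 x) ->
  limn (sum2 (fun k => z * x k)) = abs2 z * limn (sum2 x).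
Proof. by move=> cx; rewrite sum2Z limZr. Qed.

Lemma l2_pred_submod N : GRing.submod_closed (@l2_pred R N).
Proof.
split.
  apply/asboolP; split=> //.
  rewrite (_ : series _ = cst 0); first exact: is_cvg_cst.
  by apply/funext => n; rewrite /series /= big1 // => k _; rewrite /abs2 /=; ring.
move=> z x y /asboolP[x0 cx] /asboolP[y0 cy]; apply/asboolP; split.
  move=> k Nk; rewrite -[LHS]/(z * x k + y k).
  by rewrite x0 // y0 // mulr0 addr0.
apply: (@is_cvg_sum2D (fun k => z * x k)) => //; rewrite sum2Z.
exact: is_cvgZr.
Qed.

End Minkowski.

HB.instance Definition _ (R : realType) (N : option nat) :=
  GRing.isSubmodClosed.Build _ _ (@l2_pred R N) (@l2_pred_submod R N).

(* [cspace R (Some n)] is C^n with the Euclidean norm (sequences supported in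
   {0, ..., n - 1}); [cspace R None] is l^2(C). *)
Record cspace (R : realType) (N : option nat) := Cspace {
  coord :> nat -> Cplx R;
  coordP : coord \in @l2_pred R N }.

Section CspaceStructure.
Variables (R : realType) (N : option nat).
Local Notation C := (Cplx R).
Local Notation E := (cspace R N).

HB.instance Definition _ := [isSub for @coord R N].
HB.instance Definition _ := [Choice of E by <:].
HB.instance Definition _ := [SubChoice_isSubZmodule of E by <:].
HB.instance Definition _ := [SubZmodule_isSubLmodule of E by <:].

Definition cspace_norm (x : E) : C :=
  (Num.sqrt (limn (series (fun k => abs2 (x k)) : nat -> R)))%:C%C.

Lemma cvg_cspace (x : E) : cvgn (sum2 x).
Proof. by case: x => x /= /asboolP[]. Qed.

Lemma cspace_normD (x y : E) :
  cspace_norm (x + y) <= cspace_norm x + cspace_norm y.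
Proof.
rewrite -rmorphD /= lecR.
have cx := @cvg_cspace x; have cy := @cvg_cspace y.
rewrite -[leRHS]ger0_norm ?addr_ge0 ?sqrtr_ge0 // -sqrtr_sqr ler_wsqrtr //.
apply: limr_le; first exact: (@is_cvg_sum2D R x y).
by apply: nearW => n; exact: sum2D_bound.
Qed.

Lemma cspace_normZ (z : C) (x : E) :
  cspace_norm (z *: x) = `|z| * cspace_norm x.
Proof.
rewrite norm_abs2 -rmorphM /= -sqrtrM ?abs2_ge0 //; congr (_ %:C%C).
by rewrite -lim_sum2Z //; exact: cvg_cspace.
Qed.

Lemma cspace_norm0_eq0 (x : E) : cspace_norm x = 0 -> x = 0.
Proof.
move=> /complexI /eqP; rewrite sqrtr_eq0 => le0.
apply/val_inj/funext => k /=; apply: abs2_eq0; apply/le_anti.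
rewrite abs2_ge0 andbT; apply: le_trans le0.
apply: (le_trans _ (@sum2_le_lim R x k.+1 (@cvg_cspace x))).
by rewrite /sum2 /series /= big_nat_recr //= lerDr sum2_ge0.
Qed.

HB.instance Definition _ := Lmodule_isNormed.Build C E
  cspace_normD cspace_normZ cspace_norm0_eq0.

End CspaceStructure.

Section Submanifolds.
Variables (R : realType) (E : normedModType (Cplx R)).

(* Near each of its points p, M is the graph over the closed subspace P(E) of a
   holomorphic map h into the closed complement ker P, where P is a continuous
   projection; the values of h outside P(E) are irrelevant. *)
Definition complex_submanifold (M : set E) :=
  forall p, M p -> exists (P : {linear E -> E}) (h : E -> E) (U : set E),
    [/\ continuous P /\ (forall x, P (P x) = P x),
        open U /\ U p,
        (forall x, U x -> differentiable h (P (x - p))),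
        (forall x, U x -> P (h (P (x - p))) = 0) &
        (forall x, U x -> (M x <-> (x - p) - P (x - p) = h (P (x - p))))].

Definition tangent_space (M : set E) (p : E) : set E :=
  [set v | exists gamma : R -> E,
    [/\ gamma 0 = p, (\forall t \near (0 : R), M (gamma t)) &
        (t^-1)%:C%C *: (gamma t - p) @[t --> (0 : R)^'] --> v]].

(* Geodesics of the flat metric are affine lines.  M need not be complete, so
   the lines tangent to it are only required to stay in M for small times. *)
Definition totally_geodesic (M : set E) :=
  forall p v, M p -> tangent_space M p v ->
    \forall t \near (0 : R), M (p + t%:C%C *: v).

(* "Proper" has to mean positive codimension: since completeness is not
   required, every open subset of E is totally geodesic. *)
Definition proper_submanifold (M : set E) :=
  forall p, M p -> tangent_space M p != setT.

Definition full_image (S : set E) :=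
  ~ exists M : set E,
      [/\ complex_submanifold M, totally_geodesic M, proper_submanifold M &
          S `<=` M].

End Submanifolds.

Section Forms.
Variable R : realType.
Local Notation C := (Cplx R).

(* Real 2-forms are given by their values on pairs of tangent vectors; this is
   the value of dz /\ d\bar z on (a, b). *)
Definition dz_dzbar (a b : C) : C := a * b^* - b * a^*.

(* c * sqrt(-1) * \sum_k dz_k /\ d\bar z_k; the factor c > 0 is the
   normalisation of the flat metric. *)
Definition flat_form (c : R) N (u v : cspace R N) : C :=
  c%:C%C * 'i * limn (series (fun k => dz_dzbar (u k) (v k)) : nat -> C).

Definition hopf_form (c : R) N (x u v : cspace R N) : C :=
  `|x| ^- 2 * flat_form c u v.

Definition upper : set (C * C) := [set p | 0 < complex.Im p.2].

Definition tricerri_form (p u v : C * C) : C :=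
  let y : R := complex.Im p.2 in
  'i * y%:C%C * dz_dzbar u.1 v.1
  + 'i / (4 * y ^+ 2)%:C%C * dz_dzbar u.2 v.2.

Definition tricerri_kahler_form (p u v : C * C) : C :=
  ((complex.Im p.2)^-1)%:C%C * tricerri_form p u v.

Definition pullback N (F : C * C -> cspace R N)
    (omega : cspace R N -> cspace R N -> cspace R N -> C) (p u v : C * C) : C :=
  omega (F p) ('d F p u) ('d F p v).

End Forms.

Inductive generated (T : Type) (S : set (T -> T)) : (T -> T) -> Prop :=
| gen_id : generated S idfun
| gen_mul s g : S s -> generated S g -> generated S (s \o g)
| gen_inv s s' g : S s -> cancel s s' -> cancel s' s ->
    generated S g -> generated S (s' \o g).

(* Points of the quotient of X by the group generated by S are orbits; the
   quotient itself is [orbit S @` X]. *)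
Definition orbit (T : Type) (S : set (T -> T)) (p : T) : set T :=
  [set g p | g in generated S].

Section Surface.
Variable R : realType.
Local Notation C := (Cplx R).

Definition f0 (mu : C) (lam : R) (p : C * C) : C * C :=
  (mu * p.1, lam%:C%C * p.2).

Definition ftrans (m : 'cV[C]_3) (ell : 'cV[R]_3) (j : 'I_3) (p : C * C) : C * C :=
  (p.1 + m j 0, p.2 + (ell j 0)%:C%C).

Definition translations m ell : set (C * C -> C * C) := range (ftrans m ell).

Definition Gamma_gens mu lam m ell : set (C * C -> C * C) :=
  f0 mu lam |` translations m ell.

Definition kahler_cover m ell : set (set (C * C)) :=
  orbit (translations m ell) @` @upper R.

Definition cover_preimage m ell (V : set (set (C * C))) : set (C * C) :=
  @upper R `&` orbit (translations m ell) @^-1` V.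

Definition cover_open m ell (V : set (set (C * C))) :=
  V `<=` kahler_cover m ell /\ open (cover_preimage m ell V).

(* F is a full holomorphic map V -> l^2(C) \ {0} pulling the flat form back to
   the Kahler form; C x H -> cover is locally biholomorphic, so both conditions
   on F are tested on its lift to C x H. *)
Definition full_kahler_immersion (c : R) m ell (V : set (set (C * C)))
    (F : set (C * C) -> cspace R None) :=
  let F' := F \o orbit (translations m ell) in
  [/\ (forall p, cover_preimage m ell V p ->
         differentiable F' p /\ F' p != 0),
      (forall p u v, cover_preimage m ell V p ->
         pullback F' (fun=> @flat_form R c None) p u v
         = tricerri_kahler_form p u v) &
      full_image (F @` V)].

Definition has_local_full_kahler_immersion (c : R) m ell :=
  forall x, kahler_cover m ell x ->
  exists (V : set (set (C * C))) (F : set (C * C) -> cspace R None),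
    [/\ V x, cover_open m ell V & full_kahler_immersion c m ell V F].

Definition hopf_gens N (lambda : C) : set (cspace R N -> cspace R N) :=
  [set ( *:%R lambda)].

(* f maps S_M = (C x H)/Gamma to (C^N \ {0})/<lambda>; it is holomorphic and
   pulls the Hopf form back to the Tricerri form, both being tested on local
   lifts g : U -> C^N \ {0} with U open in C x H. *)
Definition lck_immersion (c : R) mu lam m ell N (lambda : C)
    (f : set (C * C) -> set (cspace R N)) :=
  forall p, @upper R p -> exists (U : set (C * C)) (g : C * C -> cspace R N),
    [/\ open U /\ U p, U `<=` @upper R,
        (forall q, U q -> differentiable g q /\ g q != 0),
        (forall q, U q ->
           f (orbit (Gamma_gens mu lam m ell) q) = orbit (hopf_gens lambda) (g q)) &
        (forall q u v, U q ->
           pullback g (@hopf_form R c N) q u v = tricerri_form q u v)].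

Definition hopf_induced (c : R) mu lam m ell :=
  exists (N : option nat) (lambda : C) (f : set (C * C) -> set (cspace R N)),
    [/\ lambda != 0, `|lambda| != 1 & lck_immersion c mu lam m ell lambda f].

End Surface.

(* Main.v *)
Require Import Defs.
From HB Require Import structures.
From mathcomp Require Import all_boot all_order all_algebra.
From mathcomp Require Import complex ring lra.
From mathcomp Require Import all_classical all_reals all_analysis.

Set Implicit Arguments.
Unset Strict Implicit.
Unset Printing Implicit Defensive.

Import Order.TTheory GRing.Theory Num.Theory numFieldNormedType.Exports.

Local Open Scope classical_set_scope.
Local Open Scope ring_scope.

(* Both halves are local.

   Not Hopf-induced: a local lift G(z, w) into C^N satisfies <G_z, G_w> = 0,
   |G_w|^2 = k(w) |G|^2 and |G_z|^2 = k'(w) |G|^2 with k, k' > 0 depending on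
   Im w only.  By orthogonality chi = <G_z, G> is holomorphic in w, so its
   average over a circle |w| = s is chi(z, 0); as chi is the z-derivative of
   |G|^2, the difference between the average of |G(z, .)|^2 over that circle
   and |G(z, 0)|^2 does not depend on z.  It is asymptotic to s^2 |G_w(z, 0)|^2,
   hence |G(z, 0)|^2 is constant in z, which forces G_z(0, 0) = 0 and G(0, 0) = 0.

   Local immersion: with zeta = (w - w0) / (w - conj w0), map (z, w) to
   kappa * (z, a (1 - zeta), a (zeta - zeta^2), a (zeta^2 - zeta^3), ...), where
   kappa^2 = 1 / c and a^2 = 1 / (2 Im w0).  It descends because the lattice of
   translations is discrete: (ell, m, conj m) are eigenvectors of A for distinct
   eigenvalues.  It is full because a totally geodesic submanifold is locally
   affine with closed tangent space, and such a tangent space containing the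
   image contains every basis vector. *)

(** The sequence in the second half comes from a Kähler potential: with y = Im w and y0 = Im w0, the
    function 1/(2y) has mixed derivative 1/(4 y^3), and y = y0 (1 - |zeta|^2) / |1 - zeta|^2 turns
    it into a^2 times the sum of the |(1 - zeta) zeta^k|^2. The identity of forms is checked on
    derivatives, whose inner products solve linear recurrences because the right shift of l^2(C) is
    an isometry.

    The first half starts from bare differentiability of a lift with values in a possibly
    infinite-dimensional space. Cauchy theory is therefore rebuilt on circle means: their derivative
    in the radius vanishes, and limits pass under the integral by dominated convergence. The
    dominating constants are Lipschitz bounds, which the metric relations provide: |G_z| and |G_w|
    are controlled by |G|, which is locally bounded. At the end, the asymptotics used in w are used
    again in z: as |G(z, 0)|^2 is constant, its mean minus its central value is 0, yet asymptotic to
    s^2 |G_z(0, 0)|^2; then |G_z|^2 = k' |G|^2 gives G(0, 0) = 0. *)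

Section RealNorm.
Variable R : realType.
Local Notation C := (Cplx R).

(** Norms of normed C-modules are complex numbers here; taking the real part makes order reasoning
    and limits over [R] available. *)
Definition nrm (V : normedModType C) (x : V) : R := complex.Re `|x|.

Variables (V : normedModType C).
Implicit Types (x y : V) (z : C).

Lemma nrmE x : `|x| = (nrm x)%:C%C.
Proof. by rewrite /nrm RRe_real // realE normr_ge0. Qed.

Lemma nrm_ge0 x : 0 <= nrm x.
Proof. by have := normr_ge0 x; rewrite nrmE lecR. Qed.

Lemma nrmD x y : nrm (x + y) <= nrm x + nrm y.
Proof. by have := ler_normD x y; rewrite !nrmE -rmorphD lecR. Qed.

Lemma nrmN x : nrm (- x) = nrm x.
Proof. by rewrite /nrm normrN. Qed.

Lemma nrmB x y : nrm (x - y) <= nrm x + nrm y.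
Proof. by rewrite (le_trans (nrmD _ _)) // nrmN. Qed.

Lemma nrm_distC x y : nrm (x - y) = nrm (y - x).
Proof. by rewrite -nrmN opprB. Qed.

Lemma nrmZ z x : nrm (z *: x) = nrm z * nrm x.
Proof. by rewrite {1}/nrm normrZ !nrmE -rmorphM. Qed.

Lemma nrmZr (t : R) x : nrm (t%:C%C *: x) = `|t| * nrm x.
Proof.
by rewrite nrmZ; congr (_ * _); rewrite /nrm normc_def /= expr0n addr0 sqrtr_sqr.
Qed.

Lemma nrm0 : nrm (0 : V) = 0.
Proof. by rewrite /nrm normr0. Qed.

Lemma nrm0_eq0 x : nrm x = 0 -> x = 0.
Proof. by move=> x0; apply/normr0_eq0; rewrite nrmE x0. Qed.

Lemma nrm_gt0 x : (0 < nrm x) = (x != 0).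
Proof.
rewrite lt_def nrm_ge0 andbT; congr (~~ _); apply/eqP/eqP => [/nrm0_eq0 //|->].
by rewrite nrm0.
Qed.

Lemma nrm_le_dist x y : nrm x <= nrm y + nrm (x - y).
Proof. by have := nrmD y (x - y); rewrite addrC subrK. Qed.

Lemma near_nrmP (p : V) (Q : set V) : (\forall x \near p, Q x) <->
  exists2 d : R, 0 < d & forall x, nrm (x - p) < d -> Q x.
Proof.
split.
  move=> /nbhs_normP[e /= e0 H].
  have eE : e = (complex.Re e)%:C%C by rewrite RRe_real // realE ltW.
  exists (complex.Re e); first by move: e0; rewrite eE ltcR.
  by move=> x xp; apply: H => /=; rewrite distrC nrmE eE ltcR.
move=> [d d0 H]; apply/nbhs_normP; exists d%:C%C => /=; first by rewrite ltcR.
by move=> x /=; rewrite distrC nrmE ltcR => /H.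
Qed.

Lemma cvg_nrmP (T : Type) (F : set_system T) {FF : Filter F} (f : T -> V) (l : V) :
  f @ F --> l <-> (fun t => nrm (f t - l)) @ F --> (0 : R).
Proof.
split=> H.
  apply/cvgr0Pnorm_lt => e e0.
  have /H : \forall v \near l, nrm (v - l) < e by apply/near_nrmP; exists e.
  rewrite /= nearE /=; apply: (@filterS _ F) => t /=.
  by rewrite ger0_norm ?nrm_ge0.
move=> Q; rewrite -nearE => /near_nrmP[d d0 HQ].
move/cvgr0Pnorm_lt: H => /(_ _ d0); apply: filterS => t /=.
by rewrite ger0_norm ?nrm_ge0 // => /HQ.
Qed.

End RealNorm.

Section ComplexAbsoluteValue.
Variable R : realType.
Local Notation C := (Cplx R).
Implicit Types z w : C.

Lemma nrm_real (t : R) : nrm (t%:C%C : C) = `|t|.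
Proof. by rewrite /nrm normc_def /= expr0n addr0 sqrtr_sqr. Qed.

Lemma nrmM z w : nrm (z * w) = nrm z * nrm w.
Proof. exact: (nrmZ z w). Qed.

Lemma nrm1 : nrm (1 : C) = 1.
Proof. by have := nrm_real 1; rewrite normr1. Qed.

Lemma nrmV z : nrm z^-1 = (nrm z)^-1.
Proof. by rewrite {1}/nrm normfV nrmE -fmorphV. Qed.

Lemma sqr_nrm z : nrm z ^+ 2 = abs2 z.
Proof. by rewrite /nrm norm_abs2 /= sqr_sqrtr ?abs2_ge0. Qed.

Lemma le_Re_nrm z : `|complex.Re z| <= nrm z.
Proof. by have := normc_ge_Re z; rewrite (nrmE (z : C)) lecR. Qed.

Lemma le_Im_nrm z : `|complex.Im z| <= nrm z.
Proof.
rewrite /nrm norm_abs2 /= -sqrtr_sqr ler_wsqrtr // /abs2 lerDr sqr_ge0 //.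
Qed.

Lemma nrm_le_ReIm z : nrm z <= `|complex.Re z| + `|complex.Im z|.
Proof.
rewrite /nrm norm_abs2 /= -[leRHS]ger0_norm ?addr_ge0 // -sqrtr_sqr ler_wsqrtr //.
rewrite /abs2 sqrrD !real_normK ?num_real // addrAC lerDl.
by rewrite mulrn_wge0 // mulr_ge0.
Qed.

Lemma cvg_Re (T : Type) (F : set_system T) {FF : Filter F} (f : T -> C) (l : C) :
  f @ F --> l -> (fun x => complex.Re (f x)) @ F --> complex.Re l.
Proof.
move=> /cvg_nrmP H; apply/subr_cvg0; apply/cvgr0Pnorm_lt => e e0.
move/cvgr0Pnorm_lt: H => /(_ _ e0); apply: filterS => x.
apply: le_lt_trans; rewrite (ger0_norm (nrm_ge0 _)) (le_trans _ (le_Re_nrm _)) //.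
by rewrite raddfB.
Qed.

Lemma cvg_Im (T : Type) (F : set_system T) {FF : Filter F} (f : T -> C) (l : C) :
  f @ F --> l -> (fun x => complex.Im (f x)) @ F --> complex.Im l.
Proof.
move=> /cvg_nrmP H; apply/subr_cvg0; apply/cvgr0Pnorm_lt => e e0.
move/cvgr0Pnorm_lt: H => /(_ _ e0); apply: filterS => x.
apply: le_lt_trans; rewrite (ger0_norm (nrm_ge0 _)) (le_trans _ (le_Im_nrm _)) //.
by rewrite raddfB.
Qed.

Lemma cvg_real_complex (T : Type) (F : set_system T) {FF : Filter F} (f : T -> R) (l : R) :
  f @ F --> l -> (fun x => (f x)%:C%C : C) @ F --> (l%:C%C : C).
Proof.
move=> H; apply/cvg_nrmP; under eq_fun do rewrite -rmorphB /= nrm_real.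
by apply/cvgr0Pnorm_lt => e e0; move/subr_cvg0/cvgr0Pnorm_lt: H => /(_ _ e0);
  apply: filterS => x; rewrite normr_id.
Qed.

End ComplexAbsoluteValue.

Section ComplexCoordinates.
Variable R : realType.
Local Notation C := (Cplx R).

Lemma cvg_complex (T : Type) (F : set_system T) {FF : Filter F} (f : T -> C) (l : C) :
  (fun x => complex.Re (f x)) @ F --> complex.Re l ->
  (fun x => complex.Im (f x)) @ F --> complex.Im l -> f @ F --> l.
Proof.
move=> /subr_cvg0/cvgr0Pnorm_lt H1 /subr_cvg0/cvgr0Pnorm_lt H2.
apply/cvg_nrmP/cvgr0Pnorm_lt => e e0.
have e20 : 0 < e / 2 by rewrite divr_gt0.
move: (H1 _ e20) (H2 _ e20); apply: filterS2 => t h1 h2.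
rewrite ger0_norm ?nrm_ge0 // (le_lt_trans (nrm_le_ReIm _)) // [e]splitr.
by rewrite ltrD // raddfB.
Qed.

Lemma conjCE (z : C) : z^* = conjc z.
Proof. by []. Qed.

Lemma nrm_conj (z : C) : nrm z^* = nrm z.
Proof. by rewrite /nrm norm_conjC. Qed.

Lemma nrm_i : nrm ('i%C : C) = 1.
Proof. by rewrite /nrm normc_def /= expr0n expr1n add0r sqrtr1. Qed.

End ComplexCoordinates.

Lemma seriesD (R : numFieldType) (f g : nat -> R) :
  series (fun k => f k + g k) = (series f : nat -> R) + series g.
Proof. by apply/funext => n; rewrite !fctE /series /= big_split. Qed.

Lemma seriesZ (R : numFieldType) (t : R) (f : nat -> R) :
  series (fun k => t * f k) = t *: (series f : nat -> R).
Proof. by apply/funext => n; rewrite !fctE /series /= scaler_sumr. Qed.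

(** * The real and Hermitian inner products of C^n and l^2(C) *)

Section InnerProduct.
Variables (R : realType) (N : option nat).
Local Notation C := (Cplx R).
Local Notation E := (cspace R N).
Implicit Types (x y v : E) (z w : C).

Definition rdot z w : R :=
  complex.Re z * complex.Re w + complex.Im z * complex.Im w.

(** The real part of the Hermitian product [hip]. Flat forms are expressed through it alone, as
    [ip x (i y)]. *)
Definition ip x y : R := limn (series (fun k => rdot (x k) (y k)) : nat -> R).

Lemma sqr_cnrm x : nrm x ^+ 2 = limn (sum2 x).
Proof.
have: nrm x = Num.sqrt (limn (sum2 x)) by [].
move=> ->; rewrite sqr_sqrtr //.
apply: limr_ge; first exact: cvg_cspace.
by apply: nearW => n; exact: sum2_ge0.
Qed.

Lemma coordD x y k : (x + y : E) k = x k + y k.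
Proof. by []. Qed.

Lemma coordZ z x k : (z *: x : E) k = z * x k.
Proof. by []. Qed.

Lemma coordN x k : (- x : E) k = - x k.
Proof. by []. Qed.

(** Polarization writes the partial sums as combinations of those of |x + y|^2, |x|^2 and |y|^2,
    which converge. *)
Lemma cvg_ip x y : (series (fun k => rdot (x k) (y k)) : nat -> R) @ \oo --> ip x y.
Proof.
suff: cvgn (series (fun k => rdot (x k) (y k)) : nat -> R) by [].
rewrite (_ : series _ = 2^-1 *: ((sum2 (x + y : E) : nat -> R) - sum2 x - sum2 y)).
  apply/cvg_ex; exists (2^-1 * (limn (sum2 (x + y : E)) - limn (sum2 x) - limn (sum2 y))).
  by apply: cvgZr; apply: cvgB; [apply: cvgB|]; exact: cvg_cspace.
apply/funext => n; rewrite !fctE /sum2 /series -!sumrB scaler_sumr.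
apply: eq_bigr => k _; rewrite coordD /rdot /abs2 /GRing.scale.
by case: (x k) => a b; case: (y k) => a' b' /=; field.
Qed.

Lemma ip_unique x y l :
  (series (fun k => rdot (x k) (y k)) : nat -> R) @ \oo --> l -> ip x y = l.
Proof. by move=> h; apply: cvg_lim. Qed.

Lemma ipC x y : ip x y = ip y x.
Proof.
by rewrite /ip; congr (limn (series _)); apply/funext => k; rewrite /rdot; ring.
Qed.

Lemma ipDl x y v : ip (x + y) v = ip x v + ip y v.
Proof.
apply: ip_unique.
rewrite (_ : (fun k => _) = (fun k => rdot (x k) (v k) + rdot (y k) (v k))).
  by rewrite seriesD; apply: cvgD; exact: cvg_ip.
apply/funext => k; rewrite coordD /rdot.
case: (x k) => a b; case: (y k) => a' b'; case: (v k) => a1 b1 /=; ring.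
Qed.

Lemma ipZl (t : R) x v : ip (t%:C%C *: x) v = t * ip x v.
Proof.
apply: ip_unique.
rewrite (_ : (fun k => _) = (fun k => t * rdot (x k) (v k))).
  by rewrite seriesZ; apply: cvgZr; exact: cvg_ip.
apply/funext => k; rewrite coordZ /rdot.
case: (x k) => a b; case: (v k) => a1 b1 /=; ring.
Qed.

Lemma ipNl x v : ip (- x) v = - ip x v.
Proof.
have -> : - x = (-1 : R)%:C%C *: x by rewrite rmorphN rmorph1 scaleN1r.
by rewrite ipZl mulN1r.
Qed.

Lemma ip_ii x y : ip (('i%C : C) *: x) (('i%C : C) *: y) = ip x y.
Proof.
rewrite /ip; congr (limn (series _)); apply/funext => k; rewrite !coordZ /rdot.
by case: (x k) => a b; case: (y k) => a' b' /=; ring.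
Qed.

Lemma ipxx x : ip x x = nrm x ^+ 2.
Proof.
by rewrite sqr_cnrm /ip; congr (limn (series _)).
Qed.

Lemma ipDr x y v : ip v (x + y) = ip v x + ip v y.
Proof. by rewrite ipC ipDl !(ipC _ v). Qed.

Lemma sqr_nrmD x y : nrm (x + y) ^+ 2 = nrm x ^+ 2 + nrm y ^+ 2 + 2 * ip x y.
Proof. by rewrite -!ipxx ipDl !ipDr (ipC y x); ring. Qed.

(** Cauchy-Schwarz is obtained by squaring the triangle inequality, which was proved first when the
    norm was constructed. *)
Lemma ip_le x y : ip x y <= nrm x * nrm y.
Proof.
have := nrmD x y; rewrite -(@ler_pXn2r _ 2) ?nnegrE ?addr_ge0 ?nrm_ge0 //.
rewrite sqr_nrmD; have := nrm_ge0 x; have := nrm_ge0 y; nra.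
Qed.

Lemma norm_ip_le x y : `|ip x y| <= nrm x * nrm y.
Proof.
by rewrite ler_norml ip_le andbT lerNl -ipNl (le_trans (ip_le _ _)) // nrmN.
Qed.

(** The Hermitian product, linear on the left: its imaginary part is forced by Im <x, y> = Re <x, i
    y>. *)
Definition hip x y : C := Complex (ip x y) (ip x (('i%C : C) *: y)).

Lemma hipDl x y v : hip (x + y) v = hip x v + hip y v.
Proof. by rewrite /hip !ipDl. Qed.

Lemma ip_il x y : ip (('i%C : C) *: x) y = - ip x (('i%C : C) *: y).
Proof.
by rewrite -[LHS]ip_ii scalerA -expr2 sqr_i scaleN1r ipNl.
Qed.

Lemma hipZl z x v : hip (z *: x) v = z * hip x v.
Proof.
have -> : z *: x = (complex.Re z)%:C%C *: x + (complex.Im z)%:C%C *: (('i%C : C) *: x).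
  by rewrite {1}[z]complexE scalerDl scalerA [(_ *i)%C * _]mulrC.
rewrite hipDl /hip !ipZl ip_il ip_ii.
by case: z => a b; apply/eqP; rewrite eq_complex /=; apply/andP; split; apply/eqP; ring.
Qed.

Lemma hipC x y : hip y x = (hip x y)^*.
Proof. by rewrite /hip conjCE /= ipC; congr Complex; rewrite ipC ip_il. Qed.

Lemma hipDr x y v : hip v (x + y) = hip v x + hip v y.
Proof. by rewrite hipC hipDl rmorphD /= (hipC x v) (hipC y v). Qed.

Lemma hipZr z x v : hip v (z *: x) = z^* * hip v x.
Proof. by rewrite hipC hipZl rmorphM /= (hipC x v). Qed.

Lemma hipNl x v : hip (- x) v = - hip x v.
Proof. by rewrite -[- x]scaleN1r hipZl mulN1r. Qed.

Lemma hipNr x v : hip v (- x) = - hip v x.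
Proof. by rewrite hipC hipNl rmorphN /= (hipC x v). Qed.

Lemma hipxx x : hip x x = (nrm x ^+ 2)%:C%C.
Proof.
rewrite /hip ipxx; congr Complex.
by have := ip_il x x; rewrite ipC; lra.
Qed.

(** The factor 2 comes from bounding real and imaginary parts separately. It reappears in the
    numerical constants of the Cauchy estimates below. *)
Lemma nrm_hip_le x y : nrm (hip x y) <= 2 * (nrm x * nrm y).
Proof.
rewrite (le_trans (nrm_le_ReIm _)) //= mulr_natl mulr2n lerD ?norm_ip_le //.
by rewrite (le_trans (norm_ip_le _ _)) // nrmZ nrm_i mul1r.
Qed.

(** Each term of the series is 2 i Im (x_k conj y_k), and this imaginary part is the real product of
    x_k with i y_k; the outer factor i produces the minus sign. *)
Lemma flat_formE (c : R) x y :
  flat_form c x y = (- (2 * c) * ip x (('i%C : C) *: y))%:C%C.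
Proof.
rewrite /flat_form (_ : limn _ = (Complex 0 (2 * ip x (('i%C : C) *: y)) : C)).
  rewrite -complexiE; apply/eqP; rewrite eq_complex /=; apply/andP; split; apply/eqP; ring.
apply: cvg_lim => //; apply: cvg_complex => /=.
  rewrite (_ : (fun n => _) = fun=> 0); first exact: cvg_cst.
  apply/funext => n; rewrite /series /= raddf_sum big1 // => k _.
  rewrite /dz_dzbar !conjCE; case: (x k) => a b; case: (y k) => a' b' /=; ring.
rewrite (_ : (fun n => _) =
    series (fun k => 2 * rdot (x k) ((('i%C : C) *: y : E) k))).
  by rewrite seriesZ; apply: cvgZr; exact: cvg_ip.
apply/funext => n; rewrite /series raddf_sum.
apply: eq_bigr => k _; rewrite coordZ /dz_dzbar /rdot !conjCE.
by case: (x k) => a b; case: (y k) => a' b' /=; ring.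
Qed.

End InnerProduct.

(** * Averages over circles *)

Section ZeroDerivative.
Variable R : realType.

Lemma derive0_cst (f : R -> R) (a b : R) :
  (forall x, a < x < b -> is_derive x 1 f 0) ->
  forall x y, a < x < b -> a < y < b -> f x = f y.
Proof.
move=> df.
suff H x y : x <= y -> a < x < b -> a < y < b -> f x = f y.
  move=> x y hx hy; have [xy|/ltW yx] := leP x y; first exact: H.
  by apply/esym/H.
move=> xy hx hy.
have inab z : x <= z <= y -> a < z < b.
  by move=> /andP[? ?]; apply/andP; split; lra.
have cf : {within `[x, y], continuous f}.
  apply: continuous_in_subspaceT => z /set_mem /=; rewrite in_itv /= => /inab/df hz.
  apply: differentiable_continuous; exact/derivable1_diffP.
have dI z : z \in `]x, y[ -> is_derive z 1 f 0.
  by rewrite in_itv /= => /andP[/ltW xz /ltW zy]; apply/df/inab/andP.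
have [z _ /eqP] := MVT_segment xy dI cf.
by rewrite mul0r subr_eq0 => /eqP.
Qed.

(** Dominated convergence is available for sequences, so derivatives of integrals are computed along
    sequences. If the limit failed, choosing a bad point in each ball of radius 1/(n+1) would give a
    bad sequence. *)
Lemma cvg_dnbhs_seq (F : R -> R) (l d : R) : 0 < d ->
  (forall t : nat -> R, (forall n, t n != 0) -> (forall n, `|t n| < d) ->
     t @ \oo --> 0 -> (F \o t) @ \oo --> l) -> F @ 0^' --> l.
Proof.
move=> d0 H.
apply: contrapT => /cvgrPdist_lt/existsNP[e /not_implyP[e0 nH]].
have near_lt (r : R) : 0 < r -> \forall x \near (0 : R), `|x| < r.
  by move=> r0; exact: nbhs0_lt.
have ex n : exists x, [/\ x != 0, `|x| < d, `|x| < n.+1%:R^-1 & e <= `|l - F x|].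
  apply: contrapT => nex; apply: nH; rewrite nearE /dnbhs /within /=.
  have n0 : 0 < n.+1%:R^-1 :> R by rewrite invr_gt0.
  apply: filterS2 (near_lt _ d0) (near_lt _ n0) => x xd xn x0.
  by rewrite ltNge; apply/negP => h; apply: nex; exists x.
have [t tP] := choice ex.
have t0 : t @ \oo --> 0.
  apply/cvgr0Pnorm_lt => r r0.
  have := @cvg_harmonic R; move/cvgr0Pnorm_lt => /(_ _ r0); apply: filterS => n.
  have [_ _ h _] := tP n; rewrite /= ger0_norm ?invr_ge0 //; exact: lt_trans.
have tn0 n : t n != 0 by have [] := tP n.
have td n : `|t n| < d by have [] := tP n.
have /cvgrPdist_lt/(_ e e0)[k _ /(_ k (leqnn k)) /=] := H t tn0 td t0.
by have [_ _ _ h] := tP k; rewrite ltNge h.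
Qed.

Lemma seq_is_derive (f : R -> R) (x l d : R) : 0 < d ->
  (forall t : nat -> R, (forall n, t n != 0) -> (forall n, `|t n| < d) ->
     t @ \oo --> 0 -> (fun n => (f (x + t n) - f x) / t n) @ \oo --> l) ->
  is_derive x 1 f l.
Proof.
move=> d0 H.
have K : (fun h => h^-1 *: ((f \o shift x) (h *: 1) - f x)) @ 0^' --> l.
  apply: (cvg_dnbhs_seq d0) => t tn0 td t0.
  rewrite (_ : _ \o _ = fun n => (f (x + t n) - f x) / t n); first exact: H.
  by apply/funext => n /=; rewrite [_%:A]mulr1 [t n + x]addrC mulrC.
by apply: DeriveDef; [apply/cvg_ex; exists l | apply/cvg_lim].
Qed.

Lemma seq_derive0_cst (f : R -> R) (a b : R) :
  (forall x, a < x < b -> forall t : nat -> R, (forall n, t n != 0) ->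
     (forall n, a < x + t n < b) -> t @ \oo --> 0 ->
     (fun n => (f (x + t n) - f x) / t n) @ \oo --> 0) ->
  forall x y, a < x < b -> a < y < b -> f x = f y.
Proof.
move=> H; apply: derive0_cst => x xab.
have d0 : 0 < Num.min (x - a) (b - x).
  by rewrite lt_min !subr_gt0.
apply: (seq_is_derive d0) => t tn0 td t0.
apply: H => // n; have := td n; rewrite lt_min ltr_norml ltr_norml.
by move=> /andP[/andP[? ?] /andP[? ?]]; apply/andP; split; lra.
Qed.

End ZeroDerivative.

Section CircleIntegral.
Variable R : realType.
Implicit Types u v : R -> R.

(** One condition that is stable under the operations used below and gives continuity, hence
    integrability over a period. *)
Definition lip u := exists M, forall x y, `|u x - u y| <= M * `|x - y|.

(** Not normalised: a mean over the circle appears everywhere multiplied by 2 pi. *)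
Definition circ u : R := \int[lebesgue_measure]_(x in `[0%R, pi *+ 2]) u x.

Lemma lip_continuous u : lip u -> continuous u.
Proof.
move=> [M hM] x; apply/cvgrPdist_lt => e e0.
have M1 : 0 < `|M| + 1 by rewrite ltr_wpDl.
near=> y.
rewrite (le_lt_trans (hM x y)) // (@le_lt_trans _ _ ((`|M| + 1) * `|x - y|)) //.
  by rewrite ler_wpM2r // (le_trans (ler_norm _)) // lerDl.
rewrite mulrC -ltr_pdivlMr //; near: y.
by apply: cvgr_dist_lt => //; rewrite divr_gt0.
Unshelve. all: by end_near. Qed.

Lemma lipD u v : lip u -> lip v -> lip (fun x => u x + v x).
Proof.
move=> [M hM] [K hK]; exists (M + K) => x y.
rewrite mulrDl (le_trans _ (lerD (hM x y) (hK x y))) //.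
by rewrite opprD addrACA ler_normD.
Qed.

Lemma lipZ (c : R) u : lip u -> lip (fun x => c * u x).
Proof.
move=> [M hM]; exists (`|c| * M) => x y.
by rewrite -mulrBr normrM -mulrA ler_wpM2l.
Qed.

Lemma lip_cst (c : R) : lip (fun=> c).
Proof. by exists 0 => x y; rewrite subrr normr0 mul0r. Qed.

Lemma lip_shift u (e : R) : lip u -> lip (fun x => u (x + e)).
Proof.
move=> [M hM]; exists M => x y; rewrite (le_trans (hM _ _)) //.
by rewrite (_ : x + e - (y + e) = x - y) //; ring.
Qed.

Lemma pi2_gt0 : 0 < pi *+ 2 :> R.
Proof. by rewrite pmulrn_lgt0 // pi_gt0. Qed.

Lemma lip_integrable u (a b : R) : lip u ->
  lebesgue_measure.-integrable `[a, b] (EFin \o u).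
Proof.
move=> lu; apply: continuous_compact_integrable; first exact: segment_compact.
by apply: continuous_subspaceT; exact: lip_continuous.
Qed.

Lemma circD u v : lip u -> lip v -> circ (fun x => u x + v x) = circ u + circ v.
Proof. by move=> lu lv; rewrite /circ RintegralD //; exact: lip_integrable. Qed.

Lemma circZ (c : R) u : lip u -> circ (fun x => c * u x) = c * circ u.
Proof. by move=> lu; rewrite /circ RintegralZl //; exact: lip_integrable. Qed.

Lemma circ_cst (c : R) : circ (fun=> c) = c * (pi *+ 2).
Proof.
rewrite /circ Rintegral_cst //; congr (_ * _).
have := @lebesgue_measure_itv R `[0, pi *+ 2].
by rewrite /= lte_fin pi2_gt0 -EFinD subr0 => ->.
Qed.

Lemma circ_le u v : lip u -> lip v -> (forall x, u x <= v x) -> circ u <= circ v.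
Proof.
by move=> lu lv uv; apply: le_Rintegral => //; exact: lip_integrable.
Qed.

Lemma norm_circ_le u K : lip u -> (forall x, `|u x| <= K) ->
  `|circ u| <= K * (pi *+ 2).
Proof.
move=> lu uK; rewrite -circ_cst ler_norml; apply/andP; split.
  rewrite -mulN1r -circZ; last exact: lip_cst.
  apply: circ_le => //; first by apply: lipZ; exact: lip_cst.
  by move=> x; rewrite mulN1r; have := uK x; rewrite ler_norml => /andP[].
apply: circ_le => //; first exact: lip_cst.
by move=> x; rewrite (le_trans (ler_norm _)).
Qed.

Lemma circ_dct (u : nat -> R -> R) v (K : R) : (forall n, lip (u n)) -> lip v ->
  (forall n x, `|u n x| <= K) -> (forall x, (fun n => u n x) @ \oo --> v x) ->
  (fun n => circ (u n)) @ \oo --> circ v.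
Proof.
move=> lu lv uK uv.
pose I : set (measurableTypeR R) := `[0%R, pi *+ 2]%classic.
have mI : measurable I by exact: measurable_itv.
have mf w (lw : lip w) := measurable_int _ (@lip_integrable w 0 (pi *+ 2) lw).
have := @dominated_convergence _ _ R lebesgue_measure I mI
  (fun n => EFin \o u n) (EFin \o v) (EFin \o (fun=> K)) (fun n => mf _ (lu n)) (mf _ lv).
case.
- by apply: aeW => x _ /=; apply/cvg_EFin; [exact: nearW | exact: uv].
- exact/lip_integrable/lip_cst.
- by apply: aeW => x n _ /=; rewrite lee_fin.
move=> _ _ H.
have fin w : lip w -> (\int[lebesgue_measure]_(x in I) (w x)%:E)%E
   = (circ w)%:E.
  by move=> lw; rewrite /circ /Rintegral fineK //; apply: integrable_fin_num => //;
    exact: lip_integrable.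
rewrite fin // in H; move/fine_cvgP: H => [_]; apply: cvg_trans.
by apply: near_eq_cvg; apply: nearW => n.
Qed.

(** With a primitive [U] of u, the integral of the shift by c is U(c + 2 pi) - U(c), whose
    derivative in c vanishes by periodicity; compare c = e and c = 0. *)
Lemma circ_shift u (e : R) : lip u -> (forall x, u (x + pi *+ 2) = u x) ->
  circ (fun x => u (x + e)) = circ u.
Proof.
move=> lu pu.
(* The interval has room on both sides, so that 0, e and their translates by 2 pi are interior
   points. *)
pose a : R := - `|e| - 1; pose b : R := pi *+ 2 + `|e| + 1.
have e0 := normr_ge0 e; have p0 := pi2_gt0.
have ae : a < e by rewrite /a; have := ler_norm (- e); rewrite normrN; lra.
have eb : e + pi *+ 2 < b by rewrite /b; have := ler_norm e; lra.
have cu := lip_continuous lu.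
pose U (x : R) : R := \int[lebesgue_measure]_(t in `[a, x]) u t.
have dU x : a < x < b -> is_derive x 1 U (u x).
  move=> /andP[ax xb].
  have [d1 d2] := @continuous_FTC1_closed R u a x b xb (lip_integrable _ _ lu) ax (cu x).
  by apply: DeriveDef; [exact: d1|rewrite -derive1E; exact: d2].
have cU x : a < x < b -> {for x, continuous U}.
  move=> /dU hx; apply: differentiable_continuous; exact/derivable1_diffP.
have V c : a < c -> c + pi *+ 2 < b ->
    circ (fun x => u (x + c)) = U (c + pi *+ 2) - U c.
  move=> ac cb.
  have lc := lip_shift c lu.
  have inab x : 0 <= x <= pi *+ 2 -> a < x + c < b by move=> /andP[? ?]; lra.
  have dUc x : 0 <= x <= pi *+ 2 -> is_derive x 1 (fun x => U (x + c)) (u (x + c)).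
    move=> /inab /dU hx.
    have hs : is_derive x 1 (shift c) 1 by exact: is_derive_shift.
    by have := @is_derive1_comp R U (shift c) x _ 1 hx hs; rewrite mulr1.
  have cUc x : 0 <= x <= pi *+ 2 -> {for x, continuous (fun x => U (x + c))}.
    move=> /dUc hx; apply: differentiable_continuous; exact/derivable1_diffP.
  rewrite /circ /Rintegral (@continuous_FTC2 _ _ (fun x => U (x + c)) 0 (pi *+ 2) p0) /=.
  - by rewrite add0r [pi *+ 2 + c]addrC.
  - by apply: continuous_subspaceT; exact: lip_continuous.
  - split.
    + by move=> x; rewrite in_itv /= => /andP[/ltW ? /ltW ?]; have [] := dUc x _ => //; apply/andP.
    + by apply: cvg_at_right_filter; apply: cUc; rewrite lexx ltW.
    + by apply: cvg_at_left_filter; apply: cUc; rewrite lexx ltW.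
  - move=> x; rewrite in_itv /= => /andP[/ltW ? /ltW ?].
    by rewrite derive1E; apply: (@derive_val _ _ _ _ _ _ _ (dUc _ _)); apply/andP.
have p2 := pi2_gt0; have na : a < 0 by rewrite /a; lra.
have pb : 0 + pi *+ 2 < b by rewrite /b; lra.
rewrite V //.
have -> : circ u = circ (fun x => u (x + 0)) by congr circ; apply/funext => x; rewrite addr0.
rewrite V //.
apply: (@derive0_cst R (fun x => U (x + pi *+ 2) - U x) a (b - pi *+ 2)); last 2 first.
- by apply/andP; split; lra.
- by apply/andP; split; lra.
move=> x /andP[ax xb].
have h1 : is_derive x 1 U (u x) by apply: dU; apply/andP; split; lra.
have h2 : is_derive (x + pi *+ 2) 1 U (u (x + pi *+ 2)) by apply: dU; apply/andP; split; lra.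
have hs : is_derive x 1 (shift (pi *+ 2)) 1 by exact: is_derive_shift.
have h3 := @is_derive1_comp R U (shift (pi *+ 2)) x _ 1 h2 hs.
have h4 := @is_deriveB _ _ _ _ _ _ _ _ _ h3 h1.
by apply: is_derive_eq h4 _; rewrite mulr1 pu subrr.
Qed.

End CircleIntegral.

(** * Points of the unit circle and complex-valued circle integrals *)

Section Cis.
Variable R : realType.
Local Notation C := (Cplx R).

Definition cis (x : R) : C := Complex (cos x) (sin x).

Lemma cisD x y : cis (x + y) = cis x * cis y.
Proof.
apply/eqP; rewrite eq_complex /= cosD sinD; apply/andP; split; apply/eqP => //.
by ring.
Qed.

Lemma nrm_cis x : nrm (cis x) = 1.
Proof. by rewrite /nrm norm_abs2 /abs2 /= cos2Dsin2 sqrtr1. Qed.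

Lemma cis_neq0 x : cis x != 0.
Proof. by rewrite -nrm_gt0 nrm_cis. Qed.

Lemma cis_periodic x : cis (x + pi *+ 2) = cis x.
Proof. by rewrite /cis cosD2pi sinD2pi. Qed.

Lemma derive_le1_lip (f df : R -> R) : (forall x : R, is_derive x 1 f (df x)) ->
  (forall x, `|df x| <= 1) -> forall x y, `|f x - f y| <= `|x - y|.
Proof.
move=> fd df1.
suff H x y : x <= y -> `|f x - f y| <= `|x - y|.
  move=> x y; have [xy|/ltW yx] := leP x y; first exact: H.
  by rewrite distrC (distrC x); exact: H.
move=> xy.
have cf : {within `[x, y], continuous f}.
  apply: continuous_subspaceT => z.
  by apply: differentiable_continuous; apply/derivable1_diffP; have [] := fd z.
have [z _ e] := MVT_segment xy (fun z _ => fd z) cf.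
by rewrite distrC e normrM (distrC x) ler_piMl.
Qed.

Lemma cis_lip x y : nrm (cis x - cis y) <= 2 * `|x - y|.
Proof.
rewrite (le_trans (nrm_le_ReIm _)) //= mulr_natl mulr2n lerD //.
  apply: (@derive_le1_lip cos (fun x => - sin x)) => z.
  by rewrite normrN sin_max.
apply: (@derive_le1_lip sin cos) => z; exact: cos_max.
Qed.

Lemma cvg_comp_dnbhs (f : R -> R) (l : R) (t : nat -> R) : f @ 0^' --> l ->
  (forall n, t n != 0) -> t @ \oo --> 0 -> (fun n => f (t n)) @ \oo --> l.
Proof.
move=> fl tn t0; have td : t @ \oo --> 0^'.
  move=> P; rewrite /dnbhs /within /= => /t0 /=.
  by move=> [k _ h]; exists k => // n kn; apply: h.
exact: cvg_comp td fl.
Qed.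

Lemma cvg_cis_quotient (t : nat -> R) : (forall n, t n != 0) -> t @ \oo --> 0 ->
  (fun n => (t n)%:C%C^-1 * (cis (t n) - 1)) @ \oo --> ('i%C : C).
Proof.
move=> tn t0.
have E n : ((t n)%:C%C^-1 * (cis (t n) - 1) : C) =
   Complex ((t n)^-1 * (cos (t n) - 1)) ((t n)^-1 * sin (t n)).
  rewrite -fmorphV; apply/eqP; rewrite eq_complex /=; apply/andP.
  by split; apply/eqP; ring.
have D (f : R -> R) (l : R) : is_derive (0 : R) 1 f l ->
    (fun n => (t n)^-1 * (f (t n) - f 0)) @ \oo --> l.
  move=> [df <-]; have := cvg_comp_dnbhs df tn t0.
  rewrite (_ : (fun n => _) = (fun n => (t n)^-1 * (f (t n) - f 0))) //.
  by apply/funext => n; rewrite /= [_%:A]mulr1 addr0.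
under eq_fun do rewrite E.
apply: cvg_complex => /=.
  have := D cos _ (is_derive_cos 0); rewrite sin0 oppr0 cos0; exact.
have := D sin _ (is_derive_sin 0); rewrite sin0 cos0.
by under eq_fun do rewrite subr0.
Qed.

End Cis.

Section SequenceLimits.
Variable R : realType.
Local Notation C := (Cplx R).

Lemma cvgCD (u v : nat -> C) (a b : C) : u @ \oo --> a -> v @ \oo --> b ->
  (fun n => u n + v n) @ \oo --> a + b.
Proof. exact: cvgD. Qed.

Lemma cvgCM (u v : nat -> C) (a b : C) : u @ \oo --> a -> v @ \oo --> b ->
  (fun n => u n * v n) @ \oo --> a * b.
Proof. exact: cvgM. Qed.

Lemma cvgCcst (a : C) : (fun=> a) @ \oo --> a.
Proof. exact: cvg_cst. Qed.

Lemma cvgCV (u : nat -> C) (a : C) : a != 0 -> u @ \oo --> a ->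
  (fun n => (u n)^-1) @ \oo --> a^-1.
Proof. exact: cvgV. Qed.

Lemma cvgC_unique (u : nat -> C) (a b : C) : u @ \oo --> a -> u @ \oo --> b -> a = b.
Proof. by move=> h1 h2; apply: cvg_unique h1 h2; exact: norm_hausdorff. Qed.

Lemma squeeze_nrm (V : normedModType C) (u : nat -> V) (l : V) (v : nat -> R) :
  (forall n, nrm (u n - l) <= v n) -> v @ \oo --> (0 : R) -> u @ \oo --> l.
Proof.
move=> uv /cvgr0Pnorm_lt v0; apply/cvg_nrmP/cvgr0Pnorm_lt => e e0.
apply: filterS (v0 e e0) => n; apply: le_lt_trans.
by rewrite ger0_norm ?nrm_ge0 // (le_trans (uv n)) // ler_norm.
Qed.

End SequenceLimits.

Arguments cvgCcst {R} a.

Section ComplexCircleIntegral.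
Variable R : realType.
Local Notation C := (Cplx R).
Implicit Types f g : R -> C.

Definition clip f := exists M : R, forall x y, nrm (f x - f y) <= M * `|x - y|.

Definition ccirc f : C :=
  Complex (circ (fun x => complex.Re (f x))) (circ (fun x => complex.Im (f x))).

Lemma clip_Re f : clip f -> lip (fun x => complex.Re (f x)).
Proof.
move=> [M hM]; exists M => x y; rewrite (le_trans _ (hM x y)) //.
by rewrite -raddfB le_Re_nrm.
Qed.

Lemma clip_Im f : clip f -> lip (fun x => complex.Im (f x)).
Proof.
move=> [M hM]; exists M => x y; rewrite (le_trans _ (hM x y)) //.
by rewrite -raddfB le_Im_nrm.
Qed.

Lemma clipD f g : clip f -> clip g -> clip (fun x => f x + g x).
Proof.
move=> [M hM] [K hK]; exists (M + K) => x y.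
rewrite mulrDl (le_trans _ (lerD (hM x y) (hK x y))) //.
by rewrite opprD addrACA nrmD.
Qed.

Lemma clipZ (c : C) f : clip f -> clip (fun x => c * f x).
Proof.
move=> [M hM]; exists (nrm c * M) => x y.
by rewrite -mulrBr nrmM -mulrA ler_wpM2l ?nrm_ge0.
Qed.

Lemma clipM (A B : R) f g : clip f -> clip g -> (forall x, nrm (f x) <= A) ->
  (forall x, nrm (g x) <= B) -> clip (fun x => f x * g x).
Proof.
move=> [M hM] [K hK] fA gB; exists (B * M + A * K) => x y.
rewrite (_ : _ - _ = (f x - f y) * g x + f y * (g x - g y)); last by ring.
rewrite (le_trans (nrmD _ _)) // !nrmM mulrDl lerD //.
  by rewrite mulrC -mulrA ler_pM ?nrm_ge0.
by rewrite -mulrA ler_pM ?nrm_ge0.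
Qed.

Lemma clip_cst (c : C) : clip (fun=> c).
Proof. by exists 0 => x y; rewrite subrr nrm0 mul0r. Qed.

Lemma clip_shift f e : clip f -> clip (fun x => f (x + e)).
Proof.
move=> [M hM]; exists M => x y; rewrite (le_trans (hM _ _)) //.
by rewrite (_ : x + e - (y + e) = x - y) //; ring.
Qed.

Lemma clip_cisV : clip (fun x => (cis x)^-1).
Proof.
exists 2 => x y; rewrite (_ : _ - _ = (cis y - cis x) / (cis x * cis y)).
  by rewrite nrmM nrmV nrmM !nrm_cis mulr1 invr1 mulr1 distrC cis_lip.
by field; rewrite !cis_neq0.
Qed.

Lemma ccircD f g : clip f -> clip g -> ccirc (fun x => f x + g x) = ccirc f + ccirc g.
Proof.
move=> lf lg; apply/eqP; rewrite eq_complex /=.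
rewrite -(circD (clip_Re lf) (clip_Re lg)) -(circD (clip_Im lf) (clip_Im lg)); apply/andP.
by split; apply/eqP; congr circ; apply/funext => x; rewrite raddfD.
Qed.

Lemma ccircZ (c : C) f : clip f -> ccirc (fun x => c * f x) = c * ccirc f.
Proof.
move=> lf; have lr := clip_Re lf; have li := clip_Im lf.
case: c => a b; apply/eqP; rewrite eq_complex /=; apply/andP.
rewrite -!mulNr -!circZ // -!circD; do ?exact: lipZ.
by split; apply/eqP; congr circ; apply/funext => x; case: (f x) => c d /=; ring.
Qed.

Lemma ccirc_cst (c : C) : ccirc (fun=> c) = c * (pi *+ 2)%:C%C.
Proof.
rewrite /ccirc !circ_cst; case: c => a b; apply/eqP; rewrite eq_complex /=.
by apply/andP; split; apply/eqP; ring.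
Qed.

Lemma ccirc_shift f (e : R) : clip f -> (forall x, f (x + pi *+ 2) = f x) ->
  ccirc (fun x => f (x + e)) = ccirc f.
Proof.
move=> lf pf; rewrite /ccirc.
rewrite (@circ_shift R (fun x => complex.Re (f x))); last 2 first.
- exact: clip_Re.
- by move=> x; rewrite pf.
rewrite (@circ_shift R (fun x => complex.Im (f x))) //; first exact: clip_Im.
by move=> x; rewrite pf.
Qed.

Lemma ccirc_dct (u : nat -> R -> C) v (K : R) : (forall n, clip (u n)) -> clip v ->
  (forall n x, nrm (u n x) <= K) -> (forall x, (fun n => u n x) @ \oo --> v x) ->
  (fun n => ccirc (u n)) @ \oo --> ccirc v.
Proof.
move=> lu lv uK uv; apply: cvg_complex => /=.
  apply: (@circ_dct R _ _ K) => [n|||x].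
  - exact: clip_Re.
  - exact: clip_Re.
  - by move=> n x; rewrite (le_trans (le_Re_nrm _)).
  - exact: cvg_Re (uv x).
apply: (@circ_dct R _ _ K) => [n|||x].
- exact: clip_Im.
- exact: clip_Im.
- by move=> n x; rewrite (le_trans (le_Im_nrm _)).
- exact: cvg_Im (uv x).
Qed.

Lemma nrm_ccirc_le f (K : R) : clip f -> (forall x, nrm (f x) <= K) ->
  nrm (ccirc f) <= 2 * (K * (pi *+ 2)).
Proof.
move=> lf fK; rewrite (le_trans (nrm_le_ReIm _)) //= mulr_natl mulr2n lerD //.
  apply: norm_circ_le; first exact: clip_Re.
  by move=> x; rewrite (le_trans (le_Re_nrm _)).
apply: norm_circ_le; first exact: clip_Im.
by move=> x; rewrite (le_trans (le_Im_nrm _)).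
Qed.

Lemma seq_derive0_cstC (f : R -> C) (a b : R) :
  (forall x, a < x < b -> forall t : nat -> R, (forall n, t n != 0) ->
     (forall n, a < x + t n < b) -> t @ \oo --> 0 ->
     (fun n => (t n)%:C%C^-1 * (f (x + t n) - f x)) @ \oo --> (0 : C)) ->
  forall x y, a < x < b -> a < y < b -> f x = f y.
Proof.
move=> H x y xab yab; apply/eqP; rewrite eq_complex; apply/andP; split; apply/eqP.
  apply: (@seq_derive0_cst R (fun x => complex.Re (f x)) a b) => // z zab t tn tab t0.
  have h : (fun n => complex.Re ((t n)%:C%C^-1 * (f (z + t n) - f z) : C)) @ \oo --> (0 : R).
  exact: cvg_Re (H z zab t tn tab t0).
move: h;   rewrite (_ : (fun n => _) = (fun n => (complex.Re (f (z + t n)) - complex.Re (f z)) / t n)) //.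
  apply/funext => n; rewrite -fmorphV /=; case: (f _) => p q; case: (f z) => p' q' /=; ring.
apply: (@seq_derive0_cst R (fun x => complex.Im (f x)) a b) => // z zab t tn tab t0.
have h : (fun n => complex.Im ((t n)%:C%C^-1 * (f (z + t n) - f z) : C)) @ \oo --> (0 : R).
  exact: cvg_Im (H z zab t tn tab t0).
move: h; rewrite (_ : (fun n => _) = (fun n => (complex.Im (f (z + t n)) - complex.Im (f z)) / t n)) //.
apply/funext => n; rewrite -fmorphV /=; case: (f _) => p q; case: (f z) => p' q' /=; ring.
Qed.

End ComplexCircleIntegral.

(** * Cauchy theory by differentiating averages *)

Section ComplexDerivative.
Variable R : realType.
Local Notation C := (Cplx R).

(** The error is a sequence inside the parenthesis, so terms with h n = 0 are allowed and increments
    expand without dividing. *)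
Definition cderiv (D : set C) (f : C -> C) (x d : C) :=
  forall h : nat -> C, h @ \oo --> (0 : C) -> (forall n, D (x + h n)) ->
  exists2 e : nat -> C, e @ \oo --> (0 : C) &
    forall n, f (x + h n) = f x + h n * (d + e n).

Lemma cderiv_sub (D D' : set C) (f : C -> C) x d :
  D' `<=` D -> cderiv D f x d -> cderiv D' f x d.
Proof. by move=> DD H h h0 hD; apply: H => // n; exact/DD. Qed.

Definition annulus (a b : R) : set C := [set x | a < nrm x < b].

Definition disc (b : R) : set C := [set x | nrm x < b].

Lemma nrm_polar (r t : R) : 0 <= r -> nrm (r%:C%C * cis t : C) = r.
Proof. by move=> r0; rewrite nrmM nrm_cis mulr1 nrm_real ger0_norm. Qed.

Lemma cancel_i (j p q : C) : j * j = -1 -> p * (q + 0) + j * p * j * (q + 0) = 0.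
Proof.
move=> jj; rewrite !addr0 (_ : _ + _ = (1 + j * j) * (p * q)); last by ring.
by rewrite jj subrr mul0r.
Qed.

Lemma nrm_lip (V : normedModType C) (x y : V) : `|nrm x - nrm y| <= nrm (x - y).
Proof.
rewrite ler_norml; apply/andP; split.
  by have := nrm_le_dist y x; rewrite nrm_distC; lra.
by have := nrm_le_dist x y; lra.
Qed.

Lemma sqr_nrm_lip (V : normedModType C) (x y : V) (A X : R) :
  nrm x <= A -> nrm y <= A -> nrm (x - y) <= X ->
  `|nrm x ^+ 2 - nrm y ^+ 2| <= X * (A + A).
Proof.
move=> xA yA xyX; have s0 : 0 <= nrm x + nrm y by rewrite addr_ge0 ?nrm_ge0.
rewrite subr_sqr normrM (ger0_norm s0) ler_pM ?lerD //.
exact: le_trans (nrm_lip _ _) xyX.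
Qed.

Section MeanOverCircles.
Variables (f df : C -> C) (a b K : R).
Hypothesis a0 : 0 <= a.
Hypothesis f_deriv : forall x, annulus a b x -> cderiv (annulus a b) f x (df x).
Hypothesis f_lip : forall x y, annulus a b x -> annulus a b y ->
  nrm (f x - f y) <= K * nrm (x - y).

Lemma annulus_polar (r t : R) : a < r < b -> annulus a b (r%:C%C * cis t).
Proof.
by move=> /andP[ar rb]; rewrite /annulus /= nrm_polar ?ar // ltW // (le_lt_trans a0).
Qed.

Lemma clip_polar (r : R) : a < r < b -> clip (fun t => f (r%:C%C * cis t)).
Proof.
move=> rab; exists (`|K| * (r * 2)) => x y.
have r0 : 0 <= r by move: rab => /andP[/ltW /(le_trans a0)].
rewrite (le_trans (f_lip (annulus_polar _ rab) (annulus_polar _ rab))) //.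
rewrite -mulrBr nrmM nrm_real ger0_norm // -!mulrA.
rewrite (le_trans (ler_wpM2r _ (ler_norm K))) ?mulr_ge0 ?nrm_ge0 //.
by rewrite ler_wpM2l // ler_wpM2l // cis_lip.
Qed.

(* Since f is complex differentiable, moving radially differs to first order
   from i^-1 times moving along the circle, and the latter does not change the mean. *)
Lemma circle_mean_cst (r s : R) : a < r < b -> a < s < b ->
  ccirc (fun t => f (r%:C%C * cis t)) = ccirc (fun t => f (s%:C%C * cis t)).
Proof.
move: r s; apply: seq_derive0_cstC => x xab t tn tab t0.
have x0 : 0 < x by move: xab => /andP[/(le_lt_trans a0)].
have K0 := normr_ge0 K.
(* The angle whose arc at radius x has length t n, so that radial and angular displacements have the
   same size. *)
pose eps n := t n / x.
have epsn n : eps n != 0 by rewrite mulf_neq0 // invr_neq0 // gt_eqF.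
have eps0 : eps @ \oo --> 0.
  by rewrite -[X in _ --> X](mul0r x^-1); apply: cvgM => //; exact: cvg_cst.
pose F y := f (x%:C%C * cis y).
(* The angular increment is added because its mean is 0 by periodicity: the mean of [u n] is the
   difference quotient of the means, while pointwise the two first-order terms cancel. *)
pose u n y := (t n)%:C%C^-1 * ((f ((x + t n)%:C%C * cis y) - F y)
   + 'i%C * (F (y + eps n) - F y)).
have lF : clip F by exact: clip_polar.
have lN (g : R -> C) : clip g -> clip (fun y => - g y).
  move=> lg; rewrite (_ : (fun y => - g y) = fun y => -1 * g y) ?mulN1r; first exact: clipZ.
  by apply/funext => y; rewrite mulN1r.
have lu1 n : clip (fun y => f ((x + t n)%:C%C * cis y) - F y).
  by apply: clipD; [exact: clip_polar | exact: lN].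
have lu2 n : clip (fun y => F (y + eps n) - F y).
  by apply: clipD; [exact: clip_shift | exact: lN].
have lu n : clip (u n).
  by apply: clipZ; apply: clipD => //; exact: clipZ.
have cN (g : R -> C) : clip g -> ccirc (fun y => - g y) = - ccirc g.
  move=> lg; rewrite (_ : (fun y => - g y) = fun y => -1 * g y) ?ccircZ ?mulN1r //.
  by apply/funext => y; rewrite mulN1r.
have uE n : ccirc (u n) = (t n)%:C%C^-1 * (ccirc (fun y => f ((x + t n)%:C%C * cis y)) - ccirc F).
  rewrite ccircZ; last by apply: clipD => //; exact: clipZ.
  congr (_ * _); rewrite ccircD //; last exact: clipZ.
  rewrite ccircZ // ccircD; [|exact: clip_polar|exact: lN].
  rewrite ccircD; [|exact: clip_shift|exact: lN].
  rewrite !cN // ccirc_shift //; first by rewrite subrr mulr0 addr0.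
  by move=> y; rewrite /F cis_periodic.
suff H : (fun n => ccirc (u n)) @ \oo --> (0 : C).
  by move: H; under eq_fun do rewrite uE.
have -> : (0 : C) = ccirc (fun=> (0 : C)) by rewrite ccirc_cst mul0r.
(* The radial increment contributes |K| and the angular one 2 |K|, where the 2 is the Lipschitz
   constant in [cis_lip]. *)
apply: (@ccirc_dct _ _ _ (3 * `|K|)) => //; first exact: clip_cst.
- move=> n y; rewrite /u nrmM nrmV nrm_real ler_pdivrMl ?normr_gt0 //.
  rewrite (le_trans (nrmD _ _)) // nrmM nrm_i mul1r.
  have h1 : nrm (f ((x + t n)%:C%C * cis y) - F y) <= `|K| * `|t n|.
    apply: le_trans (f_lip (annulus_polar _ (tab n)) (annulus_polar _ xab)) _.
    rewrite -mulrBl nrmM nrm_cis mulr1 -rmorphB nrm_real addrAC subrr add0r.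
    by rewrite ler_wpM2r // ler_norm.
  have h2 : nrm (F (y + eps n) - F y) <= `|K| * (2 * `|t n|).
    apply: le_trans (f_lip (annulus_polar _ xab) (annulus_polar _ xab)) _.
    rewrite (le_trans (ler_wpM2r (nrm_ge0 _) (ler_norm K))) // ler_wpM2l //.
    rewrite -mulrBr nrmM nrm_real (ger0_norm (ltW x0)).
    rewrite -ler_pdivlMl // (le_trans (cis_lip _ _)) // addrAC subrr add0r.
    by rewrite /eps normrM normfV (ger0_norm (ltW x0)) -subr_ge0 (_ : _ - _ = 0) //; ring.
  by rewrite (le_trans (lerD h1 h2)) // -subr_ge0 (_ : _ - _ = 0) //; ring.
- move=> y; pose z : C := x%:C%C * cis y.
  have zA : annulus a b z by exact: annulus_polar.
  pose h1 n : C := (t n)%:C%C * cis y.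
  pose h2 n : C := z * (cis (eps n) - 1).
  have tC : (fun n => (t n)%:C%C : C) @ \oo --> (0 : C).
    by rewrite -(rmorph0 (real_complex R)); exact: cvg_real_complex.
  have h10 : h1 @ \oo --> (0 : C).
    by rewrite -[X in _ --> X](mul0r (cis y)); exact: cvgCM tC (cvgCcst _).
  have q := cvg_cis_quotient epsn eps0.
  have epsC : (fun n => (eps n)%:C%C : C) @ \oo --> (0 : C).
    by rewrite -(rmorph0 (real_complex R)); exact: cvg_real_complex.
  have epsCn n : (eps n)%:C%C != 0 :> C.
    by rewrite -(rmorph0 (real_complex R)) (inj_eq (@complexI R)).
  have h20 : h2 @ \oo --> (0 : C).
    rewrite (_ : h2 = fun n => z * ((eps n)%:C%C * ((eps n)%:C%C^-1 * (cis (eps n) - 1)))).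
      rewrite -[X in _ --> X](mulr0 z) -[X in _ * X](mul0r 'i%C).
      by exact: cvgCM (cvgCcst z) (cvgCM epsC q).
    by apply/funext => n; rewrite mulVKf.
  have E1 n : z + h1 n = (x + t n)%:C%C * cis y by rewrite rmorphD mulrDl.
  have E2 n : z + h2 n = x%:C%C * cis (y + eps n) by rewrite cisD /h2 /z; ring.
  have h1A n : annulus a b (z + h1 n) by rewrite E1; exact: annulus_polar.
  have h2A n : annulus a b (z + h2 n) by rewrite E2; exact: annulus_polar.
  have [e1 e10 fe1] := f_deriv zA h10 h1A.
  have [e2 e20 fe2] := f_deriv zA h20 h2A.
  have uxE n : u n y = cis y * (df z + e1 n) +
      'i%C * cis y * ((eps n)%:C%C^-1 * (cis (eps n) - 1)) * (df z + e2 n).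
    rewrite /u /F -E1 -E2 fe1 fe2 -/z !(addrC (f z)) !addrK.
    rewrite /h1 /h2 /z /eps.
    have tC0 : (t n)%:C%C != 0 :> C.
      by rewrite -(rmorph0 (real_complex R)) (inj_eq (@complexI R)).
    have xC0 : x%:C%C != 0 :> C.
      by rewrite -(rmorph0 (real_complex R)) (inj_eq (@complexI R)) gt_eqF.
    rewrite rmorphM fmorphV; field; by rewrite tC0 xC0.
  have -> : (0 : C) = cis y * (df z + 0) + 'i%C * cis y * 'i%C * (df z + 0).
    by apply/esym/cancel_i; rewrite -expr2 sqr_i.
  under eq_fun do rewrite uxE.
  have l1 := cvgCM (cvgCcst (cis y)) (cvgCD (cvgCcst (df z)) e10).
  have l2 := cvgCM (cvgCcst ('i%C * cis y)) q.
  exact: cvgCD l1 (cvgCM l2 (cvgCD (cvgCcst (df z)) e20)).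
Qed.

End MeanOverCircles.

Section CauchyOnDisc.
Variables (f df : C -> C) (b K : R).
Hypothesis f_deriv : forall x, disc b x -> cderiv (disc b) f x (df x).
Hypothesis f_lip : forall x y, disc b x -> disc b y ->
  nrm (f x - f y) <= K * nrm (x - y).

Lemma disc_polar (r t : R) : 0 <= r < b -> disc b (r%:C%C * cis t).
Proof. by move=> /andP[r0 rb]; rewrite /disc /= nrm_polar. Qed.

Lemma clip_polar_disc (r : R) : 0 < r < b -> clip (fun t => f (r%:C%C * cis t)).
Proof.
move=> rab; apply: (@clip_polar f 0 b K (lexx 0)) => // x y /andP[_ xb] /andP[_ yb].
exact: f_lip.
Qed.

(** The mean is the same on every smaller circle, and on the circle of radius s it differs from the
    central value by O(s). *)
Lemma mean_value (r : R) : 0 < r < b ->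
  ccirc (fun t => f (r%:C%C * cis t)) = f 0 * (pi *+ 2)%:C%C.
Proof.
move=> rb; have [r0 r1] := andP rb; have b0 : 0 < b by exact: lt_trans r0 r1.
have sub : annulus 0 b `<=` disc b by move=> x /andP[].
have cst s : 0 < s < b ->
    ccirc (fun t => f (r%:C%C * cis t)) = ccirc (fun t => f (s%:C%C * cis t)).
  apply: (@circle_mean_cst f df 0 b K (lexx 0)) => //.
    by move=> x xA; apply: (cderiv_sub sub); exact/f_deriv/sub.
  by move=> x y /sub xb /sub yb; exact: f_lip.
apply/eqP; rewrite -subr_eq0 -[_ == 0]negbK -nrm_gt0; apply/negP => pos.
have bd s : 0 < s < b ->
    nrm (ccirc (fun t => f (r%:C%C * cis t)) - f 0 * (pi *+ 2)%:C%C) <=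
    2 * (`|K| * s * (pi *+ 2)).
  move=> sb; have [s0 s1] := andP sb.
  rewrite (cst _ sb) -ccirc_cst -[X in _ - X]mul1r -mulNr -ccircZ; last exact: clip_cst.
  have lf := clip_polar_disc sb.
  rewrite -ccircD //; last by apply: clipZ; exact: clip_cst.
  apply: nrm_ccirc_le.
    by apply: clipD => //; apply: clipZ; exact: clip_cst.
  move=> x; rewrite mulN1r (le_trans (f_lip _ _)) //.
  - by apply: disc_polar; rewrite (ltW s0).
  - by rewrite /disc /= nrm0.
  - by rewrite subr0 (nrm_polar _ (ltW s0)) (ler_wpM2r (ltW s0)) // ler_norm.
have p0 := @pi2_gt0 R; have K0 := normr_ge0 K.
(* With s B at most A / 2, the estimate [bd] gives A <= s B <= A / 2, impossible for A > 0. The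
   added 1 keeps B positive when K = 0. *)
pose B := 2 * (`|K| + 1) * (pi *+ 2).
have B0 : 0 < B by rewrite !mulr_gt0 // ltr_wpDl.
set A := nrm _ in pos bd.
pose s := Num.min (b / 2) (A / 2 / B).
have s0 : 0 < s by rewrite lt_min !divr_gt0.
have sb : s < b by rewrite gt_min ltr_pdivrMr // ltr_pMr // ltr1n.
have := bd s; rewrite s0 sb => /(_ isT).
have : s * B <= A / 2 by rewrite -ler_pdivlMr // ge_min lexx orbT.
rewrite /B; nra.
Qed.

(** Meaningful off 0 only, where division by zero gives the value 0; the derivative at 0 is reached
    through shrinking circles. *)
Definition diff_quotient (z : C) : C := (f z - f 0) / z.

(** The constant blows up as the inner radius a tends to 0, which is why constancy of means is
    proved on annuli and not just on discs. *)
Lemma diff_quotient_lip (a : R) (x y : C) : 0 < a -> annulus a b x -> annulus a b y ->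
  nrm (diff_quotient x - diff_quotient y) <= (2 * `|K| / a) * nrm (x - y).
Proof.
move=> a0 /andP[ax xb] /andP[ay yb].
have x0 : x != 0 by rewrite -nrm_gt0 (lt_trans a0).
have y0 : y != 0 by rewrite -nrm_gt0 (lt_trans a0).
have d0 : disc b 0 by rewrite /disc /= nrm0 (lt_trans a0) // (lt_trans ax).
rewrite (_ : _ - _ = x^-1 * ((f x - f y) - (f y - f 0) / y * (x - y))); last first.
  by rewrite /diff_quotient; field; rewrite x0 y0.
rewrite nrmM nrmV ler_pdivrMl ?nrm_gt0 // (le_trans (nrmB _ _)) // !nrmM nrmV.
have h1 : nrm (f x - f y) <= `|K| * nrm (x - y).
  by rewrite (le_trans (f_lip _ _)) // ler_wpM2r ?nrm_ge0 // ler_norm.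
have h2 : nrm (f y - f 0) / nrm y <= `|K|.
  rewrite ler_pdivrMr ?nrm_gt0 // (le_trans (f_lip _ _)) // subr0.
  by rewrite ler_wpM2r ?nrm_ge0 // ler_norm.
have h3 := ler_wpM2r (nrm_ge0 (x - y)) h2.
rewrite (le_trans (lerD h1 h3)) // mulrA -mulrDl -mulr2n -[_ *+ 2]mulr_natl ler_wpM2r ?nrm_ge0 //.
rewrite mulrCA ler_peMr // ?mulr_ge0 // ler_pdivlMr // mul1r ltW //.
Qed.

Lemma diff_quotient_deriv (x : C) : annulus 0 b x ->
  cderiv (annulus 0 b) diff_quotient x ((df x - diff_quotient x) / x).
Proof.
move=> xA h h0 hA.
have [x0 xb] := andP xA; have xn : x != 0 by rewrite -nrm_gt0.
have hn n : x + h n != 0 by rewrite -nrm_gt0; have /andP[] := hA n.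
have hd n : disc b (x + h n) by have /andP[] := hA n.
have [e e0 fe] := f_deriv xb h0 hd.
exists (fun n => (df x + e n - diff_quotient x) / (x + h n) - (df x - diff_quotient x) / x).
  rewrite (_ : (0 : C) = (df x + 0 + - diff_quotient x) * (x + 0)^-1
      + - ((df x - diff_quotient x) / x)); last by rewrite !addr0 subrr.
  have l1 := cvgCD (cvgCD (cvgCcst (df x)) e0) (cvgCcst (- diff_quotient x)).
  have xn0 : x + 0 != 0 by rewrite addr0.
  have l2 := cvgCV xn0 (cvgCD (cvgCcst x) h0).
  exact: cvgCD (cvgCM l1 l2) (cvgCcst _).
move=> n; rewrite [X in _ * X]addrC subrK {1}/diff_quotient fe /diff_quotient.
by field; rewrite hn xn.
Qed.

(** The quotient is holomorphic off 0, so its mean does not depend on the radius; on shrinking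
    circles it is bounded by |K| and tends to the derivative. *)
Lemma cauchy_derivative (r : R) : 0 < r < b ->
  ccirc (fun t => diff_quotient (r%:C%C * cis t)) = df 0 * (pi *+ 2)%:C%C.
Proof.
move=> rb; have [r0 r1] := andP rb; have b0 : 0 < b by exact: lt_trans r0 r1.
have d0 : disc b 0 by rewrite /disc /= nrm0.
(* The denominator n + 2 keeps every radius strictly below r. *)
pose s n : R := r / n.+2%:R.
have s0 n : 0 < s n by rewrite divr_gt0.
have sr n : s n < r by rewrite ltr_pdivrMr // ltr_pMr // ltr1n.
have lq (p : R) : 0 < p < b -> clip (fun t => diff_quotient (p%:C%C * cis t)).
  move=> /andP[p0 pb].
  have p20 : 0 < p / 2 by rewrite divr_gt0.
  apply: (@clip_polar diff_quotient (p / 2) b (2 * `|K| / (p / 2)) (ltW p20)).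
    by move=> x y; exact: diff_quotient_lip.
  by rewrite pb andbT ltr_pdivrMr // ltr_pMr // ltr1n.
have cst n : ccirc (fun t => diff_quotient (r%:C%C * cis t)) =
             ccirc (fun t => diff_quotient ((s n)%:C%C * cis t)).
  have p20 : 0 < s n / 2 by rewrite divr_gt0.
  have sn2 : s n / 2 < s n by rewrite ltr_pdivrMr // ltr_pMr // ltr1n.
  have sub : annulus (s n / 2) b `<=` annulus 0 b.
    by move=> x /andP[x1 x2]; apply/andP; split => //; exact: lt_trans x1.
  apply: (@circle_mean_cst diff_quotient _ (s n / 2) b (2 * `|K| / (s n / 2)) (ltW p20)).
  - move=> x xA; apply: (cderiv_sub sub); exact/diff_quotient_deriv/sub.
  - by move=> x y; exact: diff_quotient_lip.
  - by rewrite r1 andbT (lt_trans sn2).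
  - by rewrite sn2 (lt_trans (sr n)).
have lim : (fun n => ccirc (fun t => diff_quotient ((s n)%:C%C * cis t))) @ \oo
    --> ccirc (fun=> df 0).
  apply: (@ccirc_dct _ _ _ `|K|) => [n||n t|t].
  - by apply: lq; rewrite s0 (lt_trans (sr n)).
  - exact: clip_cst.
  - have zn : 0 < nrm ((s n)%:C%C * cis t : C) by rewrite nrm_polar // ltW.
    rewrite /diff_quotient nrmM nrmV ler_pdivrMr // (le_trans (f_lip _ _)) //.
      by apply: disc_polar; rewrite (ltW (s0 n)) (lt_trans (sr n)).
    by rewrite subr0 ler_wpM2r ?nrm_ge0 // ler_norm.
  - pose h n : C := (s n)%:C%C * cis t.
    have sc0 : s @ \oo --> (0 : R).
      rewrite -[X in _ --> X](mulr0 r); apply: cvgMr.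
      have := @cvg_harmonic R; rewrite -(cvg_shiftn 1).
      by under eq_fun do rewrite addn1.
    have h0 : h @ \oo --> (0 : C).
      rewrite -[X in _ --> X](mul0r (cis t)); apply: cvgCM; last exact: cvgCcst.
      by rewrite -(rmorph0 (real_complex R)); exact: cvg_real_complex.
    have hd n : disc b (0 + h n).
      by rewrite add0r; apply: disc_polar; rewrite (ltW (s0 n)) (lt_trans (sr n)).
    have [e f_e0 fe] := f_deriv d0 h0 hd.
    rewrite (_ : (fun n => _) = fun n => df 0 + e n).
      by rewrite -[X in _ --> X]addr0; exact: cvgCD (cvgCcst _) f_e0.
    apply/funext => n; rewrite /diff_quotient -/(h n).
    have hn : h n != 0 by rewrite -nrm_gt0 nrm_polar // ltW.
    have := fe n; rewrite add0r => ->.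
    by field.
move: lim; under eq_fun do rewrite -cst.
by rewrite ccirc_cst; apply: cvgC_unique; exact: cvgCcst.
Qed.

End CauchyOnDisc.

End ComplexDerivative.

(** * Cauchy estimates and energy of holomorphic curves in C^n or l^2(C) *)

Section HolomorphicCurves.
Variables (R : realType) (N : option nat).
Local Notation C := (Cplx R).
Local Notation E := (cspace R N).

Definition vderiv (D : set C) (f : C -> E) (x : C) (d : E) :=
  forall h : nat -> C, h @ \oo --> (0 : C) -> (forall n, D (x + h n)) ->
  exists2 e : nat -> E, e @ \oo --> (0 : E) &
    forall n, f (x + h n) = f x + h n *: (d + e n).

Lemma cvg_hip_l (e : nat -> E) (v : E) : e @ \oo --> (0 : E) ->
  (fun n => hip (e n) v) @ \oo --> (0 : C).
Proof.
move=> /cvg_nrmP e0.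
apply: (@squeeze_nrm _ _ _ _ (fun n => (2 * nrm v) * nrm (e n - 0))).
  by move=> n; rewrite !subr0 (le_trans (nrm_hip_le _ _)) // mulrAC mulrA.
by rewrite -[X in _ --> X](mulr0 (2 * nrm v)); exact: cvgMr.
Qed.

(** Pairing with a fixed vector reduces vector-valued curves to scalar functions, so that only
    scalar integrals occur. *)
Lemma vderiv_hip D f x d v : vderiv D f x d ->
  cderiv D (fun z => hip (f z) v) x (hip d v).
Proof.
move=> H h h0 hD; have [e e0 fe] := H h h0 hD.
exists (fun n => hip (e n) v); first exact: cvg_hip_l.
by move=> n; rewrite fe hipDl hipZl hipDl.
Qed.

(** The Cauchy lemmas are stated at the centre 0; this recentres them at x. *)
Lemma vderiv_shift (a b : R) f (x : C) (df : C -> E) : a + nrm x <= b ->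
  (forall z, disc b z -> vderiv (disc b) f z (df z)) ->
  forall z, disc a z -> vderiv (disc a) (fun z => f (x + z)) z (df (x + z)).
Proof.
move=> ab H z za h h0 ha.
have sub y : disc a y -> disc b (x + y).
  by rewrite /disc /= => ya; rewrite (le_lt_trans (nrmD _ _)) //; lra.
have hb n : disc b (x + z + h n) by rewrite -addrA; exact/sub.
have [e e0 fe] := H _ (sub _ za) h h0 hb.
by exists e => // n; rewrite addrA fe.
Qed.

Section OneCurve.
Variables (H dH : C -> E) (b K : R).
Hypothesis H_deriv : forall x, disc b x -> vderiv (disc b) H x (dH x).
Hypothesis H_lip : forall x y, disc b x -> disc b y ->
  nrm (H x - H y) <= K * nrm (x - y).

Lemma hip_lip (v : E) x y : disc b x -> disc b y ->
  nrm (hip (H x) v - hip (H y) v) <= (2 * K * nrm v) * nrm (x - y).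
Proof.
move=> xb yb; rewrite -hipNl -hipDl (le_trans (nrm_hip_le _ _)) //.
rewrite -!mulrA ler_pM2l // [nrm v * _]mulrC mulrA ler_wpM2r ?nrm_ge0 //.
exact: H_lip.
Qed.

Lemma clip_hip (v : E) (r : R) : 0 < r < b ->
  clip (fun t => hip (H (r%:C%C * cis t)) v).
Proof.
move=> rb; apply: (@clip_polar_disc _ (fun z => hip (H z) v) b (2 * K * nrm v)) => //.
by move=> x y xb yb; exact: hip_lip.
Qed.

Lemma hip_mean_value (v : E) (r : R) : 0 < r < b ->
  ccirc (fun t => hip (H (r%:C%C * cis t)) v) = hip (H 0) v * (pi *+ 2)%:C%C.
Proof.
move=> rb.
apply: (@mean_value _ (fun z => hip (H z) v) (fun z => hip (dH z) v) b (2 * K * nrm v)) => //.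
  by move=> x xb; exact/vderiv_hip/H_deriv.
by move=> x y xb yb; exact: hip_lip.
Qed.

Lemma hip_cauchy_derivative (v : E) (r : R) : 0 < r < b ->
  ccirc (fun t => hip (H (r%:C%C * cis t) - H 0) v / (r%:C%C * cis t)) =
  hip (dH 0) v * (pi *+ 2)%:C%C.
Proof.
move=> rb.
rewrite -(@cauchy_derivative _ (fun z => hip (H z) v) (fun z => hip (dH z) v)
  b (2 * K * nrm v) _ _ r rb).
- by congr ccirc; apply/funext => t; rewrite /diff_quotient hipDl hipNl.
- by move=> x xb; exact/vderiv_hip/H_deriv.
- by move=> x y xb yb; exact: hip_lip.
Qed.

Lemma clip_polarV (r : R) : clip (fun t => (r%:C%C * cis t)^-1).
Proof.
rewrite (_ : (fun t => _) = fun t => (r%:C%C : C)^-1 * (cis t)^-1).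
  by apply: clipZ; exact: clip_cisV.
by apply/funext => t; rewrite invfM.
Qed.

Lemma nrm_polarV (r t : R) : 0 < r -> nrm ((r%:C%C * cis t)^-1 : C) = r^-1.
Proof. by move=> r0; rewrite nrmV nrm_polar // ltW. Qed.

Lemma clip_hip_quotient (v : E) (r : R) : 0 < r < b ->
  clip (fun t => hip (H (r%:C%C * cis t) - H 0) v / (r%:C%C * cis t)).
Proof.
move=> rb; have [r0 r1] := andP rb.
apply: (@clipM _ (2 * ((`|K| * r) * nrm v)) r^-1).
- rewrite (_ : (fun t => _) = fun t => hip (H (r%:C%C * cis t)) v + - hip (H 0) v).
    by apply: clipD; [exact: clip_hip | exact: clip_cst].
  by apply/funext => t; rewrite hipDl hipNl.
- exact: clip_polarV.
- move=> t; rewrite (le_trans (nrm_hip_le _ _)) // ler_pM2l // ler_wpM2r ?nrm_ge0 //.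
  have db : disc b (r%:C%C * cis t) by apply: disc_polar; rewrite ltW.
  have d0 : disc b 0 by rewrite /disc /= nrm0 (lt_trans r0).
  rewrite (le_trans (H_lip db d0)) // subr0 (nrm_polar _ (ltW r0)).
  by rewrite ler_wpM2r ?ler_norm // ltW.
- by move=> t; rewrite nrm_polarV.
Qed.

Lemma sqr_nrm_dist (x y : E) :
  nrm x ^+ 2 = nrm y ^+ 2 + 2 * ip (x - y) y + nrm (x - y) ^+ 2.
Proof. by have := sqr_nrmD (x - y) y; rewrite subrK => ->; ring. Qed.

Lemma lip_sqr_nrm_dist (y : E) (r : R) : 0 < r < b ->
  lip (fun t => nrm (H (r%:C%C * cis t) - y) ^+ 2).
Proof.
move=> rb; have [r0 r1] := andP rb.
have db t : disc b (r%:C%C * cis t) by apply: disc_polar; rewrite ltW.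
have d0 : disc b 0 by rewrite /disc /= nrm0 (lt_trans r0).
pose B := `|K| * r + nrm (H 0 - y).
have bd t : nrm (H (r%:C%C * cis t) - y) <= B.
  rewrite (_ : _ - y = (H (r%:C%C * cis t) - H 0) + (H 0 - y)); last by rewrite addrA subrK.
  rewrite (le_trans (nrmD _ _)) // lerD2r (le_trans (H_lip (db t) d0)) //.
  by rewrite subr0 (nrm_polar _ (ltW r0)) ler_wpM2r ?ler_norm // ltW.
exists ((B + B) * (`|K| * (r * 2))) => t s.
rewrite [X in _ <= X](_ : _ = (`|K| * (r * 2) * `|t - s|) * (B + B)); last by ring.
apply: sqr_nrm_lip => //.
rewrite (_ : _ - y - _ = H (r%:C%C * cis t) - H (r%:C%C * cis s)); last first.
  by rewrite opprB addrA subrK.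
rewrite (le_trans (H_lip (db t) (db s))) // -mulrBr nrmM nrm_real gtr0_norm //.
rewrite (le_trans (ler_wpM2r _ (ler_norm K))) ?mulr_ge0 ?nrm_ge0 ?(ltW r0) //.
by rewrite -!mulrA ler_wpM2l // ler_pM2l // cis_lip.
Qed.

(** For H(z) = sum H_k z^k this is 2 pi times the sum over k >= 1 of s^(2k) |H_k|^2. *)
Definition energy (s : R) : R :=
  circ (fun t => nrm (H (s%:C%C * cis t)) ^+ 2) - nrm (H 0) ^+ 2 * (pi *+ 2).

(** Expanding |H|^2 around H(0), the cross term <H - H(0), H(0)> has mean 0 by the mean value
    property. *)
Lemma energyE (s : R) : 0 < s < b ->
  energy s = circ (fun t => nrm (H (s%:C%C * cis t) - H 0) ^+ 2).
Proof.
move=> sb; have l1 := lip_sqr_nrm_dist (H 0) sb.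
have l2 := clip_Re (clip_hip (H 0) sb).
have m := congr1 (@complex.Re R) (hip_mean_value (H 0) sb).
have m2 : circ (fun t => ip (H (s%:C%C * cis t)) (H 0)) = nrm (H 0) ^+ 2 * (pi *+ 2).
  move: m; rewrite /= => ->; rewrite mulr0 subr0 ipxx //.
rewrite /energy.
rewrite (_ : (fun t => nrm (H (s%:C%C * cis t)) ^+ 2) = (fun t =>
  (- nrm (H 0) ^+ 2 + 2 * ip (H (s%:C%C * cis t)) (H 0)) +
  nrm (H (s%:C%C * cis t) - H 0) ^+ 2)).
  rewrite circD //; last by apply: lipD; [exact: lip_cst|exact: lipZ].
  rewrite circD; [|exact: lip_cst|exact: lipZ].
  by rewrite circZ // circ_cst m2; ring.
apply/funext => t; rewrite (sqr_nrm_dist (H (s%:C%C * cis t)) (H 0)).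
by rewrite ipDl ipNl ipxx; ring.
Qed.

(** By [energyE] the quotient is a mean of |H - H(0)|^2 / s^2, which is dominated by K^2 and tends
    to |H'(0)|^2. The radii b/(n+2) stay inside the disc. *)
Lemma energy_asymptotic : 0 < b ->
  (fun n => (b / n.+2%:R) ^- 2 * energy (b / n.+2%:R)) @ \oo --> nrm (dH 0) ^+ 2 * (pi *+ 2).
Proof.
move=> b0; pose s n : R := b / n.+2%:R.
have s0 n : 0 < s n by rewrite divr_gt0.
have sr n : s n < b by rewrite ltr_pdivrMr // ltr_pMr // ltr1n.
have sb n : 0 < s n < b by rewrite s0 sr.
have d0 : disc b 0 by rewrite /disc /= nrm0.
rewrite -circ_cst.
under eq_fun do rewrite -/(s _) (energyE (sb _)).
rewrite (_ : (fun n => _) = fun n => circ (fun t =>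
    s n ^- 2 * nrm (H ((s n)%:C%C * cis t) - H 0) ^+ 2)); last first.
  by apply/funext => n; rewrite circZ //; exact: lip_sqr_nrm_dist.
apply: (@circ_dct _ _ _ (`|K| ^+ 2)) => [n||n t|t].
- by apply: lipZ; exact: lip_sqr_nrm_dist.
- exact: lip_cst.
- have pos : 0 <= s n ^- 2 * nrm (H ((s n)%:C%C * cis t) - H 0) ^+ 2.
    by rewrite mulr_ge0 ?invr_ge0 ?sqr_ge0.
  rewrite (ger0_norm pos) ler_pdivrMl ?exprn_gt0 //.
  have db : disc b ((s n)%:C%C * cis t) by apply: disc_polar; rewrite ltW ?sr.
  rewrite -exprMn lerXn2r ?nnegrE ?nrm_ge0 ?(mulr_ge0 (ltW (s0 n))) //.
  rewrite (le_trans (H_lip db d0)) // subr0 (nrm_polar _ (ltW (s0 n))) mulrC.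
  by rewrite ler_pM2l // ler_norm.
- pose h n : C := (s n)%:C%C * cis t.
  have sc0 : s @ \oo --> (0 : R).
    rewrite -[X in _ --> X](mulr0 b); apply: cvgMr.
    have := @cvg_harmonic R; rewrite -(cvg_shiftn 1).
    by under eq_fun do rewrite addn1.
  have h0 : h @ \oo --> (0 : C).
    have tC : (fun n => (s n)%:C%C : C) @ \oo --> (0 : C).
      by rewrite -(rmorph0 (real_complex R)); exact: cvg_real_complex.
    by rewrite -[X in _ --> X](mul0r (cis t)); exact: cvgCM tC (cvgCcst _).
  have hd n : disc b (0 + h n).
    by rewrite add0r; apply: disc_polar; rewrite ltW ?sr.
  have [e e0 fe] := H_deriv d0 h0 hd.
  rewrite (_ : (fun n => _) = fun n => nrm (dH 0 + e n) ^+ 2); last first.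
    apply/funext => n; have := fe n; rewrite add0r /h => ->.
    rewrite addrAC subrr add0r nrmZ (nrm_polar _ (ltW (s0 n))) [(s n * _) ^+ 2]exprMn.
    by rewrite mulKf // expf_neq0 // gt_eqF.
  have l : (fun n => nrm (dH 0 + e n)) @ \oo --> nrm (dH 0).
    apply/subr_cvg0/cvgr0Pnorm_lt => eps eps0.
    move/cvg_nrmP/cvgr0Pnorm_lt: e0 => /(_ eps eps0); apply: filterS => n.
    apply: le_lt_trans; rewrite subr0 (ger0_norm (nrm_ge0 _)).
    by rewrite (le_trans (nrm_lip _ _)) // addrAC subrr add0r.
  by rewrite expr2; under eq_fun do rewrite expr2; exact: cvgM.
Qed.

End OneCurve.

(** The Cauchy formula is paired with v, the difference of the derivatives itself, so that a bound
    of |v|^2 by a multiple of |v| results. The 4 is a factor 2 from [nrm_hip_le] times a factor 2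
    from [nrm_ccirc_le]. *)
Lemma derivative_dist_le (H1 H2 dH1 dH2 : C -> E) (b K r M : R) : 0 < r < b ->
  (forall x, disc b x -> vderiv (disc b) H1 x (dH1 x)) ->
  (forall x, disc b x -> vderiv (disc b) H2 x (dH2 x)) ->
  (forall x y, disc b x -> disc b y -> nrm (H1 x - H1 y) <= K * nrm (x - y)) ->
  (forall x y, disc b x -> disc b y -> nrm (H2 x - H2 y) <= K * nrm (x - y)) ->
  (forall x, disc b x -> nrm ((H1 x - H1 0) - (H2 x - H2 0)) <= M) ->
  nrm (dH1 0 - dH2 0) <= 4 * M / r.
Proof.
move=> rb d1 d2 l1 l2 HM; set v := dH1 0 - dH2 0.
have [r0 r1] := andP rb.
have db t : disc b (r%:C%C * cis t) by apply: disc_polar; rewrite ltW.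
have M0 : 0 <= M by rewrite (le_trans (nrm_ge0 _) (HM _ (db 0))).
have c1 := hip_cauchy_derivative d1 l1 v rb.
have c2 := hip_cauchy_derivative d2 l2 v rb.
have q1 := clip_hip_quotient l1 v rb.
have q2 := clip_hip_quotient l2 v rb.
have E1 : hip v v * (pi *+ 2)%:C%C = ccirc (fun t =>
    hip ((H1 (r%:C%C * cis t) - H1 0) - (H2 (r%:C%C * cis t) - H2 0)) v / (r%:C%C * cis t)).
  rewrite {1}/v hipDl hipNl mulrBl -c1 -c2 -mulN1r -ccircZ // -ccircD //; last exact: clipZ.
  congr ccirc; apply/funext => t.
  by rewrite [in RHS]hipDl [in RHS]hipNl mulN1r mulrBl.
have lq : clip (fun t => hip ((H1 (r%:C%C * cis t) - H1 0) - (H2 (r%:C%C * cis t) - H2 0)) v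
    / (r%:C%C * cis t)).
  rewrite (_ : (fun t => _) = fun t => hip (H1 (r%:C%C * cis t) - H1 0) v / (r%:C%C * cis t) +
    (-1) * (hip (H2 (r%:C%C * cis t) - H2 0) v / (r%:C%C * cis t))).
    by apply: clipD => //; exact: clipZ.
  apply/funext => t.
  by rewrite [in LHS]hipDl [in LHS]hipNl mulN1r mulrBl.
have bd t : nrm (hip ((H1 (r%:C%C * cis t) - H1 0) - (H2 (r%:C%C * cis t) - H2 0)) v
    / (r%:C%C * cis t)) <= 2 * (M * nrm v) / r.
  rewrite nrmM nrm_polarV // ler_pM2r ?invr_gt0 // (le_trans (nrm_hip_le _ _)) //.
  by rewrite ler_pM2l // ler_wpM2r ?nrm_ge0 // HM.
have := nrm_ccirc_le lq bd; rewrite -E1 hipxx -rmorphM nrm_real.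
have p0 := @pi2_gt0 R; have v0 := nrm_ge0 v.
rewrite ger0_norm ?mulr_ge0 ?sqr_ge0 ?(ltW p0) // [X in _ <= X]mulrA ler_pM2r //.
have [->|vn] := eqVneq (nrm v) 0; first by move=> _; rewrite divr_ge0 ?mulr_ge0 // ltW.
have vp : 0 < nrm v by rewrite lt_def vn.
rewrite (_ : 2 * _ = (4 * M / r) * nrm v); last by ring.
by rewrite expr2 ler_pM2r.
Qed.

End HolomorphicCurves.

(** * Maps with orthogonal partial derivatives *)

Section TwoVariables.
Variables (R : realType) (N : option nat).
Local Notation C := (Cplx R).
Local Notation E := (cspace R N).

Lemma cvgR0D (u v : nat -> R) : u @ \oo --> (0 : R) -> v @ \oo --> (0 : R) ->
  (fun n => u n + v n) @ \oo --> (0 : R).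
Proof. by move=> hu hv; rewrite -[X in _ --> X](addr0 (0 : R)); exact: cvgD hu hv. Qed.

Lemma cvgR0Z (c : R) (u : nat -> R) : u @ \oo --> (0 : R) ->
  (fun n => c * u n) @ \oo --> (0 : R).
Proof. by move=> hu; rewrite -[X in _ --> X](mulr0 c); apply: cvgMr. Qed.

(** Cauchy's estimate around z applies to G(., w) and G(., w'), whose centred difference is at most
    2 K |w - w'|. Half the distance to the boundary as radius gives 4 * 2 * 2 = 16. *)
Lemma partial_lip (G Gz : C -> C -> E) (rho K : R) :
  (forall z w, disc rho z -> disc rho w ->
     vderiv (disc rho) (fun z => G z w) z (Gz z w)) ->
  (forall z z' w, disc rho z -> disc rho z' -> disc rho w ->
     nrm (G z w - G z' w) <= K * nrm (z - z')) ->
  (forall z w w', disc rho z -> disc rho w -> disc rho w' ->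
     nrm (G z w - G z w') <= K * nrm (w - w')) ->
  forall z w w', disc rho z -> disc rho w -> disc rho w' ->
    nrm (Gz z w - Gz z w') <= (16 * K / (rho - nrm z)) * nrm (w - w').
Proof.
move=> dz lz lw z w w' zr wr wr'.
pose b := rho - nrm z; have b0 : 0 < b by rewrite subr_gt0.
have rb : 0 < b / 2 < b by rewrite divr_gt0 //= ltr_pdivrMr // ltr_pMr // ltr1n.
have ab : b + nrm z <= rho by rewrite /b subrK.
have sub x : disc b x -> disc rho (z + x).
  move=> xb; rewrite /disc /= (le_lt_trans (nrmD _ _)) // addrC -ltrBrDr //.
have vs y : disc rho y -> forall x, disc b x ->
    vderiv (disc b) (fun x => G (z + x) y) x (Gz (z + x) y).
  move=> yr; apply: (vderiv_shift ab (f := fun z => G z y) (df := fun z => Gz z y)).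
  by move=> x xr; exact: dz.
have ls y : disc rho y -> forall x x', disc b x -> disc b x' ->
    nrm (G (z + x) y - G (z + x') y) <= K * nrm (x - x').
  move=> yr x x' xb xb'; rewrite (le_trans (lz _ _ _ (sub _ xb) (sub _ xb') yr)) //.
  by rewrite (_ : z + x - (z + x') = x - x') // opprD addrACA subrr add0r.
have := derivative_dist_le (M := 2 * K * nrm (w - w')) rb (vs w wr) (vs w' wr')
  (ls w wr) (ls w' wr').
rewrite /= !addr0 => /(_ _)/le_trans; apply.
  move=> x xb.
  rewrite (_ : _ - _ = (G (z + x) w - G (z + x) w') - (G z w - G z w')).
    rewrite (le_trans (nrmB _ _)) // -mulrA mulr_natl mulr2n lerD ?lw //.
    exact: sub.
  by rewrite !opprB addrACA [RHS]addrACA; congr (_ + _); rewrite addrC.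
rewrite /b -subr_ge0 (_ : _ - _ = 0) //; field.
by rewrite gt_eqF.
Qed.

Section Kernel.
Variables (G Gz Gw : C -> C -> E) (rho K B : R).
Hypothesis dz : forall z w, disc rho z -> disc rho w ->
  vderiv (disc rho) (fun z => G z w) z (Gz z w).
Hypothesis dw : forall z w, disc rho z -> disc rho w ->
  vderiv (disc rho) (G z) w (Gw z w).
Hypothesis lz : forall z z' w, disc rho z -> disc rho z' -> disc rho w ->
  nrm (G z w - G z' w) <= K * nrm (z - z').
Hypothesis lw : forall z w w', disc rho z -> disc rho w -> disc rho w' ->
  nrm (G z w - G z w') <= K * nrm (w - w').
Hypothesis bGz : forall z w, disc rho z -> disc rho w -> nrm (Gz z w) <= K.
Hypothesis bGw : forall z w, disc rho z -> disc rho w -> nrm (Gw z w) <= K.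
Hypothesis bG : forall z w, disc rho z -> disc rho w -> nrm (G z w) <= B.
Hypothesis orth : forall z w, disc rho z -> disc rho w -> hip (Gz z w) (Gw z w) = 0.

(** No mixed derivative is assumed to exist. The Cauchy formula in z writes <G_z, v> as a circle
    mean of difference quotients of G, which can be differentiated in w under the integral. *)
Lemma partial_cderiv (z : C) (v : E) : disc rho z -> exists D : C -> C,
  forall w, disc rho w -> cderiv (disc rho) (fun w => hip (Gz z w) v) w (D w).
Proof.
move=> zr.
pose b := rho - nrm z; have b0 : 0 < b by rewrite subr_gt0.
pose r := b / 2.
have rb : 0 < r < b by rewrite divr_gt0 //= ltr_pdivrMr // ltr_pMr // ltr1n.
have r0 : 0 < r by case/andP: rb.
have ab : b + nrm z <= rho by rewrite /b subrK.
have sub x : disc b x -> disc rho (z + x).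
  move=> xb; rewrite /disc /= (le_lt_trans (nrmD _ _)) // addrC -ltrBrDr //.
pose zeta (t : R) : C := r%:C%C * cis t.
have zetab t : disc b (zeta t) by apply: disc_polar; rewrite (ltW r0); case/andP: rb.
have zr' t : disc rho (z + zeta t) by exact: sub.
have vs y : disc rho y -> forall x, disc b x ->
    vderiv (disc b) (fun x => G (z + x) y) x (Gz (z + x) y).
  move=> yr; apply: (vderiv_shift ab (f := fun z => G z y) (df := fun z => Gz z y)).
  by move=> x xr; exact: dz.
have ls y : disc rho y -> forall x x', disc b x -> disc b x' ->
    nrm (G (z + x) y - G (z + x') y) <= K * nrm (x - x').
  move=> yr x x' xb xb'; rewrite (le_trans (lz (sub _ xb) (sub _ xb') yr)) //.
  by rewrite (_ : z + x - (z + x') = x - x') // opprD addrACA subrr add0r.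
have lws y : disc rho y -> forall x x', disc b x -> disc b x' ->
    nrm (Gw (z + x) y - Gw (z + x') y) <= 16 * K / (rho - nrm y) * nrm (x - x').
  move=> yr x x' xb xb'.
  have := @partial_lip (fun w z => G z w) (fun w z => Gw z w) rho K.
  move=> /(_ (fun w z wr zr => dw zr wr) (fun w w' z wr wr' zr => lw zr wr wr')
     (fun w z z' wr zr zr' => lz zr zr' wr) y (z + x) (z + x') yr (sub _ xb) (sub _ xb')).
  move=> h; rewrite (le_trans h) //.
  by rewrite (_ : z + x - (z + x') = x - x') // opprD addrACA subrr add0r.
pose Q y t := hip (G (z + zeta t) y - G z y) v / zeta t.
(* The formal w-derivative of [Q]; its mean is the candidate derivative [D]. *)
pose Qw y t := hip (Gw (z + zeta t) y - Gw z y) v / zeta t.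
have cQ y : disc rho y -> clip (Q y).
  move=> yr; have := clip_hip_quotient (ls y yr) v rb.
  by under eq_fun do rewrite addr0.
have cQw y : disc rho y -> clip (Qw y).
  move=> yr; have := clip_hip_quotient (lws y yr) v rb.
  by under eq_fun do rewrite addr0.
have cau y : disc rho y -> ccirc (Q y) = hip (Gz z y) v * (pi *+ 2)%:C%C.
  move=> yr; have := hip_cauchy_derivative (vs y yr) (ls y yr) v rb.
  by rewrite addr0 => <-.
have p0 : (pi *+ 2)%:C%C != 0 :> C.
  by rewrite -(rmorph0 (real_complex R)) (inj_eq (@complexI R)) gt_eqF // pi2_gt0.
pose phi y := hip (Gz z y) v.
pose D y : C := ((pi *+ 2)%:C%C)^-1 * ccirc (Qw y).
exists D => w wr h h0 hD.
(* The error of the difference quotient, set to 0 where h n = 0; [u n] is the integrand whose mean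
   represents it. *)
pose e n : C := if h n == 0 then 0 else (phi (w + h n) - phi w) / h n - D w.
pose u n t : C := if h n == 0 then 0 else (h n)^-1 * (Q (w + h n) t + (-1) * Q w t) + (-1) * Qw w t.
have u0 n : h n = 0 -> u n = fun=> 0.
  by move=> hn; apply/funext => t; rewrite /u hn eqxx.
have u1 n : h n != 0 -> u n = fun t => (h n)^-1 * (Q (w + h n) t + (-1) * Q w t) + (-1) * Qw w t.
  by move=> hn; apply/funext => t; rewrite /u (negbTE hn).
have cu n : clip (u n).
  have [/u0 ->|/u1 ->] := eqVneq (h n) 0; first exact: clip_cst.
  apply: clipD; last exact/clipZ/cQw.
  by apply: clipZ; apply: clipD; [exact: cQ|exact/clipZ/cQ].
have eu n : e n = ((pi *+ 2)%:C%C)^-1 * ccirc (u n).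
  have [hn|hn] := eqVneq (h n) 0; first by rewrite /e hn eqxx (u0 _ hn) ccirc_cst mul0r mulr0.
  rewrite /e (negbTE hn) (u1 _ hn).
  rewrite ccircD; [|by apply: clipZ; apply: clipD; [exact: cQ|exact/clipZ/cQ]|exact/clipZ/cQw].
  rewrite ccircZ; last by apply: clipD; [exact: cQ|exact/clipZ/cQ].
  rewrite ccircD; [|exact: cQ|exact/clipZ/cQ].
  rewrite !ccircZ; [|exact: cQw|exact: cQ].
  rewrite (cau _ (hD n)) (cau _ wr) /D /phi.
  move: ((pi *+ 2)%:C%C : C) p0 => P p0.
  by field; rewrite p0 hn.
exists e; last first.
  move=> n; rewrite /e /phi; have [->|hn] := eqVneq (h n) 0.
    by rewrite !addr0 mul0r addr0.
  by field.
have suff0 : (fun n => ccirc (u n)) @ \oo --> ccirc (fun=> 0).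
  have zn t : nrm (zeta t) = r by rewrite nrm_polar // ltW.
  have uE n t : h n != 0 -> u n t = hip ((h n)^-1 *: ((G (z + zeta t) (w + h n) - G (z + zeta t) w)
      - (G z (w + h n) - G z w)) - (Gw (z + zeta t) w - Gw z w)) v / zeta t.
    move=> hn; rewrite /u (negbTE hn) /Q /Qw !(hipDl, hipNl, hipZl).
    by ring.
  (* The increments of G divided by h and the two values of G_w contribute K each, four in all;
     [nrm_hip_le] doubles this. *)
  apply: (@ccirc_dct _ _ _ (8 * K * nrm v / r)) => // [|n t|t].
  - exact: clip_cst.
  - have K0 : 0 <= K by rewrite (le_trans (nrm_ge0 _) (bGz zr wr)).
    have [hn|hn] := eqVneq (h n) 0.
      rewrite /u hn eqxx nrm0 divr_ge0 ?(ltW r0) // mulr_ge0 ?nrm_ge0 //.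
      by rewrite mulr_ge0.
    rewrite uE // nrmM nrmV zn ler_pM2r ?invr_gt0 // (le_trans (nrm_hip_le _ _)) //.
    rewrite mulrA ler_wpM2r ?nrm_ge0 // (_ : 8 * K = 2 * ((K + K) + (K + K))); last by ring.
    rewrite ler_pM2l // (le_trans (nrmB _ _)) // lerD //.
      rewrite nrmZ nrmV ler_pdivrMl ?nrm_gt0 // (le_trans (nrmB _ _)) //.
      have e1 : w + h n - w = h n by rewrite addrAC subrr add0r.
      have l1 := lw (zr' t) (hD n) wr; have l2 := lw zr (hD n) wr.
      by move: (lerD l1 l2); rewrite e1 -mulrDl mulrC.
    by rewrite (le_trans (nrmB _ _)) // lerD // bGw.
  - have [e1 e10 f1] := dw (zr' t) wr h0 hD.
    have [e2 e20 f2] := dw zr wr h0 hD.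
    pose c := 2 * nrm v / r.
    apply: (@squeeze_nrm _ _ _ _ (fun n => c * (nrm (e1 n - 0) + nrm (e2 n - 0)))).
      move=> n; rewrite !subr0.
      have c0 : 0 <= c by rewrite divr_ge0 ?(ltW r0) // mulr_ge0 ?nrm_ge0.
      have [hn|hn] := eqVneq (h n) 0.
        by rewrite /u hn eqxx nrm0 mulr_ge0 // addr_ge0 ?nrm_ge0.
      have fa1 : G (z + zeta t) (w + h n) - G (z + zeta t) w = h n *: (Gw (z + zeta t) w + e1 n).
        by rewrite f1 addrAC subrr add0r.
      have fa2 : G z (w + h n) - G z w = h n *: (Gw z w + e2 n).
        by rewrite f2 addrAC subrr add0r.
      rewrite uE // fa1 fa2 -scalerBr scalerA.
      rewrite mulVf // scale1r (_ : _ - _ = e1 n - e2 n); last first.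
        by rewrite opprD addrACA [LHS]addrAC subrr add0r.
      rewrite nrmM nrmV zn (le_trans (ler_wpM2r _ (nrm_hip_le _ _))) ?invr_ge0 ?(ltW r0) //.
      rewrite (_ : 2 * _ / r = c * nrm (e1 n - e2 n)); last by rewrite /c; ring.
      by rewrite ler_wpM2l // nrmB.
    move/cvg_nrmP: e10 => e10; move/cvg_nrmP: e20 => e20.
    exact: cvgR0Z (cvgR0D e10 e20).
rewrite (_ : e = fun n => ((pi *+ 2)%:C%C : C)^-1 * ccirc (u n)); last by apply/funext.
have := cvgCM (cvgCcst ((pi *+ 2)%:C%C)^-1) suff0.
by rewrite ccirc_cst mul0r mulr0.
Qed.

Let L (z : C) := 16 * K / (rho - nrm z).

Lemma Gz_lip z w w' : disc rho z -> disc rho w -> disc rho w' ->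
  nrm (Gz z w - Gz z w') <= L z * nrm (w - w').
Proof. exact: (partial_lip dz lz lw). Qed.

Definition chi z w := hip (Gz z w) (G z w).

Lemma chi_lip z w w' : disc rho z -> disc rho w -> disc rho w' ->
  nrm (chi z w - chi z w') <= (2 * (L z * B + K * K)) * nrm (w - w').
Proof.
move=> zr wr wr'; rewrite /chi.
rewrite (_ : _ - _ = hip (Gz z w - Gz z w') (G z w) + hip (Gz z w') (G z w - G z w')); last first.
  by rewrite hipDl hipDr hipNl hipNr; ring.
rewrite (le_trans (nrmD _ _)) //.
rewrite (_ : _ * nrm (w - w') = 2 * (L z * nrm (w - w') * B) + 2 * (K * (K * nrm (w - w')))); last by ring.
have K0 : 0 <= K by rewrite (le_trans (nrm_ge0 _) (bGz zr wr)).
rewrite lerD // (le_trans (nrm_hip_le _ _)) // ler_pM2l //.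
  exact: (ler_pM (nrm_ge0 _) (nrm_ge0 _) (Gz_lip zr wr wr') (bG zr wr)).
exact: (ler_pM (nrm_ge0 _) (nrm_ge0 _) (bGz zr wr') (lw zr wr wr')).
Qed.

(* Orthogonality of the partial derivatives kills the antiholomorphic part of
   the w-derivative of [chi]. *)
Lemma chi_cderiv z : disc rho z -> exists D : C -> C,
  forall w, disc rho w -> cderiv (disc rho) (chi z) w (D w).
Proof.
move=> zr.
(* One derivative for each frozen second argument v; at w the one for v = G z w is taken. *)
have [D HD] := choice (fun v => partial_cderiv v zr).
exists (fun w => D (G z w) w) => w wr h h0 hD.
have [e1 e10 f1] := HD (G z w) w wr h h0 hD.
have [e e0 f] := dw zr wr h0 hD.
(* The coefficient of conj h in the increment of [chi]; it tends to <G_z, G_w> = 0. *)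
pose del n := hip (Gz z (w + h n) - Gz z w) (Gw z w) + hip (Gz z (w + h n)) (e n).
have del0 : del @ \oo --> (0 : C).
  apply: (@squeeze_nrm _ _ _ _ (fun n =>
      (2 * L z * nrm (Gw z w)) * nrm (h n - 0) + (2 * K) * nrm (e n - 0))).
    move=> n; rewrite !subr0 (le_trans (nrmD _ _)) // lerD // (le_trans (nrm_hip_le _ _)) //.
      rewrite (_ : 2 * L z * _ * _ = 2 * (L z * nrm (h n) * nrm (Gw z w))); last by ring.
      rewrite ler_pM2l // ler_wpM2r ?nrm_ge0 //.
      have := Gz_lip zr (hD n) wr; rewrite (_ : w + h n - w = h n) // addrAC subrr add0r //.
    by rewrite -!mulrA ler_pM2l // ler_wpM2r ?nrm_ge0 ?bGz.
  move/cvg_nrmP: h0 => h0'; move/cvg_nrmP: e0 => e0'.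
  exact: cvgR0D (cvgR0Z _ h0') (cvgR0Z _ e0').
(* The ratio conj h / h has modulus at most 1 but no limit; only the factor [del] makes this term an
   error. *)
exists (fun n => e1 n + (h n)^* / h n * del n).
  rewrite -[X in _ --> X](addr0 (0 : C)); apply: (cvgCD e10).
  apply: (@squeeze_nrm _ _ _ _ (fun n => nrm (del n - 0))).
    move=> n; rewrite !subr0 nrmM nrmM nrm_conj nrmV ler_piMl ?nrm_ge0 //.
    have [->|hn] := eqVneq (nrm (h n)) 0; first by rewrite mul0r.
    by rewrite mulfV.
  by move/cvg_nrmP: del0.
move=> n; rewrite {1}/chi f hipDr hipZr f1 -/(chi z w).
have -> : hip (Gz z (w + h n)) (Gw z w + e n) = del n.
  rewrite /del hipDr hipDl hipNl orth // subr0 //.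
have [->|hn] := eqVneq (h n) 0; first by rewrite conjC0 !mul0r addr0.
by field.
Qed.

Lemma clip_chi z s : disc rho z -> 0 < s < rho ->
  clip (fun t => chi z (s%:C%C * cis t)).
Proof.
move=> zr sr.
apply: (@clip_polar_disc _ (chi z) rho (2 * (L z * B + K * K))) => //.
by move=> x y xr yr; exact: chi_lip.
Qed.

Lemma chi_mean z s : disc rho z -> 0 < s < rho ->
  ccirc (fun t => chi z (s%:C%C * cis t)) = chi z 0 * (pi *+ 2)%:C%C.
Proof.
move=> zr sr; have [D HD] := chi_cderiv zr.
apply: (@mean_value _ (chi z) D rho (2 * (L z * B + K * K))) => //.
by move=> x y xr yr; exact: chi_lip.
Qed.

Definition wenergy s z :=
  circ (fun t => nrm (G z (s%:C%C * cis t)) ^+ 2) - nrm (G z 0) ^+ 2 * (pi *+ 2).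

Lemma lip_sqr_nrm_G z s : disc rho z -> 0 < s < rho ->
  lip (fun t => nrm (G z (s%:C%C * cis t)) ^+ 2).
Proof.
move=> zr sr.
have := @lip_sqr_nrm_dist _ _ (G z) rho K _ 0 s sr.
by under eq_fun do rewrite subr0; apply => x y xr yr; exact: lw.
Qed.

Lemma sqr_nrm_G_lip z z' w : disc rho z -> disc rho z' -> disc rho w ->
  `|nrm (G z w) ^+ 2 - nrm (G z' w) ^+ 2| <= (2 * B * K) * nrm (z - z').
Proof.
move=> zr zr' wr.
rewrite (_ : 2 * B * K * _ = (K * nrm (z - z')) * (B + B)); last by ring.
exact: sqr_nrm_lip (bG zr wr) (bG zr' wr) (lz zr zr' wr).
Qed.

(** Along the segment from 0 to z, the derivative of |G|^2 is 2 Re (z chi). Its mean over the circle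
    equals its central value because [chi] is holomorphic in w, so the derivative of [wenergy]
    vanishes. *)
Lemma wenergy_cst s z : disc rho z -> 0 < s < rho -> wenergy s z = wenergy s 0.
Proof.
move=> zr sr; have [->//|z0] := eqVneq z 0.
have [s0 s1] := andP sr; have rho0 := lt_trans s0 s1.
have dr0 : disc rho 0 by rewrite /disc /= nrm0.
have nz : 0 < nrm z by rewrite nrm_gt0.
have x0 : 0 < rho / nrm z by rewrite divr_gt0.
have x1 : 1 < rho / nrm z by rewrite ltr_pdivlMr // mul1r.
(* The point t z stays in the disc for |t| < rho / |z|, an open interval containing both 0 and 1. *)
pose f (t : R) := wenergy s (t%:C%C * z).
suff : f 1 = f 0 by rewrite /f rmorph1 mul1r rmorph0 mul0r.
apply: (@seq_derive0_cst _ f (- (rho / nrm z)) (rho / nrm z)); last 2 first.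
- by apply/andP; split; lra.
- by apply/andP; split; lra.
have inD t : - (rho / nrm z) < t < rho / nrm z -> disc rho (t%:C%C * z).
  by rewrite -ltr_norml /disc /= nrmM nrm_real ltr_pdivlMr.
move=> t ta tau taun taua tau0.
pose zt : C := t%:C%C * z; have ztr : disc rho zt by exact: inD.
have ztr' n : disc rho ((t + tau n)%:C%C * z) by exact: inD.
pose u w n := (nrm (G ((t + tau n)%:C%C * z) w) ^+ 2 - nrm (G zt w) ^+ 2) / tau n.
pose l w := 2 * complex.Re (z * chi zt w).
have ul w : disc rho w -> u w @ \oo --> l w.
  move=> wr; pose h n : C := (tau n)%:C%C * z.
  have h0 : h @ \oo --> (0 : C).
    have tC : (fun n => (tau n)%:C%C : C) @ \oo --> (0 : C).
      by rewrite -(rmorph0 (real_complex R)); exact: cvg_real_complex.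
    by rewrite -[X in _ --> X](mul0r z); exact: cvgCM tC (cvgCcst _).
  have hE n : zt + h n = (t + tau n)%:C%C * z by rewrite rmorphD mulrDl.
  have hD n : disc rho (zt + h n) by rewrite hE.
  have [e e0 fe] := dz ztr wr h0 hD.
  have uE n : u w n = 2 * complex.Re (z * (chi zt w + hip (e n) (G zt w))) +
      tau n * nrm (z *: (Gz zt w + e n)) ^+ 2.
    rewrite /u -hE fe sqr_nrmD /chi -hipDl -hipZl /= ipC /h -scalerA ipZl nrmZr.
    rewrite exprMn real_normK ?num_real //.
    by field.
  have c1 : (fun n => 2 * complex.Re (z * (chi zt w + hip (e n) (G zt w)))) @ \oo --> l w.
    apply: cvgMr; apply: cvg_Re; apply: (cvgCM (cvgCcst z)).
    rewrite -[X in _ --> X]addr0; exact: cvgCD (cvgCcst _) (cvg_hip_l _ e0).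
  have c2 : (fun n => tau n * nrm (z *: (Gz zt w + e n)) ^+ 2) @ \oo --> (0 : R).
    have l1 : (fun n => nrm (z *: (Gz zt w + e n))) @ \oo --> nrm (z *: Gz zt w).
      apply/subr_cvg0/cvgr0Pnorm_lt => eps eps0.
      have d0 : 0 < eps / nrm z by rewrite divr_gt0.
      move/cvg_nrmP/cvgr0Pnorm_lt: e0 => /(_ _ d0); apply: filterS => n.
      rewrite subr0 (ger0_norm (nrm_ge0 _)) ltr_pdivlMr //; apply: le_lt_trans.
      by rewrite (le_trans (nrm_lip _ _)) // -scalerBr addrAC subrr add0r nrmZ mulrC.
    rewrite -[X in _ --> X](mul0r (nrm (z *: Gz zt w) ^+ 2)); apply: cvgM => //.
    by rewrite expr2; under eq_fun do rewrite expr2; exact: cvgM.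
  have -> : u w = (fun n => 2 * complex.Re (z * (chi zt w + hip (e n) (G zt w)))) +
      (fun n => tau n * nrm (z *: (Gz zt w + e n)) ^+ 2).
    by apply/funext => n; rewrite uE.
  by rewrite -[X in _ --> X]addr0; exact: cvgD.
have dp b : disc rho (s%:C%C * cis b) by apply: disc_polar; rewrite (ltW s0).
have lu n : lip (fun b => u (s%:C%C * cis b) n).
  rewrite (_ : (fun b => _) = fun b => (tau n)^-1 *
     (nrm (G ((t + tau n)%:C%C * z) (s%:C%C * cis b)) ^+ 2
      + (-1) * nrm (G zt (s%:C%C * cis b)) ^+ 2)).
    apply: lipZ; apply: lipD; first exact: lip_sqr_nrm_G.
    by apply: lipZ; exact: lip_sqr_nrm_G.
  by apply/funext => b; rewrite /u mulN1r mulrC.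
have ll : lip (fun b => l (s%:C%C * cis b)).
  apply: lipZ; apply: (@clip_Re _ (fun b => z * chi zt (s%:C%C * cis b))).
  by apply: clipZ; exact: clip_chi.
have lim1 : (fun n => circ (fun b => u (s%:C%C * cis b) n)) @ \oo -->
    circ (fun b => l (s%:C%C * cis b)).
  apply: (@circ_dct _ _ _ (2 * B * K * nrm z)) => // [n b|b]; last exact: ul.
  rewrite /u normrM normfV ler_pdivrMr ?normr_gt0 //.
  rewrite (le_trans (sqr_nrm_G_lip (ztr' n) ztr (dp b))) //.
  have -> : (t + tau n)%:C%C * z - zt = (tau n)%:C%C * z.
    by rewrite /zt rmorphD mulrDl addrAC subrr add0r.
  by rewrite nrmM nrm_real [`|_| * _]mulrC mulrA.
(* The mean value property of [chi], read on the real part of z times [chi]. *)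
have limE : circ (fun b => l (s%:C%C * cis b)) = l 0 * (pi *+ 2).
  rewrite circZ; last first.
    apply: (@clip_Re _ (fun b => z * chi zt (s%:C%C * cis b))).
    by apply: clipZ; exact: clip_chi.
  have := congr1 (@complex.Re R) (ccircZ z (clip_chi ztr sr)).
  rewrite (chi_mean ztr sr) mulrA {1}/ccirc /= => ->.
  by rewrite /l; case: (z * chi zt 0) => p q /=; ring.
have lim2 := ul 0 dr0.
rewrite (_ : (fun n => _) = (fun n => circ (fun b => u (s%:C%C * cis b) n)) -
    (fun n => u 0 n * (pi *+ 2))).
  rewrite -[X in _ --> X](subrr (l 0 * (pi *+ 2))) -{1}limE.
  by apply: cvgB => //; apply: cvgMl.
apply/funext => n; rewrite /f /wenergy -/zt.
rewrite [RHS]/(circ _ - _).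
have -> : circ (fun b => u (s%:C%C * cis b) n) = (tau n)^-1 *
  (circ (fun b => nrm (G ((t + tau n)%:C%C * z) (s%:C%C * cis b)) ^+ 2) +
   (-1) * circ (fun b => nrm (G zt (s%:C%C * cis b)) ^+ 2)).
  have l1 := lip_sqr_nrm_G (ztr' n) sr; have l2 := lip_sqr_nrm_G ztr sr.
  rewrite -(circZ (-1) l2) -(circD l1 (lipZ (-1) l2)) -circZ; last by apply: lipD => //; exact: lipZ.
  by congr circ; apply/funext => b; rewrite /u mulN1r mulrC.
rewrite /u.
move: (circ _) (circ _) (nrm (G _ 0) ^+ 2) (nrm (G zt 0) ^+ 2) (pi *+ 2) (tau n)^-1 => A A' n1 n2 p ti.
change ((A' - n1 * p - (A - n2 * p)) * ti = ti * (A' + -1 * A) - (n1 - n2) * ti * p).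
by ring.
Qed.

Lemma no_orthogonal_isothermal_map (kw kz : R) : 0 < rho -> kw != 0 -> kz != 0 ->
  (forall z, disc rho z -> nrm (Gw z 0) ^+ 2 = kw * nrm (G z 0) ^+ 2) ->
  nrm (Gz 0 0) ^+ 2 = kz * nrm (G 0 0) ^+ 2 ->
  G 0 0 = 0.
Proof.
move=> rho0 kw0 kz0 Hw Hz.
have dr0 : disc rho 0 by rewrite /disc /= nrm0.
have pn : pi *+ 2 != 0 :> R by rewrite gt_eqF // pi2_gt0.
have uniq (a : nat -> R) (x y : R) : a @ \oo --> x -> a @ \oo --> y -> x = y.
  by move=> h1 h2; apply: cvg_unique h1 h2; exact: norm_hausdorff.
have as_w z : disc rho z -> (fun n => (rho / n.+2%:R) ^- 2 * wenergy (rho / n.+2%:R) z) @ \oo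
    --> nrm (Gw z 0) ^+ 2 * (pi *+ 2).
  move=> zr; apply: (@energy_asymptotic _ _ (G z) (Gw z) rho K) => //.
    by move=> w wr; exact: dw.
  by move=> x y xr yr; exact: lw.
have srho n : 0 < rho / n.+2%:R < rho.
  by rewrite divr_gt0 //= ltr_pdivrMr // ltr_pMr // ltr1n.
(* Energies independent of z have the same asymptotics, so |G_w(z, 0)|^2 does not depend on z, and
   [kw] can be cancelled. *)
have Ncst z : disc rho z -> nrm (G z 0) ^+ 2 = nrm (G 0 0) ^+ 2.
  move=> zr; have h := as_w z zr.
  have h' : (fun n => (rho / n.+2%:R) ^- 2 * wenergy (rho / n.+2%:R) 0) @ \oo
      --> nrm (Gw z 0) ^+ 2 * (pi *+ 2).
    by move: h; under eq_fun do rewrite (wenergy_cst zr (srho _)).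
  have := mulIf pn (uniq _ _ _ h' (as_w 0 dr0)).
  rewrite (Hw _ zr) (Hw _ dr0); exact: (mulfI kw0).
have as_z : (fun n => (rho / n.+2%:R) ^- 2 * energy (fun z => G z 0) (rho / n.+2%:R)) @ \oo
    --> nrm (Gz 0 0) ^+ 2 * (pi *+ 2).
  apply: (@energy_asymptotic _ _ (fun z => G z 0) (fun z => Gz z 0) rho K) => //.
    by move=> z zr; exact: dz.
  by move=> x y xr yr; exact: lz.
(* On each circle |G(z, 0)|^2 equals its central value, so the energy in z vanishes and its
   asymptotics give G_z(0, 0) = 0. *)
have e0 n : energy (fun z => G z 0) (rho / n.+2%:R) = 0.
  rewrite /energy (_ : (fun t => _) = fun=> nrm (G 0 0) ^+ 2) ?circ_cst ?subrr //.
  apply/funext => t; apply: Ncst; apply: disc_polar.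
  by have /andP[/ltW -> ->] := srho n.
move: as_z; under eq_fun do rewrite e0 mulr0.
move=> h; have c0 : (fun _ : nat => 0 : R) @ \oo --> (0 : R) by exact: cvg_cst.
have := uniq _ _ _ h c0; move=> /eqP.
rewrite mulf_eq0 (negbTE pn) orbF Hz mulf_eq0 (negbTE kz0) /= sqrf_eq0 => /eqP.
exact: nrm0_eq0.
Qed.

End Kernel.
End TwoVariables.

Section LipschitzFromDerivative.
Variables (R : realType) (N : option nat).
Local Notation C := (Cplx R).
Local Notation E := (cspace R N).

(** The mean value theorem is applied to the real function <H(z(t)), v> with v = H x - H y: its
    total increment is |v|^2, its slope at most K |x - y| |v|. *)
Lemma derivative_bound_lip (H dH : C -> E) (b K : R) :
  (forall x, disc b x -> vderiv (disc b) H x (dH x)) ->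
  (forall x, disc b x -> nrm (dH x) <= K) ->
  forall x y, disc b x -> disc b y -> nrm (H x - H y) <= K * nrm (x - y).
Proof.
move=> dHx dHK x y xb yb.
pose v := H x - H y; pose z (t : R) : C := y + t%:C%C * (x - y).
pose m (t : R) := ip (H (z t)) v.
have zb (t : R) : 0 <= t <= 1 -> disc b (z t).
  move=> /andP[t0 t1]; rewrite /disc /= /z.
  rewrite (_ : y + _ = t%:C%C * x + (1 - t)%:C%C * y); last by rewrite rmorphB rmorph1; ring.
  rewrite (le_lt_trans (nrmD _ _)) // !nrmM !nrm_real ger0_norm // ger0_norm ?subr_ge0 //.
  have [xb' yb'] : nrm x < b /\ nrm y < b by [].
  have [t1'|t1'] := ltP t 1; last first.
    have -> : t = 1 by apply/le_anti; rewrite t1 t1'.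
    by rewrite subrr mul1r mul0r addr0.
  have h1 : 0 < (1 - t) * (b - nrm y) by rewrite mulr_gt0 // subr_gt0.
  have h2 : 0 <= t * (b - nrm x) by rewrite mulr_ge0 // subr_ge0 ltW.
  lra.
have dm (t : R) : 0 <= t <= 1 -> is_derive t 1 m (ip ((x - y) *: dH (z t)) v).
  move=> t01; have ztb := zb t t01.
  (* For |tau| < d the point z (t + tau) is still in the disc; the added 1 keeps the denominator
     positive. *)
  pose d := (b - nrm (z t)) / (nrm (x - y) + 1).
  have xy1 : 0 < nrm (x - y) + 1 by rewrite ltr_wpDl ?nrm_ge0.
  have d0 : 0 < d by rewrite divr_gt0 // subr_gt0.
  apply: (seq_is_derive d0) => tau taun taud tau0.
  pose h n : C := (tau n)%:C%C * (x - y).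
  have zE n : z (t + tau n) = z t + h n by rewrite /z /h rmorphD; ring.
  have h0 : h @ \oo --> (0 : C).
    have tC : (fun n => (tau n)%:C%C : C) @ \oo --> (0 : C).
      by rewrite -(rmorph0 (real_complex R)); exact: cvg_real_complex.
    by rewrite -[X in _ --> X](mul0r (x - y)); exact: cvgCM tC (cvgCcst _).
  have hD n : disc b (z t + h n).
    rewrite /disc /= (le_lt_trans (nrmD _ _)) // nrmM nrm_real -ltrBrDl.
    have := taud n; rewrite /d ltr_pdivlMr // mulrDr mulr1 => hh.
    by rewrite (le_lt_trans _ hh) // lerDl.
  have [e e0 fe] := dHx _ ztb h h0 hD.
  rewrite (_ : (fun n => _) = fun n => ip ((x - y) *: dH (z t)) v + complex.Re ((x - y) * hip (e n) v)).
    rewrite -[X in _ --> X]addr0; apply: cvgD; first exact: cvg_cst.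
    have c := cvgCM (cvgCcst (x - y)) (cvg_hip_l v e0).
    have c' : (fun n => (x - y) * hip (e n) v) @ \oo --> (0 : C).
      by rewrite -(mulr0 (x - y)); exact: c.
    exact: (cvg_Re c').
  apply/funext => n; rewrite /m zE fe ipDl -hipZl /= /h -scalerA ipZl scalerDr ipDl.
  by field.
have cm : {within `[0, 1], continuous m}.
  apply: continuous_in_subspaceT => t /set_mem /=; rewrite in_itv /= => /dm ht.
  by apply: differentiable_continuous; exact/derivable1_diffP.
have dm' (t : R) : t \in `]0, 1[ -> is_derive t 1 m (ip ((x - y) *: dH (z t)) v).
  by rewrite in_itv /= => /andP[/ltW t0 /ltW t1]; apply/dm/andP.
have [t t01 mE] := MVT_segment ler01 dm' cm.
have z1 : z 1 = x by rewrite /z rmorph1 mul1r addrC subrK.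
have z0 : z 0 = y by rewrite /z rmorph0 mul0r addr0.
move: mE; rewrite /m z1 z0 -ipNl -ipDl -/v ipxx subr0 mulr1 => mE.
have zt : disc b (z t) by apply: zb; move: t01; rewrite in_itv.
have := ip_le ((x - y) *: dH (z t)) v; rewrite -mE nrmZ.
have [->|vn] := eqVneq (nrm v) 0.
  by rewrite mulr_ge0 ?nrm_ge0 // (le_trans (nrm_ge0 _) (dHK _ xb)).
have vp : 0 < nrm v by rewrite lt_def vn nrm_ge0.
rewrite expr2 ler_pM2r // => h; rewrite (le_trans h) // mulrC ler_wpM2r ?nrm_ge0 //.
exact: dHK.
Qed.

End LipschitzFromDerivative.

(** * From differentials to expansions along sequences *)

Section FromDifferentiable.
Variable R : realType.
Local Notation C := (Cplx R).

Lemma nrm_pair_le (V W : normedModType C) (p : V * W) : nrm p <= nrm p.1 + nrm p.2.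
Proof.
rewrite {1}/nrm prod_normE /Order.max; case: ifP => _.
  by rewrite -/(nrm _) lerDr nrm_ge0.
by rewrite -/(nrm _) lerDl nrm_ge0.
Qed.

(** Gives the sequential form of [vderiv] in one direction; the error is set to 0 where h n = 0,
    where nothing is known about the quotient. *)
Lemma differentiable_seq (V W : normedModType C) (g : V -> W) (q u : V) (h : nat -> C) :
  differentiable g q -> h @ \oo --> (0 : C) ->
  exists2 e : nat -> W, e @ \oo --> (0 : W) &
    forall n, g (q + h n *: u) = g q + h n *: ('d g q u + e n).
Proof.
move=> dg h0.
pose F (x : C) := x^-1 *: (g (x *: u + q) - g q).
have DF : F @ 0^' --> 'd g q u.
  by rewrite -deriveE //; exact: (@diff_derivable _ _ _ g q u dg).
pose e n : W := if h n == 0 then 0 else F (h n) - 'd g q u.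
exists e; last first.
  move=> n; rewrite /e; have [->|hn] := eqVneq (h n) 0; first by rewrite !scale0r !addr0.
  by rewrite (addrC ('d g q u)) subrK /F scalerA mulfV // scale1r [_ *: u + q]addrC [RHS]addrC subrK.
apply/cvg_nrmP/cvgr0Pnorm_lt => eps eps0.
move: DF => /cvg_nrmP/cvgr0Pnorm_lt/(_ eps eps0).
move=> DF0.
have /near_nrmP[d d0 Hd] : \forall t \near (0 : C), t != 0 -> `|nrm (F t - 'd g q u)| < eps.
  exact: DF0.
move: h0 => /cvg_nrmP/cvgr0Pnorm_lt/(_ d d0); apply: filterS => n.
rewrite !ger0_norm ?nrm_ge0 // subr0 => hd; rewrite subr0 /e.
have [_|hn] := eqVneq (h n) 0; first by rewrite nrm0.
have := Hd (h n); rewrite subr0 => /(_ hd hn).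
by rewrite ger0_norm ?nrm_ge0.
Qed.

End FromDifferentiable.

(** * A lift to C^N has conformally prescribed, orthogonal partial derivatives *)

Section NotHopfInduced.
Variable R : realType.
Local Notation C := (Cplx R).

(** The differential is C-linear, so evaluating the equality of forms at (u, -i v) recovers the
    pulled-back metric. *)
Lemma hopf_pullback_ip (N : option nat) (c : R) (g : C * C -> cspace R N) (q u v : C * C) :
  0 < c -> differentiable g q -> g q != 0 -> upper q ->
  (forall u v, pullback g (@hopf_form R c N) q u v = tricerri_form q u v) ->
  let y : R := complex.Im q.2 in
  ip ('d g q u) ('d g q v) =
  nrm (g q) ^+ 2 / c * (y * rdot u.1 v.1 + rdot u.2 v.2 / (4 * y ^+ 2)).
Proof.
move=> c0 dg gq0 qu H y.
have y0 : 0 < y by [].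
have n0 : 0 < nrm (g q) by rewrite nrm_gt0.
have L : ('i%C : C) *: 'd g q (- ('i%C : C) *: v) = 'd g q v.
  by rewrite linearZ /= scalerA mulrN -expr2 sqr_i opprK scale1r.
have := H u (- ('i%C : C) *: v).
rewrite /pullback /hopf_form flat_formE L.
rewrite nrmE -rmorphXn -fmorphV -rmorphM => /(congr1 (@complex.Re R)).
rewrite [complex.Re (_ %:C)%C]/= => E.
have -> : ip ('d g q u) ('d g q v) =
  - (nrm (g q) ^+ 2 / (2 * c)) * (nrm (g q) ^- 2 * (- (2 * c) * ip ('d g q u) ('d g q v))).
  by field; rewrite !gt_eqF.
have qy : complex.Im q.2 = y by [].
rewrite E /tricerri_form qy -complexiE; clear L E; move: y y0 {qy} => y y0.
rewrite /dz_dzbar /rdot; case: u v => [[a b] [a' b']] [[a1 b1] [a2 b2]].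
rewrite !conjCE /=.
by field; rewrite !gt_eqF.
Qed.

Lemma not_hopf_induced (c lam : R) (mu : C) m ell : 0 < c ->
  ~ hopf_induced c mu lam m ell.
Proof.
move=> c0 [N [lambda [f [_ _ /(_ (0, 'i%C))]]]].
have p0u : @upper R (0, 'i%C) by rewrite /upper /=.
move=> /(_ p0u)[U [g [[Uo Up0] Uupper dg _ gH]]].
pose p0 : C * C := (0, 'i%C).
have [d1 d10 Hd1] : exists2 d : R, 0 < d & forall x, nrm (x - p0) < d -> U x.
  by apply/near_nrmP; apply: open_nbhs_nbhs.
have cg : {for p0, continuous g}.
  by apply: differentiable_continuous; have [] := dg p0 Up0.
pose B := nrm (g p0) + 1.
have [d2 d20 Hd2] : exists2 d : R, 0 < d & forall x, nrm (x - p0) < d -> nrm (g x) < B.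
  have gB : \forall y \near g p0, nrm y < B.
    apply/near_nrmP; exists 1 => // x xg.
    by rewrite (le_lt_trans (nrm_le_dist _ (g p0))) // ltrD2l.
  by apply/near_nrmP; exact: (cg _ gB).
(* The bound 1/2 keeps y = 1 + Im w in [1/2, 3/2]; the other one is halved because the distance of a
   pair is bounded by the sum of both distances. *)
pose rho := Num.min (1 / 2) (Num.min d1 d2 / 2).
have rho0 : 0 < rho by rewrite !lt_min !divr_gt0 // lt_min d10.
pose pt (z w : C) : C * C := (z, 'i%C + w).
have ptd z w : disc rho z -> disc rho w -> nrm (pt z w - p0) < Num.min d1 d2.
  rewrite /disc /= => zr wr; rewrite (le_lt_trans (nrm_pair_le _)) //=.
  rewrite subr0 [_ + w]addrC addrK (lt_le_trans (ltrD zr wr)) //.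
  have : rho <= Num.min d1 d2 / 2 by rewrite ge_min lexx orbT.
  lra.
have ptU z w : disc rho z -> disc rho w -> U (pt z w).
  by move=> zr wr; apply: Hd1; have := ptd z w zr wr; rewrite lt_min => /andP[].
have ptB z w : disc rho z -> disc rho w -> nrm (g (pt z w)) <= B.
  by move=> zr wr; apply/ltW/Hd2; have := ptd z w zr wr; rewrite lt_min => /andP[].
pose G z w := g (pt z w).
pose Gz z w : cspace R N := 'd g (pt z w) (1, 0).
pose Gw z w : cspace R N := 'd g (pt z w) (0, 1).
have gip z w u v (zr : disc rho z) (wr : disc rho w) :
    ip ('d g (pt z w) u) ('d g (pt z w) v) = nrm (G z w) ^+ 2 / c *
    ((1 + complex.Im w) * rdot u.1 v.1 + rdot u.2 v.2 / (4 * (1 + complex.Im w) ^+ 2)).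
  have ptu := ptU z w zr wr; have [dgp gp0] := dg _ ptu.
  have imE : 1 + complex.Im w = complex.Im (pt z w).2 by case: (w) => a b.
  rewrite imE; exact: (hopf_pullback_ip u v c0 dgp gp0 (Uupper _ ptu) (fun u v => gH _ u v ptu)).
have imw w : disc rho w -> 1 / 2 <= 1 + complex.Im w <= 3 / 2.
  rewrite /disc /= => wr.
  have : `|complex.Im w| <= 1 / 2.
    rewrite (le_trans (le_Im_nrm _)) // (le_trans (ltW wr)) // ge_min lexx //.
  by rewrite ler_norml => /andP[? ?]; apply/andP; split; lra.
have rd1 : rdot (1 : C) 1 = 1 by rewrite /rdot /=; ring.
have rd0l (x : C) : rdot 0 x = 0 by rewrite /rdot /=; ring.
have rd0r (x : C) : rdot x 0 = 0 by rewrite /rdot /=; ring.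
have Gz2 z w : disc rho z -> disc rho w ->
    nrm (Gz z w) ^+ 2 = ((1 + complex.Im w) / c) * nrm (G z w) ^+ 2.
  move=> zr wr; rewrite -ipxx (gip _ _ _ _ zr wr) /= rd1 rd0l; ring.
have Gw2 z w : disc rho z -> disc rho w ->
    nrm (Gw z w) ^+ 2 = (4 * c * (1 + complex.Im w) ^+ 2)^-1 * nrm (G z w) ^+ 2.
  move=> zr wr; rewrite -ipxx (gip _ _ _ _ zr wr) /= rd1 rd0l.
  have /andP[h _] := imw w wr.
  have h1 : 1 + complex.Im w != 0 by rewrite gt_eqF // (lt_le_trans _ h) // divr_gt0.
  by field; rewrite h1 gt_eqF.
have orth z w : disc rho z -> disc rho w -> hip (Gz z w) (Gw z w) = 0.
  move=> zr wr; rewrite /hip /Gw -linearZ !(gip _ _ _ _ zr wr) /=.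
  rewrite scaler0 rd0r !rd0l mul0r mulr0 addr0 mulr0 //.
have B0 : 0 <= B by rewrite addr_ge0 ?nrm_ge0.
(* One constant for both partial derivatives: |G_z|^2 = (y / c) |G|^2 with y <= 3/2, and |G_w|^2 =
   |G|^2 / (4 c y^2) with y >= 1/2. *)
pose K := Num.sqrt (2 * B ^+ 2 / c).
have K2 : K ^+ 2 = 2 * B ^+ 2 / c.
  by rewrite sqr_sqrtr // divr_ge0 ?(ltW c0) // mulr_ge0 ?sqr_ge0.
have K0 : 0 <= K by exact: sqrtr_ge0.
have GB z w : disc rho z -> disc rho w -> nrm (G z w) ^+ 2 <= B ^+ 2.
  by move=> zr wr; rewrite lerXn2r ?nnegrE ?nrm_ge0 // ptB.
have bGz z w : disc rho z -> disc rho w -> nrm (Gz z w) <= K.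
  move=> zr wr; rewrite -(@ler_pXn2r _ 2) ?nnegrE ?nrm_ge0 // K2 Gz2 //.
  rewrite mulrAC ler_pM2r ?invr_gt0 //; have /andP[i1 i2] := imw w wr.
  by rewrite ler_pM ?sqr_ge0 ?GB //; lra.
have bGw z w : disc rho z -> disc rho w -> nrm (Gw z w) <= K.
  move=> zr wr; rewrite -(@ler_pXn2r _ 2) ?nnegrE ?nrm_ge0 // K2 Gw2 //.
  have /andP[i1 i2] := imw w wr.
  rewrite [X in _ <= X](_ : _ = 2 / c * B ^+ 2); last by ring.
  have y0 : 0 < 1 + complex.Im w by lra.
  have cy : 0 < 4 * c * (1 + complex.Im w) ^+ 2 by rewrite !mulr_gt0.
  apply: ler_pM; rewrite ?sqr_ge0 ?GB ?invr_ge0 ?(ltW cy) //.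
  rewrite -[X in X <= _]mul1r ler_pdivrMr // (_ : 2 / c * _ = 8 * (1 + complex.Im w) ^+ 2).
    nra.
  by field; rewrite gt_eqF.
have dz z w : disc rho z -> disc rho w ->
    vderiv (disc rho) (fun z => G z w) z (Gz z w).
  move=> zr wr h h0 hD; have [dgp _] := dg _ (ptU z w zr wr).
  have [e e0 fe] := @differentiable_seq R _ _ g _ (1, 0) h dgp h0; exists e => // n.
  rewrite -fe /G /pt; congr g; congr pair; first by rewrite /= [_ *: _]mulr1.
  by rewrite /= scaler0 addr0.
have dw z w : disc rho z -> disc rho w -> vderiv (disc rho) (G z) w (Gw z w).
  move=> zr wr h h0 hD; have [dgp _] := dg _ (ptU z w zr wr).
  have [e e0 fe] := @differentiable_seq R _ _ g _ (0, 1) h dgp h0; exists e => // n.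
  rewrite -fe /G /pt; congr g; congr pair; first by rewrite /= scaler0 addr0.
  by rewrite /= [_ *: _]mulr1 addrA.
have dr0 : disc rho 0 by rewrite /disc /= nrm0.
have /eqP : G 0 0 = 0; last first.
  by apply/negP; have [] := dg _ (ptU 0 0 dr0 dr0).
(* The two factors at w = 0, that is y = 1. *)
apply: (@no_orthogonal_isothermal_map R N G Gz Gw rho K B dz dw _ _ bGz bGw ptB orth
  (4 * c)^-1 c^-1 rho0) => //.
- by move=> z z' w zr zr' wr; apply: (derivative_bound_lip (fun x xr => dz x w xr wr)) => // x xr; exact: bGz.
- by move=> z w w' zr wr wr'; apply: (derivative_bound_lip (dw z ^~ zr)) => // x xr; exact: bGw.
- by rewrite invr_neq0 // mulf_neq0 // gt_eqF.
- by rewrite invr_neq0 // gt_eqF.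
- by move=> z zr; rewrite Gw2 // addr0 expr1n mulr1.
- by rewrite Gz2 // addr0 mul1r.
Qed.

End NotHopfInduced.

Section ZmoduleIdentities.
Variable V : zmodType.
Implicit Types a b c d : V.

Lemma addKC a b : a + b - a = b.
Proof. by rewrite addrC addKr. Qed.

Lemma subDDl a b c : (a + b) - (a + c) = b - c.
Proof. by rewrite opprD addrACA subrr add0r. Qed.

End ZmoduleIdentities.

Lemma lmod_rearrange (K : comNzRingType) (V : lmodType K) (a b c d : V) (z h : K) :
  (h *: a + z *: c) - h *: (b + z *: d) = h *: (a - b) + z *: (c - h *: d).
Proof. by rewrite scalerDr scalerBr scalerBr !scalerA (mulrC h z) opprD addrACA. Qed.

Lemma cvg_near_eq (R : realType) (V : normedModType (Cplx R)) (T : Type)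
    (F : set_system T) {FF : Filter F} (f g : T -> V) (l : V) :
  (\forall t \near F, f t = g t) -> f @ F --> l -> g @ F --> l.
Proof.
move=> fg /cvg_nrmP/cvgr0Pnorm_lt H; apply/cvg_nrmP/cvgr0Pnorm_lt => e e0.
by apply: filterS2 fg (H e e0) => t <-.
Qed.

(** * Totally geodesic submanifolds of a flat space *)

Section FlatSubmanifolds.
Variables (R : realType) (E : normedModType (Cplx R)).
Local Notation C := (Cplx R).

(** The slope [b t] may vary with t a priori. The supremum T of the times up to which the affine
    formula with slope [b 0] holds is reached, and cannot be below 1, because the local formula at T
    is two-sided. *)
Lemma locally_affine_segment (k b : R -> E) :
  (forall t, 0 <= t <= 1 -> exists2 e : R, 0 < e &
     forall s, `|s| < e -> 0 <= t + s <= 1 -> k (t + s) = k t + (s%:C%C : C) *: b t) ->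
  k 1 = k 0 + b 0.
Proof.
move=> H.
pose A : set R := [set t | 0 <= t <= 1 /\
  forall s, 0 <= s <= t -> k s = k 0 + (s%:C%C : C) *: b 0].
have A0 : A 0.
  split; first by rewrite lexx ler01.
  move=> s /andP[s0 s0']; have -> : s = 0 by apply/le_anti; rewrite s0 s0'.
  by rewrite rmorph0 scale0r addr0.
have Aub : ubound A 1 by move=> t [/andP[]].
have supA : has_sup A by split; [exists 0 | exists 1].
pose T := sup A.
have T0 : 0 <= T by apply: ub_le_sup => //; exists 1.
have T1 : T <= 1 by apply: ge_sup => //; exists 0.
have T01 : 0 <= T <= 1 by rewrite T0 T1.
have [e e0 He] := H T T01.
have [bT kT] : b T = b 0 /\ k T = k 0 + (T%:C%C : C) *: b 0.
  have [TE|Tn] := eqVneq T 0; first by rewrite TE rmorph0 scale0r addr0.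
  have Tp : 0 < T by rewrite lt_def Tn.
  have eT : 0 < Num.min e T by rewrite lt_min e0.
  have [t [/andP[t0 t1] At] tT] := sup_adherent eT supA.
  have tT' : t <= T by apply: ub_le_sup; [exists 1 | split=> //; apply/andP].
  pose m := T - Num.min e T.
  have m0 : 0 <= m by rewrite subr_ge0 ge_min lexx orbT.
  have mt : m < t by [].
  (* A second point left of T: comparing the two formulas at s and t identifies the slope at T with
     [b 0]. *)
  pose s := (m + t) / 2.
  have ms : m < s by rewrite /s; lra.
  have st : s < t by rewrite /s; lra.
  have me : T - e <= m by rewrite lerD2l lerN2 ge_min lexx.
  have ev x : m < x -> x <= T -> k x = k T + ((x - T)%:C%C : C) *: b T.
    move=> mx xT; have := He (x - T); rewrite (addrC T) subrK; apply.
      by rewrite ler0_norm; lra.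
    by apply/andP; split; lra.
  have k1 := ev t mt tT'; have k2 := ev s ms (le_trans (ltW st) tT').
  rewrite (At t) ?t0 ?lexx // in k1.
  rewrite (At s) in k2; last by apply/andP; split; lra.
  have d : ((t - s)%:C%C : C) *: b T = ((t - s)%:C%C : C) *: b 0.
    have := congr2 (fun x y => x - y) k1 k2.
    rewrite !subDDl -scalerBl -scalerBl -!rmorphB => ->.
    by congr ((_ %:C)%C *: _); ring.
  have tsn : ((t - s)%:C%C : C) != 0.
    by rewrite -(rmorph0 (real_complex R)) (inj_eq (@complexI R)) subr_eq0 gt_eqF.
  have bT : b T = b 0 by exact: (scalerI tsn).
  split=> //; move: k1; rewrite bT rmorphB scalerBl => /eqP.
  by rewrite addrA eq_sym subr_eq -addrA [_ *: _ + _]addrC addrA => /eqP k1;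
    apply: (addIr ((t%:C%C : C) *: b 0)); rewrite k1.
have kx x : T <= x -> x <= 1 -> x < T + e -> k x = k 0 + (x%:C%C : C) *: b 0.
  move=> Tx x1 xe; have := He (x - T); rewrite (addrC T) subrK => ->.
  - by rewrite bT kT -addrA -scalerDl -rmorphD (addrC T) subrK.
  - by rewrite ger0_norm; lra.
  - by apply/andP; split; lra.
suff TE : T = 1 by rewrite -TE in kT *; rewrite kT TE rmorph1 scale1r.
apply/le_anti; rewrite T1 /= leNgt; apply/negP => Tlt.
(* A time beyond T, below both 1 and T + e, to which the formula extends. *)
pose x := T + Num.min e (1 - T) / 2.
have mm : 0 < Num.min e (1 - T) by rewrite lt_min e0 subr_gt0.
have h1 : Num.min e (1 - T) <= e by rewrite ge_min lexx.
have h2 : Num.min e (1 - T) <= 1 - T by rewrite ge_min lexx orbT.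
have : A x.
  split; first by apply/andP; split; rewrite /x; lra.
  move=> s /andP[s0 sx]; have [Ts|sT] := leP T s.
    by apply: kx => //; move: sx; rewrite /x; lra.
  have sT' : 0 < T - s by rewrite subr_gt0.
  have [t [_ At] tT] := sup_adherent sT' supA.
  by apply: At; rewrite s0 ltW //; move: tT; rewrite opprB addrCA subrr addr0.
move=> /(ub_le_sup _) => /(_ (ex_intro _ 1 Aub)); rewrite -/T /x; lra.
Qed.

(** Tangent vectors are velocities of curves with a real parameter, so the complex limit is
    restricted to real increments. *)
Lemma cvg_real_difference_quotient (f : E -> E) (a v : E) : differentiable f a ->
  ((t^-1)%:C%C : C) *: (f (a + (t%:C%C : C) *: v) - f a) @[t --> (0 : R)^'] --> 'd f a v.
Proof.
move=> df.
have D : x^-1 *: (f (x *: v + a) - f a) @[x --> (0 : C)^'] --> 'd f a v.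
  by rewrite -deriveE //; exact: (@diff_derivable _ _ _ f a v df).
apply/cvg_nrmP/cvgr0Pnorm_lt => eps eps0.
have D0 := D; move: D0 => /cvg_nrmP/cvgr0Pnorm_lt/(_ eps eps0) D0.
have /near_nrmP[d d0 Hd] : \forall x \near (0 : C), x != 0 ->
    `|nrm (x^-1 *: (f (x *: v + a) - f a) - 'd f a v)| < eps.
  exact: D0.
have hd : \forall t \near (0 : R), `|t| < d by exact: nbhs0_lt.
rewrite nearE /dnbhs /within /=; apply: filterS hd => t td t0.
have := Hd t%:C%C; rewrite subr0 nrm_real => /(_ td).
rewrite -(rmorph0 (real_complex R)) (inj_eq (@complexI R)) => /(_ t0).
by rewrite fmorphV addrC [a + _]addrC addrC.
Qed.

(* M is near p the graph of h over a subspace; the tangent lines stay in M, so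
   t |-> h (t u) is locally affine, hence affine, and h agrees with its
   differential at 0. *)
Lemma flat_submanifold_local (M : set E) (p : E) :
  complex_submanifold M -> totally_geodesic M -> M p ->
  exists T : set E,
    [/\ (forall (u : nat -> E) (v : E), (forall n, T (u n)) -> u @ \oo --> v -> T v),
        (forall (z : C) u v, T u -> T v -> T (z *: u + v)),
        T `<=` tangent_space M p &
        exists2 r : R, 0 < r & forall x, M x -> nrm (x - p) < r -> T (x - p)].
Proof.
move=> subM geoM Mp.
have [P [h [U [[cP PP] [Uo Up] dh Ph Mh]]]] := subM p Mp.
have [r0 r00 Ur] : exists2 d : R, 0 < d & forall x, nrm (x - p) < d -> U x.
  by apply/near_nrmP; apply: open_nbhs_nbhs.
have Pp : P (p - p) = 0 by rewrite subrr linear0.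
have dh0 : differentiable h 0 by rewrite -Pp; exact: dh.
have h0 : h 0 = 0.
  by have := (Mh p Up).1 Mp; rewrite Pp subrr subr0.
have r02 : 0 < r0 / 2 by rewrite divr_gt0.
have [r1 r10 Hr1] : exists2 d : R, 0 < d & forall x, nrm (x - 0) < d -> nrm (h x) < r0 / 2.
  apply/near_nrmP.
  have hB : \forall y \near h 0, nrm y < r0 / 2.
    by apply/near_nrmP; exists (r0 / 2) => // x; rewrite h0 subr0.
  exact: (differentiable_continuous dh0 hB).
(* For |u| < r2 both p + u and the graph point p + u + h u lie within r0 of p, hence in U. *)
pose r2 := Num.min r1 (r0 / 2).
have r20 : 0 < r2 by rewrite lt_min r10.
pose gam u := p + u + h u.
have gamE u : gam u - p = u + h u by rewrite /gam -(addrA p u) addKC.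
have puE u : p + u - p = u by exact: addKC.
have gamU u : nrm u < r2 -> U (gam u).
  rewrite lt_min => /andP[u1 u2]; apply: Ur; rewrite gamE.
  rewrite (le_lt_trans (nrmD _ _)) // [r0]splitr ltrD //.
  by apply: Hr1; rewrite subr0.
have puU u : nrm u < r2 -> U (p + u).
  rewrite lt_min => /andP[u1 u2]; apply: Ur; rewrite puE (lt_trans u2) //.
  by rewrite ltr_pdivrMr // ltr_pMr // ltr1n.
have Phu u : P u = u -> nrm u < r2 -> P (h u) = 0.
  by move=> Pu ur; have := Ph _ (puU u ur); rewrite puE Pu.
have dhu u : P u = u -> nrm u < r2 -> differentiable h u.
  by move=> Pu ur; have := dh _ (puU u ur); rewrite puE Pu.
have gamM u : P u = u -> nrm u < r2 -> M (gam u).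
  move=> Pu ur; apply/(Mh _ (gamU u ur)).
  by rewrite gamE linearD Pu Phu // addr0 addKC.
have Puw u w (t : R) : P u = u -> P w = w -> P (u + (t%:C%C : C) *: w) = u + (t%:C%C : C) *: w.
  by move=> Pu Pw; rewrite linearD linearZZ Pu Pw.
have near_small (u w : E) : nrm u < r2 -> \forall t \near (0 : R), nrm (u + (t%:C%C : C) *: w) < r2.
  move=> ur; have w1 : 0 < nrm w + 1 by rewrite ltr_wpDl ?nrm_ge0.
  have d0 : 0 < (r2 - nrm u) / (nrm w + 1) by rewrite divr_gt0 // subr_gt0.
  have := @nbhs0_lt R R _ d0; apply: filterS => t.
  rewrite ltr_pdivlMr // => td.
  rewrite (le_lt_trans (nrmD _ _)) // nrmZr -ltrBrDl (le_lt_trans _ td) //.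
  by rewrite ler_wpM2l // lerDl.
have tang u w : P u = u -> P w = w -> nrm u < r2 ->
    tangent_space M (gam u) (w + 'd h u w).
  move=> Pu Pw ur; exists (fun t => gam (u + (t%:C%C : C) *: w)); split.
  - by rewrite rmorph0 scale0r addr0.
  - have := near_small u w ur; apply: filterS => t tr.
    by apply: gamM => //; exact: Puw.
  - have c := cvg_real_difference_quotient (v := w) (dhu u Pu ur).
    have c2 : (fun _ : R => w) @ (0 : R)^' --> w by exact: cvg_cst.
    apply: cvg_near_eq (cvgD c2 c).
    rewrite nearE /dnbhs /within /=; apply: nearW => t t0.
    rewrite -[LHS]/(w + ((t^-1)%:C%C : C) *: (h (u + (t%:C%C : C) *: w) - h u)).
    rewrite (_ : gam _ - gam u = (t%:C%C : C) *: w + (h (u + (t%:C%C : C) *: w) - h u)).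
      have tC : (t%:C%C : C) != 0 by rewrite -(rmorph0 (real_complex R)) (inj_eq (@complexI R)).
      by rewrite [in RHS]scalerDr [in RHS]scalerA fmorphV mulVf // scale1r.
    have -> : gam (u + (t%:C%C : C) *: w) - gam u =
       (gam (u + (t%:C%C : C) *: w) - p) - (gam u - p) by rewrite opprB addrA subrK.
    by rewrite !gamE opprD addrACA addKC.
have Pdh u w : P u = u -> P w = w -> nrm u < r2 -> P ('d h u w) = 0.
  move=> Pu Pw ur.
  have c := cvg_real_difference_quotient (v := w) (dhu u Pu ur).
  have c2 : P (((t^-1)%:C%C : C) *: (h (u + (t%:C%C : C) *: w) - h u)) @[t --> (0 : R)^'] -->
      P ('d h u w) by apply: continuous_cvg c; exact: cP.
  have c3 : (fun _ : R => 0 : E) @ (0 : R)^' --> P ('d h u w).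
    apply: cvg_near_eq c2.
    rewrite nearE /dnbhs /within /=; have := near_small u w ur.
    apply: filterS => t tr t0.
    by rewrite linearZZ linearB Phu ?Puw // (Phu u) // subrr scaler0.
  have c4 : (fun _ : R => 0 : E) @ (0 : R)^' --> (0 : E) by exact: cvg_cst.
  by apply: cvg_unique c3 c4; exact: norm_hausdorff.
(* The tangent line at the graph point over u stays in M for small times; its P-component is u + t
   w, so the graph equation reads off h there. *)
have geo u w : P u = u -> P w = w -> nrm u < r2 ->
    exists2 e : R, 0 < e & forall t : R, `|t| < e -> nrm (u + (t%:C%C : C) *: w) < r2 ->
      h (u + (t%:C%C : C) *: w) = h u + (t%:C%C : C) *: 'd h u w.
  move=> Pu Pw ur.
  have := geoM _ _ (gamM u Pu ur) (tang u w Pu Pw ur).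
  have v1 : 0 < nrm (w + 'd h u w) + 1 by rewrite ltr_wpDl ?nrm_ge0.
  have nU : \forall t \near (0 : R), U (gam u + (t%:C%C : C) *: (w + 'd h u w)).
    have /near_nrmP[d d0 Hd] : \forall x \near gam u, U x.
      by apply: open_nbhs_nbhs; split => //; exact: gamU.
    have dd : 0 < d / (nrm (w + 'd h u w) + 1) by rewrite divr_gt0.
    have := @nbhs0_lt R R _ dd; apply: filterS => t; rewrite ltr_pdivlMr // => td.
    apply: Hd; rewrite addKC nrmZr (le_lt_trans _ td) //.
    by rewrite ler_wpM2l // lerDl.
  move=> nM.
  have nMU : \forall t \near (0 : R), M (gam u + (t%:C%C : C) *: (w + 'd h u w)) /\
     U (gam u + (t%:C%C : C) *: (w + 'd h u w)) by exact: filterI nM nU.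
  move: nMU => /nbhs_norm0P[e /= e0 He].
  exists e => // t te tr.
  have [Mt Ut] := He t te.
  move: Mt => /(Mh _ Ut).
  have -> : gam u + (t%:C%C : C) *: (w + 'd h u w) - p =
      (u + (t%:C%C : C) *: w) + (h u + (t%:C%C : C) *: 'd h u w).
    by rewrite addrAC gamE scalerDr addrACA.
  have -> : P ((u + (t%:C%C : C) *: w) + (h u + (t%:C%C : C) *: 'd h u w)) = u + (t%:C%C : C) *: w.
    by rewrite (linearD P) Puw // (linearD P) (linearZZ P) Phu // Pdh // scaler0 !addr0.
  by rewrite addKC => ->.
have hlin u : P u = u -> nrm u < r2 -> h u = 'd h 0 u.
  move=> Pu ur.
  have Ptu (t : R) : P ((t%:C%C : C) *: u) = (t%:C%C : C) *: u by rewrite linearZZ Pu.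
  have tur (t : R) : 0 <= t <= 1 -> nrm ((t%:C%C : C) *: u) < r2.
    move=> /andP[t0 t1]; rewrite nrmZr ger0_norm // (le_lt_trans _ ur) //.
    by rewrite ler_piMl ?nrm_ge0.
  have := @locally_affine_segment (fun t => h ((t%:C%C : C) *: u))
     (fun t => 'd h ((t%:C%C : C) *: u) u).
  rewrite rmorph1 scale1r rmorph0 scale0r h0 add0r; apply => t t01.
  have [e e0 He] := geo _ u (Ptu t) Pu (tur t t01).
  exists e => // s se ts; rewrite rmorphD scalerDl; apply: He => //.
  by rewrite -scalerDl -rmorphD; exact: tur.
have cL : continuous ('d h 0) by exact: diff_continuous.
(* The graph of the differential of h at 0 over P(E), closed because P and this differential are
   continuous. *)
exists [set v | v - P v = 'd h 0 (P v)]; split.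
- move=> u v Tu uv.
  have c1 : (fun n => u n - P (u n)) @ \oo --> v - P v.
    apply: cvgB => //; apply: continuous_cvg uv; exact: cP.
  have c2 : (fun n => 'd h 0 (P (u n))) @ \oo --> 'd h 0 (P v).
    have c3 : (fun n => P (u n)) @ \oo --> P v by apply: continuous_cvg uv; exact: cP.
    apply: continuous_cvg c3; exact: cL.
  rewrite /=; apply: cvg_unique c2; first exact: norm_hausdorff.
  by move: c1; under eq_fun do rewrite Tu.
- move=> z u v /= Tu Tv; rewrite !linearP /= -Tu -Tv.
  by rewrite addrACA [in RHS]scalerDr.
- move=> v /= Tv; have PPv := PP v.
  have := tang 0 (P v) (linear0 P) PPv; rewrite nrm0 => /(_ r20).
  by rewrite /gam h0 !addr0 -Tv addrC subrK.
- have [r3 r30 Hr3] : exists2 d : R, 0 < d & forall x, nrm (x - 0) < d -> nrm (P x) < r2.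
    apply/near_nrmP.
    have hB : \forall y \near P 0, nrm y < r2.
      by apply/near_nrmP; exists r2 => // x; rewrite linear0 subr0.
    exact: (cP 0 _ hB).
  exists (Num.min r3 r0); first by rewrite lt_min r30.
  move=> x Mx; rewrite lt_min => /andP[x3 x0] /=.
  rewrite ((Mh x (Ur x x0)).1 Mx); apply: hlin; first exact: PP.
  by apply: Hr3; rewrite subr0.
Qed.

End FlatSubmanifolds.

(** * The immersion into square-summable sequences *)

Section SquareSummable.
Variable R : realType.
Local Notation C := (Cplx R).
Local Notation E := (cspace R None).
Implicit Types (x y : E) (f g : nat -> C) (z : C).

Lemma cspace_ext x y : (forall k, x k = y k) -> x = y.
Proof. by move=> xy; apply/val_inj/funext. Qed.

(** A sequence that is not square summable is sent to 0, so that no proof of convergence is carried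
    inside terms; [mkl2E] restores it when needed. *)
Definition mkl2 f : E := insubd 0 f.

Lemma mkl2E f k : cvgn (sum2 f) -> mkl2 f k = f k.
Proof.
move=> cf; have fin : f \in @l2_pred R None by apply/asboolP.
by rewrite /mkl2 -[LHS]/(val (insubd (0 : E) f) k) insubdK.
Qed.

Definition shift_seq f k : C := if k is k'.+1 then f k' else 0.

Lemma abs20 : abs2 (0 : C) = 0.
Proof. by rewrite /abs2 /=; ring. Qed.

Lemma sum2_shift_seq f n : sum2 (shift_seq f) n.+1 = sum2 f n.
Proof. by rewrite /sum2 /series /= big_nat_recl //= abs20 add0r. Qed.

Lemma cvg_sum2_shift_seq f : cvgn (sum2 f) ->
  sum2 (shift_seq f) @ \oo --> limn (sum2 f).
Proof.
move=> cf; rewrite -(cvg_shiftS (sum2 (shift_seq f))).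
by rewrite (_ : (fun n => _) = sum2 f) //; apply/funext => n; exact: sum2_shift_seq.
Qed.

Lemma sqrt_sum2D f g n :
  Num.sqrt (sum2 (fun k => f k + g k) n) <= Num.sqrt (sum2 f n) + Num.sqrt (sum2 g n).
Proof.
rewrite -[leRHS]ger0_norm ?addr_ge0 ?sqrtr_ge0 // -sqrtr_sqr ler_wsqrtr //.
exact: sum2D.
Qed.

(* f = g + z * shift f bounds the partial sums of f by those of g, since the
   shift is an isometry and |z| < 1. *)
Lemma is_cvg_sum2_rec f g z : nrm z < 1 -> cvgn (sum2 g) -> f 0%N = g 0%N ->
  (forall k, f k.+1 = z * f k + g k.+1) -> cvgn (sum2 f).
Proof.
move=> z1 cg f0 fS; apply: nondecreasing_is_cvgn; first exact: sum2_nd.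
have d0 : 0 < 1 - nrm z by rewrite subr_gt0.
exists ((Num.sqrt (limn (sum2 g)) / (1 - nrm z)) ^+ 2) => _ [n _ <-].
have fE : f = fun k => z * shift_seq f k + g k.
  by apply/funext => -[|k]; rewrite /= ?mulr0 ?add0r ?fS.
have h1 : Num.sqrt (sum2 f n) <= nrm z * Num.sqrt (sum2 f n) + Num.sqrt (limn (sum2 g)).
  rewrite {1}fE (le_trans (sqrt_sum2D _ _ _)) // lerD //; last first.
    by rewrite ler_wsqrtr // sum2_le_lim.
  rewrite sum2Z /= -sqr_nrm sqrtrM ?sqr_ge0 // sqrtr_sqr ger0_norm ?nrm_ge0 //.
  rewrite ler_wpM2l ?nrm_ge0 // ler_wsqrtr //.
  by case: n => [|n]; rewrite ?sum2_shift_seq ?sum2_nd // /sum2 /series /= !big_geq.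
have h2 : Num.sqrt (sum2 f n) <= Num.sqrt (limn (sum2 g)) / (1 - nrm z).
  by rewrite ler_pdivlMr //; lra.
rewrite -[leLHS]sqr_sqrtr ?sum2_ge0 // lerXn2r ?nnegrE ?sqrtr_ge0 //.
by rewrite divr_ge0 ?sqrtr_ge0 ?ltW.
Qed.

Definition Sh x : E := mkl2 (shift_seq x).

Lemma ShE x k : Sh x k = shift_seq x k.
Proof.
by rewrite mkl2E //; apply/cvg_ex; exists (limn (sum2 x));
  apply: cvg_sum2_shift_seq; exact: cvg_cspace.
Qed.

Lemma nrm_Sh x : nrm (Sh x) = nrm x.
Proof.
apply/eqP; rewrite -(@eqrXn2 _ 2) ?nrm_ge0 //; apply/eqP; rewrite !sqr_cnrm.
rewrite (_ : sum2 (Sh x) = sum2 (shift_seq x)); last first.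
  by congr sum2; apply/funext => k; rewrite ShE.
by apply/cvg_lim => //; apply: cvg_sum2_shift_seq; exact: cvg_cspace.
Qed.

Lemma ShD x y : Sh (x + y) = Sh x + Sh y.
Proof.
apply: cspace_ext => k; rewrite coordD !ShE; case: k => [|k] /=; last exact: coordD.
by rewrite addr0.
Qed.

Lemma ShZ z x : Sh (z *: x) = z *: Sh x.
Proof.
apply: cspace_ext => k; rewrite coordZ !ShE; case: k => [|k] /=; last exact: coordZ.
by rewrite mulr0.
Qed.

Lemma ShN x : Sh (- x) = - Sh x.
Proof. by rewrite -[- x]scaleN1r ShZ scaleN1r. Qed.

Definition delta (j : nat) : E := mkl2 (fun k => (k == j)%:R).

Lemma cvg_delta j : cvgn (sum2 (fun k => (k == j)%:R : C)).
Proof.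
apply: nondecreasing_is_cvgn; first exact: sum2_nd.
exists 1 => _ [n _ <-]; rewrite /sum2 /series /=.
have -> : \sum_(0 <= k < n) abs2 ((k == j)%:R : C) = \sum_(0 <= k < n) (k == j)%:R :> R.
  by apply: eq_bigr => k _; case: (k == j); rewrite /abs2 /=; ring.
rewrite -natr_sum (_ : 1 = 1%:R) // ler_nat.
rewrite -big_mkcond /= sum1_count -(@eq_count _ (pred1 j)) //.
by rewrite count_uniq_mem ?iota_uniq //; case: (_ \in _).
Qed.

Lemma deltaE j k : delta j k = (k == j)%:R.
Proof. by rewrite mkl2E //; exact: cvg_delta. Qed.

Lemma Sh_delta j : Sh (delta j) = delta j.+1.
Proof.
by apply: cspace_ext => k; rewrite ShE deltaE; case: k => [|k] //=; rewrite deltaE.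
Qed.

Lemma coord_le x k : nrm (x k) <= nrm x.
Proof.
rewrite -(@ler_pXn2r _ 2) ?nnegrE ?nrm_ge0 // sqr_nrm sqr_cnrm.
apply: (le_trans _ (@sum2_le_lim R x k.+1 (@cvg_cspace _ _ x))).
by rewrite /sum2 /series /= big_nat_recr //= lerDr sum2_ge0.
Qed.

(** The shift is an isometry, so |x| <= |y| + |z| |x|. Increments and Taylor remainders of geometric
    sequences satisfy recurrences of this shape. *)
Lemma nrm_rec_le x y z : nrm z < 1 -> x = y + z *: Sh x -> nrm x <= nrm y / (1 - nrm z).
Proof.
move=> z1 xE; rewrite ler_pdivlMr ?subr_gt0 //.
have := nrmD y (z *: Sh x); rewrite -xE nrmZ nrm_Sh; lra.
Qed.

Definition geo z : E := mkl2 (fun k => z ^+ k).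

(** The termwise derivative of [geo]; at k = 0 the factor k cancels the truncated exponent. *)
Definition dgeo z : E := mkl2 (fun k => k%:R * z ^+ k.-1).

Lemma geoE z k : nrm z < 1 -> geo z k = z ^+ k.
Proof.
move=> z1; rewrite mkl2E //.
apply: (@is_cvg_sum2_rec _ (fun k => (k == 0)%:R) z) => //; first exact: cvg_delta.
by move=> j; rewrite addr0 exprS.
Qed.

Lemma dgeoE z k : nrm z < 1 -> dgeo z k = k%:R * z ^+ k.-1.
Proof.
move=> z1; rewrite mkl2E //.
apply: (@is_cvg_sum2_rec _ (shift_seq (geo z)) z) => //.
- apply/cvg_ex; exists (limn (sum2 (geo z))).
  by apply: cvg_sum2_shift_seq; exact: cvg_cspace.
- by rewrite mul0r.
- move=> j; rewrite /= geoE //; case: j => [|j]; first by rewrite expr0 mul0r mulr0 add0r mul1r.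
  by rewrite /= exprS -[in LHS]addn1 natrD; ring.
Qed.

Lemma geo_rec z : nrm z < 1 -> geo z = delta 0 + z *: Sh (geo z).
Proof.
move=> z1; apply: cspace_ext => -[|k]; rewrite coordD coordZ deltaE ShE geoE //=.
  by rewrite mulr0 addr0.
by rewrite geoE // add0r exprS.
Qed.

Lemma dgeo_rec z : nrm z < 1 -> dgeo z = Sh (geo z) + z *: Sh (dgeo z).
Proof.
move=> z1; apply: cspace_ext => k; rewrite coordD coordZ [X in _ = X + _]ShE [X in _ = _ + _ * X]ShE.
rewrite [LHS](dgeoE k z1); case: k => [|k].
  by rewrite [X in X + _](_ : _ = 0) // [X in _ + _ * X](_ : _ = 0) // mul0r mulr0 addr0.
rewrite [X in X + _](_ : _ = z ^+ k); last exact: geoE.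
rewrite [X in _ + _ * X](_ : _ = k%:R * z ^+ k.-1); last exact: dgeoE.
case: k => [|k]; first by rewrite mul0r mulr0 addr0 mul1r.
by rewrite -!pred_Sn exprS -[in LHS]addn1 natrD; ring.
Qed.

Lemma nrm_delta j : nrm (delta j) = 1.
Proof.
elim: j => [|j IH]; last by rewrite -Sh_delta nrm_Sh.
apply/eqP; rewrite -(@eqrXn2 _ 2) ?nrm_ge0 //; apply/eqP; rewrite sqr_cnrm expr1n.
apply/cvg_lim => //; rewrite -(cvg_shiftS (sum2 (delta 0))).
rewrite (_ : (fun n => _) = fun=> 1); first exact: cvg_cst.
apply/funext => n; rewrite /sum2 /series /= big_nat_recl //= deltaE big1 ?addr0.
  by rewrite /abs2 /=; ring.
by move=> k _; rewrite deltaE abs20.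
Qed.

Lemma ip_delta x k : ip x (delta k) = complex.Re (x k).
Proof.
apply: ip_unique; rewrite -(cvg_shiftn k.+1).
rewrite (_ : (fun n => _) = fun=> complex.Re (x k)); first exact: cvg_cst.
apply/funext => n; rewrite /series /= (bigD1_seq k) ?iota_uniq //=; last first.
  by rewrite mem_index_iota leq0n addnS ltnS leq_addl.
rewrite big1 ?addr0; first by rewrite deltaE eqxx /rdot /=; ring.
by move=> j jk; rewrite deltaE (negbTE jk) /rdot /=; ring.
Qed.

Lemma nrm_geo_le z : nrm z < 1 -> nrm (geo z) <= (1 - nrm z)^-1.
Proof.
by move=> z1; have := nrm_rec_le z1 (geo_rec z1); rewrite nrm_delta mul1r.
Qed.

(** The increment X solves X = h Sh (geo (z + h)) + z Sh X and the remainder Y solves Y = h Sh X + z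
    Sh Y, so [nrm_rec_le] bounds one after the other. The restriction on h gives 1 - |z + h| >= (1 -
    |z|) / 2, whence the factor 2. *)
Lemma geo_taylor z h : nrm z < 1 -> nrm h < (1 - nrm z) / 2 ->
  nrm (geo (z + h) - geo z) <= nrm h * (2 / (1 - nrm z) ^+ 2) /\
  nrm (geo (z + h) - geo z - h *: dgeo z) <= nrm h ^+ 2 * (2 / (1 - nrm z) ^+ 3).
Proof.
move=> z1 hz; have d0 : 0 < 1 - nrm z by rewrite subr_gt0.
have nzh := nrmD z h.
have zh1 : nrm (z + h) < 1 by lra.
have dn : 1 - nrm z != 0 by rewrite gt_eqF.
pose X := geo (z + h) - geo z.
have XE : X = h *: Sh (geo (z + h)) + z *: Sh X.
  rewrite {1}/X {1}(geo_rec zh1) {1}(geo_rec z1) subDDl /X ShD ShN.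
  by rewrite scalerBr scalerDl addrAC addrC.
have hS : nrm (geo (z + h)) <= 2 / (1 - nrm z).
  rewrite (le_trans (nrm_geo_le zh1)) // -[leLHS]mul1r ler_pdivrMr ?subr_gt0 //.
  by rewrite mulrAC ler_pdivlMr //; lra.
have hX : nrm X <= nrm h * (2 / (1 - nrm z) ^+ 2).
  rewrite (le_trans (nrm_rec_le z1 XE)) // nrmZ nrm_Sh.
  rewrite (_ : nrm h * (2 / _) = nrm h * (2 / (1 - nrm z)) / (1 - nrm z)); last by field.
  by rewrite ler_pM2r ?invr_gt0 // ler_wpM2l ?nrm_ge0.
split=> //; rewrite -/X.
pose Y := X - h *: dgeo z.
have YE : Y = h *: Sh X + z *: Sh Y.
  have ShXE : Sh X = Sh (geo (z + h)) - Sh (geo z) by rewrite /X ShD ShN.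
  have ShYE : Sh Y = Sh X - h *: Sh (dgeo z) by rewrite /Y ShD ShN ShZ.
  by rewrite {1}/Y {1}XE {1}(dgeo_rec z1) lmod_rearrange ShYE -ShXE.
rewrite -/Y (le_trans (nrm_rec_le z1 YE)) // nrmZ nrm_Sh.
rewrite (_ : nrm h ^+ 2 * _ = nrm h * (nrm h * (2 / (1 - nrm z) ^+ 2)) / (1 - nrm z)); last by field.
by rewrite ler_pM2r ?invr_gt0 // ler_wpM2l ?nrm_ge0.
Qed.

Lemma is_diff_geo z : nrm z < 1 -> is_diff z geo (fun h => h *: dgeo z).
Proof.
move=> z1; have d0 : 0 < 1 - nrm z by rewrite subr_gt0.
have D : h^-1 *: ((geo \o shift z) (h *: 1) - geo z) @[h --> (0 : C)^'] --> dgeo z.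
  apply/cvg_nrmP/cvgr0Pnorm_lt => e e0.
  pose M := 2 / (1 - nrm z) ^+ 3.
  have M0 : 0 < M by rewrite divr_gt0 // exprn_gt0.
  have r0 : 0 < Num.min ((1 - nrm z) / 2) (e / M) by rewrite lt_min (divr_gt0 d0) // (divr_gt0 e0 M0).
  have nh : \forall h \near (0 : C), nrm h < Num.min ((1 - nrm z) / 2) (e / M).
    by apply/near_nrmP; exists (Num.min ((1 - nrm z) / 2) (e / M)) => // x; rewrite subr0.
  rewrite nearE /dnbhs /within /=; apply: filterS nh => h; rewrite lt_min => /andP[h1 h2] hn.
  rewrite [_%:A]mulr1 ger0_norm ?nrm_ge0 // [h + z]addrC.
  rewrite (_ : _ - dgeo z = h^-1 *: (geo (z + h) - geo z - h *: dgeo z)); last first.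
    by rewrite [in RHS]scalerBr scalerA mulVf // scale1r.
  have [_ h3] := geo_taylor z1 h1.
  rewrite nrmZ nrmV ltr_pdivrMl ?nrm_gt0 // (le_lt_trans h3) // expr2 -mulrA.
  by rewrite ltr_pM2l ?nrm_gt0 // -ltr_pdivlMr.
have dS : derivable geo z 1 by apply/cvg_ex; exists (dgeo z).
have diffS : differentiable geo z by exact/derivable1_diffP.
apply: DiffDef => //; apply/funext => h.
have D1 : 'd geo z 1 = dgeo z by rewrite -deriveE //; apply/cvg_lim.
by rewrite -D1 -linearZ [_%:A]mulr1.
Qed.

(** Finite sections of x lie in T, and their squared distance to x is the tail of a convergent
    series. *)
Lemma closed_span_deltas (T : set E) :
  (forall (u : nat -> E) (v : E), (forall n, T (u n)) -> u @ \oo --> v -> T v) ->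
  (forall z u v, T u -> T v -> T (z *: u + v)) -> T 0 ->
  (forall k, T (delta k)) -> T = setT.
Proof.
move=> clT linT T0 Td; apply/seteqP; split=> // x _.
pose u n : E := \sum_(k < n) x k *: delta k.
have uS n : u n.+1 = u n + x n *: delta n by rewrite /u big_ord_recr.
have uE n k : u n k = if (k < n)%N then x k else 0.
  elim: n => [|n IH]; first by rewrite /u big_ord0.
  rewrite uS coordD IH coordZ deltaE [in RHS]ltnS [in RHS]leq_eqVlt.
  case: (eqVneq k n) => [->|kn]; first by rewrite ltnn mulr1 add0r.
  by rewrite mulr0 addr0.
apply: (clT u).
  elim=> [|n IH]; first by rewrite /u big_ord0.
  by rewrite uS addrC; exact: linT.
have nE n : nrm (u n - x) ^+ 2 = limn (sum2 x) - sum2 x n.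
  rewrite sqr_cnrm; apply/cvg_lim => //.
  have c : (fun m => sum2 x m - sum2 x n) @ \oo --> limn (sum2 x) - sum2 x n.
    by apply: cvgB; [exact: cvg_cspace | exact: cvg_cst].
  apply: cvg_trans c; apply: near_eq_cvg; exists n => // m /= nm.
  have -> : sum2 x m = sum2 x n + \sum_(n <= k < m) abs2 (x k).
    by rewrite /sum2 /series /= (big_cat_nat (n := n)).
  rewrite addKC [in RHS]/sum2 /series /= [RHS](big_cat_nat (n := n)) //=.
  have -> : \sum_(0 <= k < n) abs2 ((u n - x : E) k) = 0; last first.
    rewrite add0r; apply: eq_big_nat => k /andP[nk _].
    transitivity (abs2 (u n k - x k)); last by [].
    by rewrite uE ltnNge nk /= add0r /abs2; case: (x k) => a b /=; ring.
  rewrite big_nat big1 // => k /andP[_ kn].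
  transitivity (abs2 (u n k - x k)); first by [].
  by rewrite uE kn subrr abs20.
apply/cvg_nrmP.
have l0 : (fun n => nrm (u n - x) ^+ 2) @ \oo --> (0 : R).
  have c : (fun n => limn (sum2 x) - sum2 x n) @ \oo --> limn (sum2 x) - limn (sum2 x).
    by apply: cvgB; [exact: cvg_cst | exact: cvg_cspace].
  by move: c; rewrite subrr; under eq_fun do rewrite -nE.
apply/cvgr0Pnorm_lt => e e0; have e20 : 0 < e ^+ 2 by rewrite exprn_gt0.
move/cvgr0Pnorm_lt: l0 => /(_ _ e20); apply: filterS => n.
rewrite !ger0_norm ?nrm_ge0 ?sqr_ge0 // => h.
by rewrite -(@ltr_pXn2r _ 2) ?nnegrE ?nrm_ge0 // ltW.
Qed.

(* The averages of the first n vectors delta_1, ..., delta_n tend to 0. *)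
Lemma closed_span_delta_differences (T : set E) :
  (forall (u : nat -> E) (v : E), (forall n, T (u n)) -> u @ \oo --> v -> T v) ->
  (forall z u v, T u -> T v -> T (z *: u + v)) -> T 0 ->
  (forall k, T (delta k.+2 - delta k.+1)) -> forall k, T (delta k.+1).
Proof.
move=> clT linT T0 Td.
have TD u v : T u -> T v -> T (u + v) by move=> Tu Tv; rewrite -[u]scale1r; exact: linT.
have TN u : T u -> T (- u) by move=> Tu; rewrite -[- u]addr0 -scaleN1r; exact: linT.
have Tk k : T (delta 1 - delta k.+1).
  elim: k => [|k IH]; first by rewrite subrr.
  rewrite (_ : _ - _ = (delta 1 - delta k.+1) - (delta k.+2 - delta k.+1)).
    by apply: TD => //; exact: TN.
  by rewrite opprB addrA subrK.
pose v n : E := \sum_(k < n) delta k.+1.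
have vS n : v n.+1 = v n + delta n.+1 by rewrite /v big_ord_recr.
have vE n k : (n <= k)%N -> v n k.+1 = 0.
  elim: n => [|n IH] nk; first by rewrite /v big_ord0.
  by rewrite vS coordD IH 1?ltnW // deltaE add0r eqSS gtn_eqF.
(* By orthonormality; dividing v n by n leaves a vector of norm 1 / sqrt n. *)
have nv n : nrm (v n) ^+ 2 = n%:R.
  elim: n => [|n IH]; first by rewrite /v big_ord0 nrm0 expr0n.
  rewrite vS sqr_nrmD IH nrm_delta ip_delta vE // mulr0 addr0.
  by rewrite expr1n -natr1.
have T1 : T (delta 1).
  apply: (clT (fun n => delta 1 - (n.+1%:R^-1 : C) *: v n.+1)).
    move=> n; have -> : delta 1 - (n.+1%:R^-1 : C) *: v n.+1 =
        (n.+1%:R^-1 : C) *: (\sum_(k < n.+1) (delta 1 - delta k.+1)).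
      rewrite sumrB scalerBr; congr (_ - _).
      by rewrite sumr_const card_ord -(scaler_nat n.+1 (delta 1)) scalerA mulVf ?scale1r // pnatr_eq0.
    rewrite -[X in T X]addr0; apply: linT => //.
    elim: n.+1 => [|m IH]; first by rewrite big_ord0.
    by rewrite big_ord_recr /=; exact: TD.
  apply/cvg_nrmP.
  rewrite (_ : (fun n => _) = fun n => (Num.sqrt n.+1%:R)^-1).
    have := @cvg_harmonic R => /cvgr0Pnorm_lt H.
    apply/cvgr0Pnorm_lt => e e0; have e20 : 0 < e ^+ 2 by rewrite exprn_gt0.
    apply: filterS (H _ e20) => n; rewrite /= !ger0_norm ?invr_ge0 ?sqrtr_ge0 //.
    rewrite -sqrtrV // => h.
    by rewrite -[ltRHS]ger0_norm ?ltW // -sqrtr_sqr ltr_sqrt.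
  apply/funext => n; rewrite addrAC subrr add0r nrmN nrmZ.
  have -> : nrm (v n.+1) = Num.sqrt n.+1%:R.
    by rewrite -nv sqrtr_sqr ger0_norm ?nrm_ge0.
  have -> : (n.+1%:R^-1 : C) = (n.+1%:R^-1 : R)%:C%C by rewrite fmorphV rmorph_nat.
  rewrite nrm_real ger0_norm ?invr_ge0 // -{1}(@sqr_sqrtr _ n.+1%:R) // expr2 invfM -mulrA mulVf ?mulr1 //.
move=> k; have -> : delta k.+1 = delta 1 - (delta 1 - delta k.+1) by rewrite opprB addrC subrK.
by apply: TD => //; exact: TN.
Qed.

End SquareSummable.

Section HolomorphicMaps.
Variable R : realType.
Local Notation C := (Cplx R).

Lemma bounded_linear_continuous_nrm (V W : normedModType C) (f : {linear V -> W}) (M : R) :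
  0 < M -> (forall x, nrm (f x) <= M * nrm x) -> continuous f.
Proof.
move=> M0 fM x; apply/cvg_nrmP/cvgr0Pnorm_lt => e e0; apply/near_nrmP.
exists (e / M) => [|y]; first by rewrite divr_gt0.
rewrite ger0_norm ?nrm_ge0 // -linearB => h.
by rewrite (le_lt_trans (fM _)) // mulrC -ltr_pdivlMr.
Qed.

Lemma is_diff_fst (V W : normedModType C) (p : V * W) : is_diff p (@fst V W) (@fst V W).
Proof.
have c : continuous (@fst V W) by move=> x; exact: cvg_fst.
by apply: DiffDef; [exact: (@linear_differentiable _ _ _ fst) | exact: (@diff_lin _ _ _ fst)].
Qed.

Lemma is_diff_snd (V W : normedModType C) (p : V * W) : is_diff p (@snd V W) (@snd V W).
Proof.
have c : continuous (@snd V W) by move=> x; exact: cvg_snd.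
by apply: DiffDef; [exact: (@linear_differentiable _ _ _ snd) | exact: (@diff_lin _ _ _ snd)].
Qed.

Lemma is_diff_moebius (w0 w1 w : C) : w != w1 ->
  is_diff w (fun w => (w - w0) / (w - w1)) (fun h => h * ((w0 - w1) / (w - w1) ^+ 2)).
Proof.
move=> ww; have d : w - w1 != 0 by rewrite subr_eq0.
have dA : is_diff w (fun w : C => w - w1) id.
  apply: (is_diff_eq (is_diffD (is_diff_id w) (is_diff_cst (- w1) w))).
  by apply/funext => h; exact: addr0.
have dB : is_diff w (fun w : C => w - w0) id.
  apply: (is_diff_eq (is_diffD (is_diff_id w) (is_diff_cst (- w0) w))).
  by apply/funext => h; exact: addr0.
have dV : is_diff (w - w1) (fun x : C => x^-1) (fun h => - (w - w1) ^- 2 * h).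
  by apply: DiffDef; [exact: differentiable_Rinv | exact: diff_Rinv].
apply: (is_diff_eq (is_diffM dB (is_diff_comp dA dV))).
apply/funext => h; rewrite -[LHS]/((w - w0) * (- (w - w1) ^- 2 * h) + (w - w1)^-1 * h).
by field.
Qed.

End HolomorphicMaps.

(** * The isometric curve in l^2(C) over the half-plane *)

Section ImmersedCurve.
Variable R : realType.
Local Notation C := (Cplx R).
Local Notation E := (cspace R None).
Implicit Types (x y : E) (z : C).

Lemma hip_delta x k : hip x (delta R k) = x k.
Proof.
rewrite /hip ip_delta -(opprK (ip x _)) -ip_il ip_delta coordZ.
by case: (x k) => a b /=; congr Complex; ring.
Qed.

Lemma ip_Sh x y : ip (Sh x) (Sh y) = ip x y.
Proof.
have := sqr_nrmD (Sh x) (Sh y); rewrite -ShD !nrm_Sh sqr_nrmD.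
by lra.
Qed.

Lemma hip_Sh x y : hip (Sh x) (Sh y) = hip x y.
Proof. by rewrite /hip -ShZ !ip_Sh. Qed.

Lemma hip_delta0_Sh x : hip (delta R 0) (Sh x) = 0.
Proof. by rewrite hipC hip_delta ShE /= rmorph0. Qed.

(** The sequence (0, x_0 - x_1, x_1 - x_2, ...): the last term cancels -x_0 and frees coordinate 0
    for the variable z. *)
Definition diffop x : E := Sh x - x + x 0%N *: delta R 0.

Lemma diffop0 x : diffop x 0%N = 0.
Proof.
rewrite /diffop coordD coordD coordN coordZ ShE deltaE /= mulr1 add0r.
by rewrite addNr.
Qed.

Lemma diffopS x k : diffop x k.+1 = x k - x k.+1.
Proof. by rewrite /diffop coordD coordD coordN coordZ ShE deltaE /= mulr0 addr0. Qed.

Lemma diffopP z x y : diffop (z *: x + y) = z *: diffop x + diffop y.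
Proof.
apply: cspace_ext => -[|k].
  by rewrite [RHS]coordD [X in _ = X + _]coordZ !diffop0 mulr0 addr0.
rewrite [RHS]coordD [X in _ = X + _]coordZ !diffopS !coordD !coordZ mulrBr.
by rewrite opprD addrACA.
Qed.

Lemma diffop_is_linear : linear diffop.
Proof. exact: diffopP. Qed.

HB.instance Definition _ := GRing.isLinear.Build C E E *:%R diffop diffop_is_linear.

Lemma nrm_diffop_le x : nrm (diffop x) <= 3 * nrm x.
Proof.
rewrite /diffop (le_trans (nrmD _ _)) // nrmZ nrm_delta mulr1.
have := nrmB (Sh x) x; rewrite nrm_Sh; have := coord_le x 0; lra.
Qed.

Lemma diffop_continuous : continuous diffop.
Proof.
by apply: (bounded_linear_continuous_nrm (M := 3)) => //; exact: nrm_diffop_le.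
Qed.

Lemma diffop_delta j : diffop (delta R j.+1) = delta R j.+2 - delta R j.+1.
Proof. by rewrite /diffop Sh_delta deltaE scale0r addr0. Qed.

(** Here w stands for conj z, and G, K, Kc, N for <S, S>, <D, S>, its conjugate and <D, D>, with S =
    [geo z] and D = [dgeo z]. Each hypothesis is linear in its unknown with coefficient 1 - z w, and
    the left side is |Sh D - D|^2. Treating conj z as an independent variable makes this an identity
    of rational functions. *)
Lemma diffop_norm_identity (F : fieldType) (z w G K Kc N : F) :
  1 - z * w != 0 -> G = 1 + z * w * G -> K = w * (G + z * K) ->
  Kc = z * (G + w * Kc) -> N = G + z * K + w * Kc + z * w * N ->
  N - (K + w * N) + (- (Kc + z * N) + N) =
  2 * ((1 - z) * (1 - w)) / (1 - z * w) ^+ 3.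
Proof.
move=> rC hG hK hKc hN.
have GE : G = (1 - z * w)^-1.
  by apply: (mulfI rC); rewrite mulfV // mulrBl mul1r {1}hG addrK.
have KE : K = w / (1 - z * w) ^+ 2.
  apply: (mulfI rC); rewrite mulrBl mul1r {1}hK GE; field; exact: rC.
have KcE : Kc = z / (1 - z * w) ^+ 2.
  apply: (mulfI rC); rewrite mulrBl mul1r {1}hKc GE; field; exact: rC.
have NE : N = (1 + z * w) / (1 - z * w) ^+ 3.
  apply: (mulfI rC); rewrite mulrBl mul1r {1}hN KE KcE GE; field; exact: rC.
by rewrite NE KE KcE; field; exact: rC.
Qed.

Lemma sqr_nrm_diffop_dgeo z : nrm z < 1 ->
  nrm (diffop (dgeo z)) ^+ 2 = 2 * abs2 (1 - z) / (1 - abs2 z) ^+ 3.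
Proof.
move=> z1; have r1 : abs2 z < 1 by rewrite -sqr_nrm expr_lt1 ?nrm_ge0.
have r0 : 1 - abs2 z != 0 by rewrite subr_eq0 gt_eqF.
apply: complexI; rewrite -hipxx.
have Y : diffop (dgeo z) = Sh (dgeo z) - dgeo z.
  by rewrite /diffop dgeoE // mul0r scale0r addr0.
have Srec := geo_rec z1.
(* Pairing this recurrence and that of [geo] with each other gives the linear relations, since [Sh]
   preserves products and its image is orthogonal to [delta R 0]. *)
have Drec : dgeo z = Sh (geo z + z *: dgeo z) by rewrite ShD ShZ -dgeo_rec.
move: Srec Drec Y; move: (geo z) (dgeo z) => S D Srec Drec Y.
have zz : z * z^* = (abs2 z)%:C%C by rewrite -normCK nrmE -rmorphXn /= sqr_nrm.
have rC : 1 - z * z^* != 0.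
  by rewrite zz -(rmorph1 (real_complex R)) -rmorphB -(rmorph0 (real_complex R))
    (inj_eq (@complexI R)).
have hG : hip S S = 1 + z * z^* * hip S S.
  rewrite {1 2}Srec hipDl !hipDr !hipZl !hipZr hip_Sh hip_delta0_Sh !hip_delta ShE.
  by rewrite deltaE /= !mulr0 addr0 add0r mulrA.
have hK : hip D S = z^* * (hip S S + z * hip D S).
  rewrite {1}Srec hipDr {1}Drec hip_delta ShE /= add0r hipZr {1}Drec hip_Sh.
  by rewrite hipDl hipZl.
have hN : hip D D = hip S S + z * hip D S + z^* * (hip D S)^* + z * z^* * hip D D.
  rewrite {1 2}Drec hip_Sh hipDl !hipDr !hipZl !hipZr (hipC D S).
  by rewrite !addrA mulrA; congr (_ + _); rewrite addrAC.
have hM : hip (Sh D) D = hip D S + z^* * hip D D.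
  by rewrite {2}Drec hip_Sh hipDr hipZr.
have Nc : (hip D D)^* = hip D D by rewrite -hipC.
have -> : (2 * abs2 (1 - z) / (1 - abs2 z) ^+ 3)%:C%C =
    2 * ((1 - z) * (1 - z^*)) / (1 - z * z^*) ^+ 3 :> C.
  have -> : (1 - z) * (1 - z^*) = (abs2 (1 - z))%:C%C.
    by rewrite -sqr_nrm rmorphXn /= -nrmE normCK rmorphB rmorph1.
  by rewrite zz rmorphM fmorphV rmorphM rmorphXn rmorphB rmorph1 rmorph_nat.
have hKc : (hip D S)^* = z * ((hip S S)^* + z^* * (hip D S)^*).
  by rewrite {1}hK rmorphM rmorphD rmorphM /= conjCK.
have Gc : (hip S S)^* = hip S S by rewrite -hipC.
rewrite Y hipDl !hipDr !hipNl !hipNr opprK hip_Sh (hipC (Sh D) D) hM.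
rewrite rmorphD rmorphM /= conjCK Nc.
rewrite Gc in hKc.
move: rC hG hK hKc hN.
move: (hip D S)^* => Kc; move: (z^*) (hip D S) (hip S S) (hip D D) => w K G N.
exact: diffop_norm_identity.
Qed.

(** The Cayley transform: the upper half-plane is mapped to the unit disc and w0 to 0. *)
Definition moebius (w0 w : C) : C := (w - w0) / (w - w0^*).

Lemma conj_neq (w0 w : C) : 0 < complex.Im w0 -> 0 < complex.Im w -> w != w0^*.
Proof.
move=> h0 h; apply/eqP => wE; move: h; rewrite wE conjCE.
by case: w0 h0 {wE} => a b /= h0; rewrite oppr_gt0 ltNge ltW.
Qed.

Lemma sub_abs2_moebius (w0 w : C) : 0 < complex.Im w0 -> 0 < complex.Im w ->
  1 - abs2 (moebius w0 w) = 4 * complex.Im w * complex.Im w0 / abs2 (w - w0^*).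
Proof.
move=> h0 h; have d : w - w0^* != 0 by rewrite subr_eq0 conj_neq.
have d0 : abs2 (w - w0^*) != 0 by apply: contraNneq d => /abs2_eq0 ->.
rewrite /moebius abs2M -[abs2 _^-1]sqr_nrm nrmV exprVn sqr_nrm.
apply: (mulIf d0); rewrite mulrBl mulfVK // mul1r divfK //.
move: {d d0} (w) (w0) => [a b] [a0 b0] {h h0}; rewrite conjCE /abs2 /=; ring.
Qed.

Lemma nrm_moebius (w0 w : C) : 0 < complex.Im w0 -> 0 < complex.Im w -> nrm (moebius w0 w) < 1.
Proof.
move=> h0 h; have d : w - w0^* != 0 by rewrite subr_eq0 conj_neq.
have := sub_abs2_moebius h0 h.
have p : 0 < 4 * complex.Im w * complex.Im w0 / abs2 (w - w0^*).
  rewrite divr_gt0 // ?mulr_gt0 // lt_def abs2_ge0 andbT.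
  by apply: contraNneq d => /abs2_eq0 ->.
move=> E0; rewrite -E0 subr_gt0 -sqr_nrm in p.
by rewrite -(@expr_lt1 _ 2) ?nrm_ge0.
Qed.

Definition tricerri_immersion (k a : R) (w0 : C) (p : C * C) : E :=
  (k%:C%C : C) *: (p.1 *: delta R 0 + (a%:C%C : C) *: diffop (geo (moebius w0 p.2))).

Definition dmoebius (w0 w : C) : C := (w0 - w0^*) / (w - w0^*) ^+ 2.

Lemma is_diff_tricerri_immersion k a (w0 : C) p : 0 < complex.Im w0 -> upper p ->
  is_diff p (tricerri_immersion k a w0) (fun u => (k%:C%C : C) *: (u.1 *: delta R 0 +
    (a%:C%C : C) *: diffop ((u.2 * dmoebius w0 p.2) *: dgeo (moebius w0 p.2)))).
Proof.
move=> h0 h.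
have d1 : is_diff p (fun p : C * C => p.1 *: delta R 0) (fun u => u.1 *: delta R 0).
  exact: (is_diff_comp (is_diff_fst p) (is_diff_scalel p.1 (delta R 0))).
have dm : is_diff (p.2) (moebius w0) (fun h => h * dmoebius w0 p.2).
  apply: is_diff_moebius; exact: conj_neq.
have dg := is_diff_comp (is_diff_comp (is_diff_snd p) dm) (is_diff_geo (nrm_moebius h0 h)).
have dl x : is_diff x (diffop : E -> E) diffop.
  by apply: DiffDef; [apply: linear_differentiable | apply: diff_lin]; exact: diffop_continuous.
have dL := is_diff_comp dg (dl _).
exact: (is_diffZ k%:C%C (is_diffD d1 (is_diffZ a%:C%C dL))).
Qed.

(** Coordinate 1 is k a (1 - zeta), and zeta = 1 would mean w0 = conj w0. *)
Lemma tricerri_immersion_neq0 k a (w0 : C) p : 0 < complex.Im w0 -> upper p -> k != 0 -> a != 0 ->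
  tricerri_immersion k a w0 p != 0.
Proof.
move=> h0 h k0 a0; apply/eqP => H.
have d : p.2 - w0^* != 0 by rewrite subr_eq0 conj_neq.
have := congr1 (fun x : E => x 1%N) H.
rewrite /tricerri_immersion coordZ coordD !coordZ deltaE mulr0 add0r diffopS.
rewrite !geoE ?nrm_moebius // expr0 expr1 => /eqP.
rewrite -[X in _ == X]/(0 : C) !mulf_eq0.
rewrite -!(rmorph0 (real_complex R)) !(inj_eq (@complexI R)) (negbTE k0) (negbTE a0) /=.
rewrite rmorph0 /moebius subr_eq0 eq_sym -subr_eq0.
rewrite -(inj_eq (mulIf d)) mulrBl divfK // mul1r mul0r.
rewrite subDDl opprK addrC subr_eq0 => /eqP E0.
by have := conj_neq h0 h0; rewrite E0 eqxx.
Qed.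

Lemma dz_dzbarE (x y : C) : dz_dzbar x y = (2 * complex.Im (x * y^*))%:C%C * 'i.
Proof.
by rewrite /dz_dzbar !conjCE; case: x => a b; case: y => u v; apply/eqP;
  rewrite eq_complex /=; apply/andP; split; apply/eqP; ring.
Qed.

(** All powers of |w - conj w0| cancel and a^2 y0 / (2 y^3) remains, with y0 = Im w0; this dictates
    a^2 = 1 / (2 y0). *)
Lemma sqr_nrm_dcurve (w0 w : C) : 0 < complex.Im w0 -> 0 < complex.Im w ->
  (Num.sqrt (2 * complex.Im w0))^-1 ^+ 2 * abs2 (dmoebius w0 w) *
    nrm (diffop (dgeo (moebius w0 w))) ^+ 2 = (4 * complex.Im w ^+ 3)^-1.
Proof.
move=> h0 h; have d : w - w0^* != 0 by rewrite subr_eq0 conj_neq.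
have d0 : abs2 (w - w0^*) != 0 by apply: contraNneq d => /abs2_eq0 ->.
have abs2V (x : C) : abs2 x^-1 = (abs2 x)^-1.
  by rewrite -[LHS]sqr_nrm nrmV exprVn sqr_nrm.
rewrite sqr_nrm_diffop_dgeo ?nrm_moebius // sub_abs2_moebius //.
have -> : 1 - moebius w0 w = (w0 - w0^*) / (w - w0^*).
  rewrite /moebius; apply: (mulIf d); rewrite mulrBl !divfK // mul1r.
  by rewrite subDDl opprK addrC.
rewrite /dmoebius !abs2M !abs2V [(w - w0^*) ^+ 2]expr2 abs2M.
have -> : abs2 (w0 - w0^*) = 4 * complex.Im w0 ^+ 2.
  by rewrite conjCE; move: (w0) => [x y]; rewrite /abs2 /=; ring.
rewrite exprVn sqr_sqrtr; last by rewrite mulr_ge0 // ltW.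
move: (abs2 _) (complex.Im w) (complex.Im w0) h h0 d0 => D y y0 h h0 d0.
by field; rewrite d0 !gt_eqF.
Qed.

Lemma tricerri_immersion_pullback (c : R) (w0 : C) p u v : 0 < c -> 0 < complex.Im w0 -> upper p ->
  pullback (tricerri_immersion (Num.sqrt c)^-1 (Num.sqrt (2 * complex.Im w0))^-1 w0)
    (fun=> @flat_form R c None) p u v = tricerri_kahler_form p u v.
Proof.
move=> c0 h0 h; have hy : 0 < complex.Im p.2 := h.
rewrite /pullback; set k := (Num.sqrt c)^-1; set a := (Num.sqrt (2 * _))^-1.
have dS := is_diff_tricerri_immersion k a h0 h.
rewrite (@diff_val _ _ _ _ _ _ _ dS).
pose Y : E := diffop (dgeo (moebius w0 p.2)).
have YE (s : C) : diffop (s *: dgeo (moebius w0 p.2)) = s *: Y by rewrite linearZ.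
rewrite !YE.
(* Coordinate 0 is empty in the image of [diffop], so the z and w directions are orthogonal and the
   form splits into its two terms. *)
have hY : hip (delta R 0) Y = 0.
  by rewrite hipC hip_delta /Y diffop0 rmorph0.
have hY' : hip Y (delta R 0) = 0 by rewrite hip_delta /Y diffop0.
have hd : hip (delta R 0) (delta R 0) = 1 by rewrite hip_delta deltaE.
rewrite flat_formE.
have ipE x y : ip x (('i%C : C) *: y) = complex.Im (hip x y) by [].
rewrite ipE !hipZl !hipZr !hipDl !hipDr !hipZl !hipZr hY hY' hd hipxx.
rewrite !mulr0 addr0 add0r mulr1 !conjCE.
have keyk : c * k ^+ 2 = 1 by rewrite /k exprVn sqr_sqrtr ?ltW // mulfV // gt_eqF.
have keyN : a ^+ 2 * abs2 (dmoebius w0 p.2) * nrm Y ^+ 2 = (4 * complex.Im p.2 ^+ 3)^-1.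
  exact: sqr_nrm_dcurve.
rewrite {dS YE hY hY'}.
move: keyN; rewrite -/Y; move: (nrm Y) (dmoebius w0 p.2) => N b keyN.
transitivity ((- 2 * (c * k ^+ 2) * (complex.Im (u.1 * conjc v.1) +
    a ^+ 2 * abs2 b * N ^+ 2 * complex.Im (u.2 * conjc v.2)))%:C%C : C).
  congr (_ %:C)%C; clearbody k a; rewrite /abs2.
  move: u v b {keyN} => [[u1 u1'] [u2 u2']] [[v1 v1'] [v2 v2']] [b b'] /=.
  by ring.
rewrite keyk keyN /tricerri_kahler_form /tricerri_form !dz_dzbarE !conjCE.
move: (complex.Im (u.1 * _)) (complex.Im (u.2 * _)) hy => s t {h}.
move: (complex.Im p.2) => y y0; rewrite -[('i / _)]/('i * _^-1) -fmorphV.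
by apply/eqP; rewrite eq_complex /=; apply/andP; split; apply/eqP; field; rewrite gt_eqF.
Qed.

End ImmersedCurve.

Lemma is_diff_near_eq (R : realType) (V W : normedModType (Cplx R)) (f g df : V -> W) (x : V) :
  (\forall y \near x, f y = g y) -> is_diff x f df -> is_diff x g df.
Proof.
move=> fg [dfx <-].
have gE : g \o shift x = cst (g x) + 'd f x +o_ 0 id.
  have /eqaddoP H := diff_locally dfx.
  apply/eqaddoP => e e0; have Hn := H e e0.
  have fg0 : \forall h \near (0 : V), f (h + x) = g (h + x).
    by move: fg; rewrite (near_shift 0 x) subr0.
  apply: filterS2 Hn fg0 => h Hh fgh.
  have fgx : f x = g x by exact: nbhs_singleton fg.
  have -> : (g \o shift x - (cst (g x) + 'd f x)) h = (f \o shift x - (cst (f x) + 'd f x)) h.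
    rewrite -[LHS]/(g (h + x) - (g x + 'd f x h)) -[RHS]/(f (h + x) - (f x + 'd f x h)).
    by rewrite fgh fgx.
  exact: Hh.
have cf : continuous ('d f x) by exact: (diff_continuous dfx).
have dE : 'd g x = 'd f x :> (V -> W) by exact: (diff_unique cf gE).
apply: DiffDef; last exact: dE.
apply/diff_locallyP; split; first by rewrite dE; exact: cf.
by rewrite dE; exact: gE.
Qed.

(** * The closed span of the image *)

Section CurveSpan.
Variable R : realType.
Local Notation C := (Cplx R).
Local Notation E := (cspace R None).

Lemma nrm_iter_Sh j (x : E) : nrm (iter j (@Sh R) x) = nrm x.
Proof. by elim: j => //= j IH; rewrite nrm_Sh. Qed.

Lemma iter_Sh_geo j (z : C) : nrm z < 1 ->
  iter j (@Sh R) (geo z) = delta R j + z *: iter j.+1 (@Sh R) (geo z).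
Proof.
move=> z1; elim: j => [|j IH]; first exact: geo_rec.
by rewrite iterS IH ShD ShZ Sh_delta.
Qed.

(** The inverse transform; the formula for w - w0 shows that small zeta come from points near w0. *)
Lemma moebius_surj (w0 z : C) : 0 < complex.Im w0 -> nrm z < 1 ->
  let w := (w0 - w0^* * z) / (1 - z) in
  moebius w0 w = z /\ w - w0 = z * (w0 - w0^*) / (1 - z).
Proof.
move=> h0 z1 w.
have d : 1 - z != 0.
  by rewrite subr_eq0; apply: contraTneq z1 => <-; rewrite nrm1 ltxx.
have h : w0 - w0^* != 0 by rewrite subr_eq0 conj_neq.
have e1 : w - w0 = z * (w0 - w0^*) / (1 - z).
  by rewrite /w; move: (w0^*) h d => v h d; field.
have e2 : w - w0^* = (w0 - w0^*) / (1 - z).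
  by rewrite /w; move: (w0^*) h d => v h d; field.
split=> //; rewrite /moebius e1 e2; move: (w0^*) h d => v h d; field.
by rewrite d h.
Qed.

(* T contains the first coordinate axis and, by successive limits at zeta = 0,
   the successive differences of the other basis vectors. *)
Lemma tricerri_immersion_span (k a : R) (w0 z0 : C) (r : R) (T : set E) :
  k != 0 -> a != 0 -> 0 < complex.Im w0 -> 0 < r ->
  (forall (u : nat -> E) (v : E), (forall n, T (u n)) -> u @ \oo --> v -> T v) ->
  (forall z u v, T u -> T v -> T (z *: u + v)) ->
  (forall p : C * C, nrm (p.1 - z0) < r -> nrm (p.2 - w0) < r ->
     T (tricerri_immersion k a w0 p - tricerri_immersion k a w0 (z0, w0))) ->
  T = setT.
Proof.
move=> k0 a0 h0 r0 clT linT TS.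
have T0 : T 0.
  have := TS (z0, w0); rewrite !subrr; apply; by rewrite nrm0.
have TZ (z : C) u : T u -> T (z *: u).
  by move=> Tu; rewrite -[_ *: _]addr0; exact: linT.
have TZV (z : C) u : z != 0 -> T (z *: u) -> T u.
  by move=> z0' Tu; rewrite -[u]scale1r -(mulVf z0') -scalerA; exact: TZ.
have TB u v : T u -> T v -> T (u - v).
  by move=> Tu Tv; rewrite addrC -scaleN1r; exact: linT.
have kC : (k%:C%C : C) != 0 by rewrite -(rmorph0 (real_complex R)) (inj_eq (@complexI R)).
have aC : (a%:C%C : C) != 0 by rewrite -(rmorph0 (real_complex R)) (inj_eq (@complexI R)).
have SB (z w : C) : tricerri_immersion k a w0 (z, w) - tricerri_immersion k a w0 (z0, w0) =
   (k%:C%C : C) *: ((z - z0) *: delta R 0 +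
     (a%:C%C : C) *: diffop (geo (moebius w0 w) - geo 0)).
  rewrite /tricerri_immersion -scalerBr; congr (_ *: _).
  have -> : moebius w0 w0 = 0 by rewrite /moebius subrr mul0r.
  by rewrite [in RHS]linearB [in RHS]scalerBr [in RHS]scalerBl opprD addrACA.
(* Only z moves: at w = w0 the second component of the difference vanishes. *)
have Td0 : T (delta R 0).
  have r2 : (r / 2)%:C%C != 0 :> C.
    by rewrite -(rmorph0 (real_complex R)) (inj_eq (@complexI R)) gt_eqF // divr_gt0.
  have := TS (z0 + (r / 2)%:C%C, w0); rewrite SB /moebius subrr mul0r subrr linear0.
  rewrite scaler0 addr0 addKC nrm0 nrm_real ger0_norm ?divr_ge0 ?ltW //.
  rewrite ltr_pdivrMr // ltr_pMr // ltr1n => /(_ isT r0) /(TZV _ _ kC).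
  exact: TZV.
(* For |zeta| < s one has |1 - zeta| >= 1/2, hence |w - w0| <= 2 |zeta| |w0 - conj w0| < r. *)
pose s := Num.min (1 / 2) (r / (2 * (nrm (w0 - w0^*) + 1))).
have n1 : 0 < nrm (w0 - w0^*) + 1 by rewrite ltr_wpDl ?nrm_ge0.
have s0 : 0 < s by rewrite lt_min !divr_gt0 ?mulr_gt0.
have s12 : s <= 1 / 2 by rewrite ge_min lexx.
have sr : s <= r / (2 * (nrm (w0 - w0^*) + 1)) by rewrite ge_min lexx orbT.
have zlt1 z : nrm z < s -> nrm (z : C) < 1 by lra.
have Tgeo (z : C) : nrm z < s -> T (diffop (geo z - geo 0)).
  move=> zs; have [mE wE] := moebius_surj h0 (zlt1 z zs).
  move: mE wE; set w := _ / _ => mE wE.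
  have := TS (z0, w); rewrite SB mE subrr scale0r add0r nrm0 r0 wE => /(_ isT).
  have z2 : 1 / 2 <= nrm (1 - z).
    by have := nrm_le_dist (1 : C) z; rewrite nrm1; lra.
  have -> : nrm (z * (w0 - w0^*) / (1 - z)) < r.
    rewrite !nrmM nrmV ltr_pdivrMr; last by lra.
    move: sr; rewrite ler_pdivlMr ?mulr_gt0 // => sr.
    have := nrm_ge0 (w0 - w0^*); have := nrm_ge0 z.
    move: (nrm (w0 - _)) (nrm z) (nrm (1 - z)) zs z2 sr s0 r0 {n1 SB Td0 wE TS T0} => n t d.
    move=> ts d2 sr s0 r0 t0 n0.
    have h1 : t * n <= s * n by rewrite ler_wpM2r // ltW.
    have h2 : r * (1 / 2) <= r * d by rewrite ler_wpM2l // ltW.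
    nra.
  by move=> /(_ isT) /(TZV _ _ kC) /(TZV _ _ aC).
have geo0 : geo 0 = delta R 0.
  by rewrite (geo_rec (z := 0)) ?nrm0 // scale0r addr0.
(* Induction by zeta Sh^(j+1) geo(zeta) = Sh^j geo(zeta) - delta_j, divided by zeta. The vector
   [diffop (delta R j.+1)] to be subtracted is the limit of elements of T as zeta tends to 0. *)
have TSh j (z : C) : z != 0 -> nrm z < s -> T (diffop (iter j.+1 (@Sh R) (geo z))).
  elim: j z => [|j IH] z zn zs.
    apply: (TZV z) => //; rewrite -linearZ.
    have -> : z *: iter 1 (@Sh R) (geo z) = geo z - geo 0.
      by rewrite geo0 [in RHS](geo_rec (zlt1 z zs)) addKC.
    exact: Tgeo.
  apply: (TZV z) => //; rewrite -linearZ.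
  have -> : z *: iter j.+2 (@Sh R) (geo z) = iter j.+1 (@Sh R) (geo z) - delta R j.+1.
    by rewrite [in RHS]iter_Sh_geo ?zlt1 // addKC.
  rewrite linearB; apply: TB; first exact: IH.
  (* Nonzero points tending to 0, where the induction hypothesis applies. *)
  pose zn' n : C := (s / n.+2%:R)%:C%C.
  have zn0 n : 0 < s / n.+2%:R by rewrite divr_gt0.
  have znE n : nrm (zn' n) = s / n.+2%:R by rewrite nrm_real ger0_norm // ltW.
  have zns n : nrm (zn' n) < s by rewrite znE ltr_pdivrMr // ltr_pMr // ltr1n.
  apply: (clT (fun n => diffop (iter j.+1 (@Sh R) (geo (zn' n))))).
    move=> n; apply: IH; last exact: zns.
    by rewrite -(rmorph0 (real_complex R)) (inj_eq (@complexI R)) gt_eqF.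
  (* The 6 is 3 from [nrm_diffop_le] times the bound 2 for [geo] on |zeta| < 1/2. *)
  apply: (@squeeze_nrm _ _ _ _ (fun n => 6 * (s * n.+1%:R^-1))).
    move=> n; rewrite -linearB iter_Sh_geo ?zlt1 // addKC.
    rewrite (le_trans (nrm_diffop_le _)) // nrmZ nrm_iter_Sh znE.
    have g2 : nrm (geo (zn' n)) <= 2.
      rewrite (le_trans (nrm_geo_le (zlt1 _ (zns n)))) //.
      rewrite -[leRHS]invrK lef_pV2 ?posrE ?invr_gt0 //; last by have := zns n; lra.
      by have := zns n; lra.
    have h1 : s / n.+2%:R <= s / n.+1%:R.
      by rewrite ler_pM2l // lef_pV2 ?posrE // ler_nat.
    have h2 : s / n.+2%:R * nrm (geo (zn' n)) <= s / n.+1%:R * 2.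
      by rewrite ler_pM ?nrm_ge0 // ltW.
    by move: h2; move: (s / n.+1%:R) (s / n.+2%:R * nrm _) => u1 u2 h2; lra.
  have hs : (fun n => 6 * (s * n.+1%:R^-1)) @ \oo --> 6 * (s * 0).
    by apply: cvgMr; apply: cvgMr; exact: cvg_harmonic.
  by rewrite !mulr0 in hs.
have Td k' : T (delta R k'.+2 - delta R k'.+1).
  rewrite -diffop_delta.
  have s2 : nrm ((s / 2)%:C%C : C) < s.
    rewrite nrm_real ger0_norm ?divr_ge0 ?ltW //.
    by rewrite ltr_pdivrMr // ltr_pMr // ltr1n.
  have sn : ((s / 2)%:C%C : C) != 0.
    by rewrite -(rmorph0 (real_complex R)) (inj_eq (@complexI R)) gt_eqF // divr_gt0.
  have -> : delta R k'.+1 = iter k'.+1 (@Sh R) (geo (s / 2)%:C%C) -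
      ((s / 2)%:C%C : C) *: iter k'.+2 (@Sh R) (geo (s / 2)%:C%C).
    by rewrite [in RHS]iter_Sh_geo ?zlt1 // addrK.
  rewrite linearB linearZ; apply: TB; first exact: TSh.
  by apply: TZ; exact: TSh.
have TdS := closed_span_delta_differences clT linT T0 Td.
by apply: closed_span_deltas clT linT T0 _ => -[|j].
Qed.

End CurveSpan.

(** * Descent to the covering *)

Section GeneratedTransformations.
Variables (T : Type) (S : set (T -> T)).

Lemma generated_comp g h : generated S g -> generated S h -> generated S (g \o h).
Proof.
move=> gg gh; elim: gg => [|s g' Ss _ IH|s s' g' Ss c1 c2 _ IH].
- exact: gh.
- exact: (gen_mul Ss IH).
- exact: (gen_inv Ss c1 c2 IH).
Qed.

Hypothesis S_inv : forall s, S s -> exists s', cancel s s' /\ cancel s' s.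

Lemma generated_inv g : generated S g ->
  exists g', [/\ generated S g', cancel g g' & cancel g' g].
Proof.
elim=> [|s h Ss _ [h' [gh' c1 c2]]|s s' h Ss e1 e2 _ [h' [gh' c1 c2]]].
- by exists idfun; split=> //; exact: gen_id.
- have [s' [e1 e2]] := S_inv Ss.
  exists (h' \o s'); split; last 2 first.
  + by move=> x /=; rewrite e1 c1.
  + by move=> x /=; rewrite c2 e2.
  by apply: generated_comp gh' _; exact: (gen_inv Ss e1 e2 (gen_id S)).
- exists (h' \o s); split; last 2 first.
  + by move=> x /=; rewrite e2 c1.
  + by move=> x /=; rewrite c2 e1.
  by apply: generated_comp gh' _; exact: (gen_mul Ss (gen_id S)).
Qed.

Lemma orbit_generated g p : generated S g -> Defs.orbit S (g p) = Defs.orbit S p.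
Proof.
move=> gg; have [g' [gg' c1 c2]] := generated_inv gg.
apply/seteqP; split=> _ [h gh <-].
  by exists (h \o g) => //; exact: generated_comp.
by exists (h \o g'); [exact: generated_comp | rewrite /= c1].
Qed.

Lemma orbit_eqP p q : Defs.orbit S p = Defs.orbit S q -> exists2 g, generated S g & p = g q.
Proof.
move=> pq; have : Defs.orbit S p p by exists idfun => //; exact: gen_id.
by rewrite pq => -[g gg <-]; exists g.
Qed.

End GeneratedTransformations.

(** * Discreteness of the lattice of translations *)

Section Lattice.
Variable R : realType.
Local Notation C := (Cplx R).

Lemma translations_inv (m : 'cV[C]_3) (ell : 'cV[R]_3) s : translations m ell s ->
  exists s', cancel s s' /\ cancel s' s.
Proof.
move=> [j _ <-]; exists (fun p => (p.1 - m j 0, p.2 - (ell j 0)%:C%C)).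
by split=> -[z w]; rewrite /Defs.ftrans /= ?addrK ?subrK.
Qed.

Lemma generated_translation (m : 'cV[C]_3) (ell : 'cV[R]_3) g :
  generated (translations m ell) g -> exists n : 'I_3 -> int, forall p,
    g p = (p.1 + \sum_j (n j)%:~R * m j 0, p.2 + (\sum_j (n j)%:~R * ell j 0)%:C%C).
Proof.
have sum1 (K : pzRingType) (n : 'I_3 -> int) (v : 'cV[K]_3) (j : 'I_3) (e : int) :
    \sum_i (n i + (i == j)%:R * e)%:~R * v i 0 =
    \sum_i (n i)%:~R * v i 0 + e%:~R * v j 0.
  rewrite -[X in _ + X](_ : \sum_i ((i == j)%:R * e)%:~R * v i 0 = _); last first.
    rewrite (bigD1 j) //= eqxx mul1r big1 ?addr0 // => i ij.
    by rewrite (negbTE ij) mul0r mul0r.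
  by rewrite -big_split; apply: eq_bigr => i _ /=; rewrite -mulrDl -intrD.
elim=> [|s h [j _ <-] _ [n hE]|s s' h [j _ <-] c1 c2 _ [n hE]].
- exists (fun=> 0) => -[z w] /=.
  by rewrite !big1 ?addr0 // => i _; rewrite mul0r.
- exists (fun i => n i + (i == j)%:R * 1) => p.
  rewrite (sum1 C) (sum1 R) /= hE /Defs.ftrans /= !mul1r -addrA; congr pair.
  by rewrite rmorphD addrA.
- have s'E p : s' p = (p.1 - m j 0, p.2 - (ell j 0)%:C%C).
    by rewrite -[RHS]c1 /Defs.ftrans /= !subrK; case: p.
  exists (fun i => n i + (i == j)%:R * -1) => p.
  rewrite (sum1 C) (sum1 R) /= s'E hE /= !mulN1r -addrA; congr pair.
  by rewrite rmorphB addrA.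
Qed.

(** Applying A - a and then A - b to the relation removes x and then y, leaving u (c - a)(c - b) z =
    0. *)
Lemma eigenvectors_free (A : 'M[C]_3) (a b c : C) (x y z : 'rV[C]_3) (s t u : C) :
  x != 0 -> y != 0 -> z != 0 -> a != b -> a != c -> b != c ->
  x *m A = a *: x -> y *m A = b *: y -> z *m A = c *: z ->
  s *: x + t *: y + u *: z = 0 -> [/\ s = 0, t = 0 & u = 0].
Proof.
move=> x0 y0 z0 ab ac bc xA yA zA H.
have step (e : C) (v : 'rV[C]_3) : v *m (A - e%:M) = v *m A - e *: v.
  by rewrite mulmxBr mul_mx_scalar.
have H1 := congr1 (fun v => v *m (A - a%:M)) H.
rewrite mul0mx !mulmxDl -!scalemxAl !step xA yA zA -!scalerBl subrr scale0r scaler0 add0r in H1.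
have H2 := congr1 (fun v => v *m (A - b%:M)) H1.
rewrite mul0mx !mulmxDl -!scalemxAl !step yA zA -!scalerBl subrr scale0r !scaler0 add0r in H2.
have u0 : u = 0.
  move/eqP: H2; rewrite !scaler_eq0 (negbTE z0) !subr_eq0 orbF.
  by rewrite [c == a]eq_sym [c == b]eq_sym (negbTE ac) (negbTE bc) !orbF => /eqP.
have t0 : t = 0.
  move/eqP: H1; rewrite u0 scale0r addr0 !scaler_eq0 (negbTE y0) subr_eq0 orbF.
  by rewrite [b == a]eq_sym (negbTE ab) orbF => /eqP.
split=> //; move/eqP: H; rewrite u0 t0 !scale0r !addr0 scaler_eq0 (negbTE x0) orbF.
by move/eqP.
Qed.

Lemma eigen_row (A : 'M[int]_3) (K : comPzRingType) (v : 'cV[K]_3) (a : K) :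
  map_mx (fun z : int => z%:~R) A *m v = a *: v ->
  v^T *m (map_mx (fun z : int => z%:~R) A)^T = a *: v^T.
Proof. by move=> h; rewrite -trmx_mul h linearZ. Qed.

(** An integer vector is recovered from its products with the three eigenvectors by an inverse
    matrix; small products force entries of modulus less than 1. The product with conj m is small
    because it is conjugate to the one with m. *)
Lemma lattice_discrete (A : 'M[int]_3) (lam : R) (mu : C) (ell : 'cV[R]_3) (m : 'cV[C]_3) :
  complex.Im mu != 0 -> ell != 0 ->
  map_mx (fun a : int => a%:~R) A *m ell = lam *: ell ->
  m != 0 -> map_mx (fun a : int => a%:~R) A *m m = mu *: m ->
  exists2 d : R, 0 < d & forall n : 'I_3 -> int,
    nrm (\sum_j (n j)%:~R * m j 0 : C) < d -> `|\sum_j (n j)%:~R * ell j 0| < d ->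
    n =1 (fun=> 0).
Proof.
move=> mu0 ell0 ellE m0 mE.
pose Ac : 'M[C]_3 := (map_mx (fun a : int => a%:~R) A)^T.
pose x : 'rV[C]_3 := (map_mx (real_complex R) ell)^T.
pose y : 'rV[C]_3 := m^T.
pose z : 'rV[C]_3 := (map_mx (@Num.conj C) m)^T.
have mapA (f : {rmorphism R -> C}) :
    map_mx (fun a : int => a%:~R) A = map_mx f (map_mx (fun a : int => a%:~R) A) :> 'M[C]_3.
  by apply/matrixP => i j; rewrite !mxE rmorph_int.
have mapAc (f : {rmorphism C -> C}) :
    map_mx (fun a : int => a%:~R) A = map_mx f (map_mx (fun a : int => a%:~R) A) :> 'M[C]_3.
  by apply/matrixP => i j; rewrite !mxE rmorph_int.
have xA : x *m Ac = lam%:C%C *: x.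
  by apply: eigen_row; rewrite (mapA (real_complex R)) -map_mxM ellE map_mxZ.
have yA : y *m Ac = mu *: y by exact: eigen_row.
have zA : z *m Ac = mu^* *: z.
  by apply: eigen_row; rewrite (mapAc (@Num.conj C)) -map_mxM mE map_mxZ.
have x0 : x != 0 by rewrite trmx_eq0 map_mx_eq0.
have y0 : y != 0 by rewrite trmx_eq0.
have z0 : z != 0 by rewrite trmx_eq0 map_mx_eq0.
have lm : (lam%:C%C : C) != mu by apply: contraNneq mu0 => <-.
have lmc : (lam%:C%C : C) != mu^*.
  by apply: contraNneq mu0; rewrite conjCE; case: (mu) => a b [_ /= /eqP]; rewrite eq_sym oppr_eq0.
have mmc : mu != mu^*.
  apply: contraNneq mu0; rewrite conjCE; case: (mu) => a b [/=].
  by move=> h; apply/eqP; lra.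
(* Rows ell, m, conj m: then P applied to an integer column lists the two translation components and
   the conjugate of the complex one. *)
pose r (i : 'I_3) : 'rV[C]_3 := [:: x; y; z]`_i.
pose P : 'M[C]_3 := \matrix_i r i.
have Pu : P \in unitmx.
  rewrite -row_free_unit -kermx_eq0; apply/rowV0P => v /sub_kermxP.
  rewrite mulmx_sum_row !big_ord_recl big_ord0 addr0 !rowK /r /= addrA.
  move=> /(eigenvectors_free x0 y0 z0 lm lmc mmc xA yA zA)[v0 v1 v2].
  apply/rowP => i; rewrite mxE; case: i => -[|[|[|//]]] hi.
  - by rewrite -[RHS]v0; congr (v _ _); apply/val_inj.
  - by rewrite -[RHS]v1; congr (v _ _); apply/val_inj.
  - by rewrite -[RHS]v2; congr (v _ _); apply/val_inj.
(* Exceeds the sum of the moduli in each row of the inverse; the added 1 makes this strict. *)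
pose B : R := \sum_i \sum_j nrm (invmx P i j) + 1.
have B0 : 0 < B by rewrite ltr_wpDl // sumr_ge0 // => i _; rewrite sumr_ge0 // => j _; exact: nrm_ge0.
exists B^-1; first by rewrite invr_gt0.
move=> n h1 h2 k.
pose N : 'cV[C]_3 := \col_i (n i)%:~R.
have PN (i : 'I_3) : nrm ((P *m N) i 0) < B^-1.
  rewrite !mxE; under eq_bigr do rewrite !mxE mulrC.
  rewrite /r; case: i => -[|[|[|//]]] hi /=.
  - under eq_bigr do rewrite !mxE -(rmorph_int (real_complex R)) -rmorphM.
    by rewrite -rmorph_sum nrm_real.
  - by under eq_bigr do rewrite !mxE.
  - under eq_bigr do rewrite !mxE -(rmorph_int (@Num.conj C)) -rmorphM.
    by rewrite -rmorph_sum nrm_conj.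
have Nk : (n k)%:~R = \sum_j invmx P k j * (P *m N) j 0.
  by have := congr1 (fun M : 'cV[C]_3 => M k 0) (mulKmx Pu N); rewrite !mxE => <-.
have : nrm ((n k)%:~R : C) < 1.
  have nsum (F : 'I_3 -> C) : nrm (\sum_j F j) <= \sum_j nrm (F j).
    by elim/big_ind2: _ => //; [rewrite nrm0 | move=> u1 u2 v1 v2 l1 l2; rewrite (le_trans (nrmD _ _)) // lerD].
  rewrite Nk (le_lt_trans (nsum _)) //.
  have le1 : \sum_j nrm (invmx P k j * (P *m N) j 0) <= (\sum_j nrm (invmx P k j)) * B^-1.
    rewrite mulr_suml; apply: ler_sum => j _; rewrite nrmM ler_wpM2l ?nrm_ge0 //.
    exact/ltW.
  rewrite (le_lt_trans le1) // ltr_pdivrMr // mul1r /B [X in _ < X + 1](bigD1 k) //= -addrA ltrDl.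
  rewrite ltr_wpDl // sumr_ge0 // => i _; rewrite sumr_ge0 // => j _; exact: nrm_ge0.
have -> : ((n k)%:~R : C) = ((n k)%:~R : R)%:C%C by rewrite rmorph_int.
rewrite nrm_real -intr_norm -[1]/(1%:~R) ltr_int.
by case: (n k) => -[|?].
Qed.

End Lattice.

(** * The local immersion of the covering and its fullness *)

Section LocalImmersion.
Variable R : realType.
Local Notation C := (Cplx R).

Lemma pullback_constant_form N (F G : C * C -> cspace R N)
    (omega : cspace R N -> cspace R N -> C) (p q u v : C * C) :
  'd F p = 'd G q :> (C * C -> cspace R N) ->
  pullback F (fun=> omega) p u v = pullback G (fun=> omega) q u v.
Proof.
by move=> dE; exact: (congr2 omega (congr1 (@^~ u) dE) (congr1 (@^~ v) dE)).
Qed.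

Definition bidisc (p0 : C * C) (r : R) : set (C * C) :=
  [set p | nrm (p.1 - p0.1) < r /\ nrm (p.2 - p0.2) < r].

Lemma bidisc_center p0 r : 0 < r -> bidisc p0 r p0.
Proof. by move=> r0; rewrite /bidisc /= !subrr nrm0. Qed.

Lemma bidisc_upper p0 r p : r <= complex.Im p0.2 -> bidisc p0 r p -> upper p.
Proof.
move=> r0 [_ h]; have := le_Im_nrm (p.2 - p0.2); rewrite /upper /= raddfB /= => h2.
have := le_lt_trans h2 h; rewrite ltr_norml => /andP[h3 _].
by move: h3 r0; move: (complex.Im p.2) (complex.Im p0.2) => a b; lra.
Qed.

Lemma near_bidisc_translate p0 r (v p : C * C) : bidisc p0 r (p + v) ->
  \forall q \near p, bidisc p0 r (q + v).
Proof.
have aux (z z0 a : C) : nrm (z + a - z0) < r -> \forall x \near z, nrm (x + a - z0) < r.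
  move=> h; apply/near_nrmP; exists (r - nrm (z + a - z0)); first by rewrite subr_gt0.
  move=> x hx; have := nrmD (x - z) (z + a - z0); rewrite !addrA subrK.
  by move: hx; rewrite ltrBrDr => hx h2; exact: le_lt_trans h2 hx.
move=> [/= /aux h1 /aux h2].
have k1 : \forall q \near p, nrm (q.1 + v.1 - p0.1) < r by exact: (cvg_fst h1).
have k2 : \forall q \near p, nrm (q.2 + v.2 - p0.2) < r by exact: (cvg_snd h2).
exact: filterS2 k1 k2.
Qed.

(** On a bidisc small compared with the lattice the projection to orbits is injective, so the
    explicit map descends to its image. *)
Lemma has_local_full_kahler_immersion_discrete (c d : R) (m : 'cV[C]_3) (ell : 'cV[R]_3) :
  0 < c -> 0 < d ->
  (forall n : 'I_3 -> int, nrm (\sum_j (n j)%:~R * m j 0 : C) < d ->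
     `|\sum_j (n j)%:~R * ell j 0| < d -> n =1 (fun=> 0)) ->
  has_local_full_kahler_immersion c m ell.
Proof.
move=> c0 d0 discr _ [p0 up0 <-].
pose S := translations m ell; pose O := Defs.orbit S.
have h0 : 0 < complex.Im p0.2 := up0.
have gT g : generated S g -> exists v : C * C,
    [/\ g = (fun p => p + v), complex.Im v.2 = 0 & nrm v.1 < d -> nrm v.2 < d -> v = 0].
  move=> /generated_translation[n gE].
  exists (\sum_j (n j)%:~R * m j 0, (\sum_j (n j)%:~R * ell j 0)%:C%C); split=> //.
    by apply/funext => p; rewrite gE.
  rewrite nrm_real /= => h1 h2; have n0 := discr n h1 h2.
  by congr pair; rewrite ?(rmorph0 (real_complex R)) big1 // => j _; rewrite n0 mul0r.
(* The first bound keeps the bidisc in C x H; the second makes two of its points differ by less than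
   d in each coordinate, so that orbits meet it at most once. *)
pose r := Num.min (complex.Im p0.2) (d / 2).
have r0 : 0 < r by rewrite lt_min h0 divr_gt0.
have ry : r <= complex.Im p0.2 by rewrite ge_min lexx.
have rd : r + r <= d.
  have : r <= d / 2 by rewrite ge_min lexx orbT.
  by lra.
pose B := bidisc p0 r.
have Bp0 : B p0 by exact: bidisc_center.
have Bup p : B p -> upper p by exact: bidisc_upper.
have Buniq g q : generated S g -> B q -> B (g q) -> g q = q.
  move=> /gT[v [-> _ v0]] [q1 q2] [/= gq1 gq2].
  have near2 (a b e : C) : nrm (a - b) < r -> nrm (a + e - b) < r -> nrm e < d.
    move=> h1 h2; have -> : e = (a + e - b) - (a - b).
      by rewrite opprB addrA subrK addKC.
    by rewrite (le_lt_trans (nrmB _ _)) // (lt_le_trans (ltrD h2 h1)).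
  by rewrite v0 ?addr0 //; [exact: near2 q1 gq1 | exact: near2 q2 gq2].
have Oinv g q : generated S g -> O (g q) = O q.
  by apply: orbit_generated; exact: translations_inv.
pose k := (Num.sqrt c)^-1; pose a := (Num.sqrt (2 * complex.Im p0.2))^-1.
have k0 : k != 0 by rewrite invr_eq0 sqrtr_eq0 -ltNge.
have a0 : a != 0 by rewrite invr_eq0 sqrtr_eq0 -ltNge mulr_gt0.
pose Phi := tricerri_immersion k a p0.2.
(* By [Buniq] the representative in [B] of an orbit in [V] is unique; p0 is the default value for
   other sets. *)
pose F X : cspace R None := Phi (xget p0 (X `&` B)).
have FB q : B q -> F (O q) = Phi q.
  move=> Bq; rewrite /F; congr Phi.
  have [[g gg <-] Bg] : (O q `&` B) (xget p0 (O q `&` B)).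
    by apply: xgetPex; exists q; split=> //; exists idfun => //; exact: gen_id.
  exact: Buniq.
pose V := O @` B.
have preV p : cover_preimage m ell V p -> exists v : C * C,
    [/\ generated S (fun q => q + v), complex.Im v.2 = 0 & B (p + v)].
  move=> [_ [q Bq qp]]; have [g gg qE] := orbit_eqP qp.
  have [v [gE v0 _]] := gT g gg; exists v; rewrite -gE; split=> //.
  by move: Bq; rewrite qE gE.
have dF p : cover_preimage m ell V p -> exists v : C * C,
    [/\ complex.Im v.2 = 0, B (p + v), (F \o O) p = Phi (p + v),
        differentiable (F \o O) p & 'd (F \o O) p = 'd Phi (p + v) :> (C * C -> _)].
  move=> /preV[v [gv v0 Bv]]; exists v.
  (* A point of the preimage of [V] may lie outside [B], but a translate p + v is in it; near p the
     lift of [F] is then [Phi] composed with this translation. *)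
  have nF : \forall q \near p, Phi (q + v) = (F \o O) q.
    apply: filterS (near_bidisc_translate Bv) => q Bq.
    by rewrite /= -(Oinv _ q gv) FB.
  have dP := is_diff_tricerri_immersion k a h0 (Bup _ Bv).
  have dt : is_diff p (fun q => q + v) id.
    apply: (is_diff_eq (is_diffD (is_diff_id p) (is_diff_cst v p))).
    by apply/funext => h; exact: addr0.
  have D := is_diff_near_eq nF (is_diff_comp dt dP).
  split; [exact: v0 | exact: Bv | by rewrite (nbhs_singleton nF) | exact: (@ex_diff _ _ _ _ _ _ _ D) |].
  exact: etrans (@diff_val _ _ _ _ _ _ _ D) (esym (@diff_val _ _ _ _ _ _ _ dP)).
exists V, F; split; first by exists p0.
  split; first by move=> _ [q Bq <-]; exists q => //; exact: Bup.
  rewrite openE => p Vp; have [v [gv v0 Bv]] := preV p Vp.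
  apply: filterS (near_bidisc_translate Bv) => q Bq; split.
    by have := Bup _ Bq; rewrite /upper /= raddfD /= v0 addr0.
  by exists (q + v) => //; exact: (Oinv _ q gv).
split.
- move=> p /dF[v [v0 Bv FE dFp _]]; split; first exact: dFp.
  have Fn : (F \o O) p != 0 by rewrite FE; exact: tricerri_immersion_neq0 h0 (Bup _ Bv) k0 a0.
  exact: Fn.
- move=> p u w /dF[v [v0 Bv FE dFp dE]].
  have pE : pullback (F \o O) (fun=> @flat_form R c None) p u w =
      pullback Phi (fun=> @flat_form R c None) (p + v) u w by exact: pullback_constant_form dE.
  (* Translations are real in the second variable, so the form, which depends on the point through
     Im w only, is unchanged. *)
  have tE : tricerri_kahler_form (p + v) u w = tricerri_kahler_form p u w.
    by rewrite /tricerri_kahler_form /tricerri_form /= raddfD /= v0 addr0.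
  exact: (etrans pE (etrans (tricerri_immersion_pullback u w c0 h0 (Bup _ Bv)) tE)).
move=> [M [subM geoM propM FM]].
have MPhi q : B q -> M (Phi q).
  by move=> Bq; rewrite -FB //; apply: FM; exists (O q) => //; exists q.
have [T [clT linT Ttan [e e0 Te]]] := flat_submanifold_local subM geoM (MPhi p0 Bp0).
(* The inclusion of M - Phi p0 in T is local, so the bidisc is shrunk until its image is within e of
   Phi p0. *)
have [r1 r10 Hr1] : exists2 d : R, 0 < d & forall x, nrm (x - p0) < d -> nrm (Phi x - Phi p0) < e.
  apply/near_nrmP.
  have dP := is_diff_tricerri_immersion k a h0 up0.
  have cP := differentiable_continuous (@ex_diff _ _ _ _ _ _ _ dP).
  have hB : \forall y \near Phi p0, nrm (y - Phi p0) < e by apply/near_nrmP; exists e.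
  exact: (cP _ hB).
have TT : T = setT.
  pose r2 := Num.min r (r1 / 2).
  apply: (@tricerri_immersion_span R k a p0.2 p0.1 r2 T) => //.
    by rewrite lt_min r0 divr_gt0.
  move=> p; rewrite lt_min => /andP[p1 p1']; rewrite lt_min => /andP[p2 p2'].
  rewrite -surjective_pairing; apply: Te; first by apply: MPhi; split.
  apply: Hr1; rewrite (le_lt_trans (nrm_pair_le _)) //=.
  by rewrite [r1]splitr ltrD.
(* The tangent space contains T, hence everything, contradicting positive codimension. *)
have /eqP := propM _ (MPhi p0 Bp0); apply; apply/seteqP; split=> // v _.
by apply: Ttan; rewrite TT.
Qed.

End LocalImmersion.

Theorem mainTheorem14 (R : realType) (A : 'M[int]_3)
    (lam : R) (mu : Cplx R) (ell : 'cV[R]_3) (m : 'cV[Cplx R]_3) (c : R)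
    (detA : \det A = 1)
    (lam_gt1 : 1 < lam)
    (mu_nonreal : complex.Im mu != 0)
    (ell_neq0 : ell != 0)
    (eigen_ell : map_mx (fun a : int => a%:~R) A *m ell = lam *: ell)
    (m_neq0 : m != 0)
    (eigen_m : map_mx (fun a : int => a%:~R) A *m m = mu *: m)
    (c_gt0 : 0 < c) :
  has_local_full_kahler_immersion c m ell /\ ~ hopf_induced c mu lam m ell.
Proof.
split; last exact: not_hopf_induced.
have [d d0 discr] := lattice_discrete mu_nonreal ell_neq0 eigen_ell m_neq0 eigen_m.
exact: has_local_full_kahler_immersion_discrete c_gt0 d0 discr.
Qed.
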